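(* Suppose that the functions $f_i,g_i$, the random vector $\xi=(\xi^1,\dots,\xi^L)$ and the step sequence $(\gamma_n)$ satisfy Assumptions 1, 2, 3, 4 and 5 listed in the context. Let $(x_n)$ and $(\bar x_{n}^i)$ be the iterates and intermediate variables defined in the context. Then there exists a random variable $X_\star$ such that $\mathbb P(X_\star\in\mathcal Z)=1$ and such that $(x_n)$ converges almost surely to $X_\star$ as $n\to\infty$. Moreover, for every $i=0,\dots,L-1$, $\bar x_n^i$ converges almost surely to $X_\star$ as $n\to\infty$.
   Context: Setting. $(\Omega,\mathcal F,\mathbb P)$ is a probability space with expectation $\mathbb E$; $(\Xi,\mathcal X)$ is an arbitrary measurable space; $\mathsf X$ is a Euclidean space with Borel $\sigma$-field $\mathscr B(\mathsf X)$; $L\ge 1$ is an integer. A map $f:\mathsf X\times\Xi\to\mathbb R$ is a normal convex integrand if it is $\mathscr B(\mathsf X)\otimes\mathcal X$-measurable and $f(\cdot,s)$ is convex for every $s\in\Xi$. For $i=1,\dots,L$, $\xi^i:\Omega\to\Xi$ is a random variable (the $\xi^i$ need not be independent), and $f_i,g_i:\mathsf X\times\Xi\to\mathbb R$. Put $\xi=(\xi^1,\dots,\xi^L)$. For a convex function $g:\mathsf X\to\mathbb R$, $\mathrm{prox}_g(y)=\arg\min_x\big(g(x)+\tfrac12\|x-y\|^2\big)$, and $\partial g$ is its subdifferential. $\nabla f_i(\cdot,s)$ and $\partial g_i(\cdot,s)$ are the gradient and the subdifferential with respect to the first variable, and $\partial g_i^0(x,s)$ is the least-norm element of $\partial g_i(x,s)$.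 $\mathcal Z$ is the set of minimizers over $x\in\mathsf X$ of $\sum_{i=1}^L\mathbb E[f_i(x,\xi^i)+g_i(x,\xi^i)]$. Algorithm. For $\gamma>0$, $\mathsf T_{\gamma,i}(x,s)=\mathrm{prox}_{\gamma g_i(\cdot,s)}(x-\gamma\nabla f_i(x,s))$. Let $(\xi_n)_{n\ge1}$, $\xi_n=(\xi_n^1,\dots,\xi_n^L)$, be i.i.d. copies of $\xi$ defined on $(\Omega,\mathcal F,\mathbb P)$, let $(\gamma_n)_{n\ge1}$ be a positive sequence, and let $x_0\in\mathsf X$ be deterministic. For $n\ge0$ define $\bar x_{n+1}^0=x_n$, $\bar x_{n+1}^i=\mathsf T_{\gamma_{n+1},i}(\bar x_{n+1}^{i-1},\xi_{n+1}^i)$ for $i=1,\dots,L$, and $x_{n+1}=\bar x_{n+1}^L$. Representations. For $x_\star\in\mathcal Z$, a family $(\nabla f_i(x_\star,\xi^i),\varphi_i(\xi^i))_{i=1,\dots,L}$ is a representation of $x_\star$ if $\varphi_1,\dots,\varphi_L:\Xi\to\mathsf X$ are measurable maps with each $\varphi_i(\xi^i)$ integrable, $\varphi_i(\xi^i)\in\partial g_i(x_\star,\xi^i)$ $\mathbb P$-a.e. for every $i$, and $0=\sum_{i=1}^L\big(\mathbb E[\nabla f_i(x_\star,\xi^i)]+\mathbb E[\varphi_i(\xi^i)]\big)$. For $\alpha\ge1$, it is $\alpha$-integrable if moreover $\mathbb E[\|\nabla f_i(x_\star,\xi^i)\|^\alpha]<\infty$ and $\mathbb E[\|\varphi_i(\xi^i)\|^\alpha]<\infty$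 for every $i$. Assumption 1. For all $i$: (1) $f_i$ and $g_i$ are normal convex integrands; (2) for every $x\in\mathsf X$, $\mathbb E|f_i(x,\xi^i)|<\infty$ and $\mathbb E|g_i(x,\xi^i)|<\infty$; (3) for every $s\in\Xi$, $f_i(\cdot,s)$ is differentiable. Assumption 2. The positive sequence $(\gamma_n)$ satisfies $\sum\gamma_n=+\infty$, $\sum\gamma_n^2<\infty$, and $\gamma_{n+1}/\gamma_n\to1$. Assumption 3. For all $i$: (1) there is a measurable map $K_i:\Xi\to\mathbb R_+$ such that, $\mathbb P$-a.e., for all $x,y\in\mathsf X$, $\|\nabla f_i(x,\xi^i)-\nabla f_i(y,\xi^i)\|\le K_i(\xi^i)\|x-y\|$; (2) for all $\alpha>0$, $\mathbb E[K_i(\xi^i)^\alpha]<\infty$. Assumption 4. (1) $\mathcal Z$ is not empty; (2) for every $x_\star\in\mathcal Z$ there exists $\varepsilon>0$ such that $x_\star$ admits a $(2+\varepsilon)$-integrable representation. Assumption 5. For every compact set $\mathcal K\subset\mathsf X$ there exists $\eta>0$ such that for all $i=1,\dots,L$, $\sup_{x\in\mathcal K}\mathbb E[\|\partial g_i^0(x,\xi^i)\|^{1+\eta}]<\infty$. *)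

(* Defs.v *)
From HB Require Import structures.
From mathcomp Require Import all_boot all_order all_algebra finmap.
From mathcomp Require Import all_classical all_reals all_analysis.

Set Implicit Arguments.
Unset Strict Implicit.
Unset Printing Implicit Defensive.

Import Order.TTheory GRing.Theory Num.Theory.
Import numFieldNormedType.Exports.

Local Open Scope classical_set_scope.
Local Open Scope ring_scope.

(* The Euclidean space is 'rV[R]_d with the standard inner product, d = 0 being
   allowed. The norm `|x| that the library puts on 'rV[R]_d is the sup norm; it
   is used only through its topology, which is the Euclidean one. *)
Section euclidean.
Context {R : realType} {d : nat}.
Implicit Types (x y v : 'rV[R]_d) (h : 'rV[R]_d -> R).

Definition dotv x y : R := \sum_(j < d) x 0 j * y 0 j.

Definition enorm x : R := Num.sqrt (dotv x x).

(* This is the gradient where [h] is differentiable. *)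
Definition grad h x : 'rV[R]_d := \row_j 'D_(delta_mx 0 j) h x.

Definition subdiff h x : set 'rV[R]_d :=
  [set v | forall y, h x + dotv v (y - x) <= h y].

(* [get] selects the element of the set it is applied to; for a (finite) convex
   [h] this set is a singleton, here and in [prox]. *)
Definition subdiff0 h x : 'rV[R]_d :=
  get [set v | subdiff h x v /\ forall u, subdiff h x u -> enorm v <= enorm u].

Definition prox h y : 'rV[R]_d :=
  get [set p | forall x,
    h p + 2^-1 * enorm (p - y) ^+ 2 <= h x + 2^-1 * enorm (x - y) ^+ 2].

End euclidean.

Notation borel_rV R d := (g_sigma_algebraType (@open 'rV[R]_d)).

Definition normal_convex_integrand (R : realType) (d : nat)
    (dX : measure_display) (Xi : measurableType dX)
    (f : 'rV[R]_d -> Xi -> R) : Prop :=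
  measurable_fun [set: borel_rV R d * Xi] (fun p => f p.1 p.2) /\
  forall s, convex_function setT (f ^~ s : _ -> R^o).

Section probability.
Context {dO dS : measure_display} {Omega : measurableType dO}
  {S : measurableType dS} {R : realType} (P : probability Omega R).

Definition mutually_independent (X : nat -> {RV P >-> S}) : Prop :=
  forall (J : {fset nat}) (A : nat -> set S), (forall n, measurable (A n)) ->
    P (\bigcap_(n in [set` J]) (X n @^-1` A n)) =
    (\prod_(n <- J) P (X n @^-1` A n))%E.

(* Equality of laws is required on measurable sets only: [P] takes
   unspecified values elsewhere. *)
Definition iid_copies (X : {RV P >-> S}) (Xs : nat -> {RV P >-> S}) : Prop :=
  mutually_independent Xs /\
  forall n A, measurable A -> distribution P (Xs n) A = distribution P X A.

Definition integrable_rV (d : nat) (V : Omega -> 'rV[R]_d) : Prop :=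
  forall j, P.-integrable setT (fun w => (V w 0 j)%:E).

Definition expectation_rV (d : nat) (V : Omega -> 'rV[R]_d) : 'rV[R]_d :=
  \row_j \int[P]_w (V w 0 j).

End probability.

(* The indices 1, ..., L of the functions and of the components of xi are
   represented by the elements 0, ..., L - 1 of 'I_L. *)
Section setting.
Context {dO dX : measure_display} {Omega : measurableType dO}
  {Xi : measurableType dX} {R : realType} {d L : nat}
  (P : probability Omega R) (f g : 'I_L -> 'rV[R]_d -> Xi -> R)
  (xi : {RV P >-> L.-tuple Xi}).

Let xi_ (i : 'I_L) (w : Omega) : Xi := tnth (xi w) i.

Definition minimizers : set 'rV[R]_d :=
  let F x := (\sum_(i < L)
    'E_P[fun w => (f i x (xi_ i w) + g i x (xi_ i w))%R])%E in
  [set x | forall y, (F x <= F y)%E].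

Definition representation (x : 'rV[R]_d) (phi : 'I_L -> Xi -> 'rV[R]_d) :=
  [/\ forall i, measurable_fun setT (phi i : Xi -> borel_rV R d),
      forall i, integrable_rV P (phi i \o xi_ i),
      forall i, {ae P, forall w, subdiff (g i ^~ (xi_ i w)) x (phi i (xi_ i w))} &
      0 = \sum_(i < L) (expectation_rV P (fun w => grad (f i ^~ (xi_ i w)) x)
                        + expectation_rV P (phi i \o xi_ i))].

Definition integrable_representation (alpha : R) (x : 'rV[R]_d)
    (phi : 'I_L -> Xi -> 'rV[R]_d) : Prop :=
  representation x phi /\
  forall i, ('E_P[fun w => (enorm (grad (f i ^~ (xi_ i w)) x) `^ alpha)%R] < +oo)%E
         /\ ('E_P[fun w => (enorm (phi i (xi_ i w)) `^ alpha)%R] < +oo)%E.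

Definition assumption_integrands : Prop := forall i,
  [/\ normal_convex_integrand (f i) /\ normal_convex_integrand (g i),
      forall x, ('E_P[fun w => `|f i x (xi_ i w)|%R] < +oo)%E /\
                ('E_P[fun w => `|g i x (xi_ i w)|%R] < +oo)%E &
      forall s x, differentiable (f i ^~ s) x].

Definition assumption_steps (gamma : nat -> R) : Prop :=
  [/\ forall n, (0 < n)%N -> 0 < gamma n,
      (\sum_(1 <= n <oo) (gamma n)%:E = +oo)%E,
      (\sum_(1 <= n <oo) (gamma n ^+ 2)%:E < +oo)%E &
      (gamma n.+1 / gamma n) @[n --> \oo] --> (1 : R)].

Definition assumption_lipschitz : Prop := forall i, exists K : Xi -> R,
  [/\ measurable_fun setT K, forall s, 0 <= K s,
      {ae P, forall w, forall x y,
        enorm (grad (f i ^~ (xi_ i w)) x - grad (f i ^~ (xi_ i w)) y)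
          <= K (xi_ i w) * enorm (x - y)} &
      forall alpha : R, 0 < alpha ->
        ('E_P[fun w => (K (xi_ i w) `^ alpha)%R] < +oo)%E].

Definition assumption_representation : Prop :=
  minimizers !=set0 /\
  forall x, minimizers x -> exists2 eps : R, 0 < eps &
    exists phi, integrable_representation (2 + eps) x phi.

Definition assumption_subgradient : Prop :=
  forall K : set 'rV[R]_d, compact K -> exists2 eta : R, 0 < eta &
    forall i, (ereal_sup
      [set 'E_P[fun w => (enorm (subdiff0 (g i ^~ (xi_ i w)) x)
                           `^ (1 + eta))%R] | x in K] < +oo)%E.

Definition forward_backward (gamma : R) (i : 'I_L) (x : 'rV[R]_d) (s : Xi) :=
  prox (fun y => gamma * g i y s) (x - gamma *: grad (f i ^~ s) x).

(* [xbar n i] is used for 0 < n and i <= L; other values are irrelevant. *)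
Definition iterates (gamma : nat -> R) (xis : nat -> {RV P >-> L.-tuple Xi})
    (x0 : 'rV[R]_d) (x : nat -> Omega -> 'rV[R]_d)
    (xbar : nat -> nat -> Omega -> 'rV[R]_d) : Prop :=
  forall w, x 0%N w = x0 /\ forall n,
    [/\ xbar n.+1 0%N w = x n w,
        forall i : 'I_L, xbar n.+1 i.+1 w =
          forward_backward (gamma n.+1) i (xbar n.+1 i w) (tnth (xis n.+1 w) i) &
        x n.+1 w = xbar n.+1 L w].

End setting.

(* Main.v *)
(* For a minimizer z with representation (grad f_i(z, .), phi_i), a pass with step c
   and sample s satisfies
     |x' - z|^2 <= |x - z|^2 - 2 c G - (1/4) sum_i |y_i - y_(i-1)|^2
                   - 2 c <N, x - z> + c^2 B (1 + |x - z|^2),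
   where the y_i are the intermediate points, G >= 0 is the sum of the Bregman gaps
   of the f_i and g_i at z, N is the sum of the grad f_i(z, s_i) + phi_i(s_i), which
   is centred, and B is integrable. As the sample is independent of the past,
   E |x_n - z|^2 stays bounded, the terms in N form an almost surely convergent
   martingale, |x_n - z| converges almost surely, and the sum over n of c_n times the
   conditional expectation of G is finite. The steps are not summable, so this
   conditional expectation tends to 0 along a subsequence on which x_n converges;
   by Fatou's lemma the limit is a minimizer. Applied to a countable dense set of
   minimizers, Opial's argument gives the convergence of (x_n), and the summability
   of the squared moves that of the intermediate points. *)

Require Import Defs.
From HB Require Import structures.
From mathcomp Require Import all_boot all_order all_algebra finmap.
From mathcomp Require Import all_classical all_reals all_analysis.
From mathcomp Require Import measurable_realfun ring lra.

Set Implicit Arguments.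
Unset Strict Implicit.
Unset Printing Implicit Defensive.

Import Order.TTheory GRing.Theory Num.Theory.
Import numFieldNormedType.Exports.

Local Open Scope classical_set_scope.
Local Open Scope ring_scope.

(** * Euclidean space *)

(** The Lipschitz and subgradient conditions hold off null events that need not be measurable, and
    the random iterates test them at uncountably many points. For a fixed [z] they are replaced by
    countably many inequalities that define a measurable set [good] of samples: affine minorants of
    the g_i and quadratic majorants of the f_i at [z]. The majorant is used because it is continuous
    in the tested point and, by convexity, returns |grad f_i(y) - grad f_i(z)| <= 4 K_i |y - z|, the
    only form of the Lipschitz condition used afterwards. Within one pass the points depend on the
    same sample as the K_i, so their distance to [z] is controlled only up to a power of 1 + sum_i
    K_i. Thus B is the square of such a power times the size of the representation; Young's
    inequality makes it integrable, at the price of all moments of the K_i and of an exponent above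
    2 for the representation. Conditioning on the past is done by integrating over the law of one
    fresh sample, and centring is expressed as orthogonality to bounded functions of the past. The
    null events vary with [z], so the minimizers to be tested are fixed as a sequence before the
    path is. *)

Section euclidean_theory.
Context {R : realType} {d : nat}.
Implicit Types (x y z u v : 'rV[R]_d) (c : R).

Lemma dotvC x y : dotv x y = dotv y x.
Proof. by apply: eq_bigr => j _; rewrite mulrC. Qed.

Lemma dotvDl x y z : dotv (x + y) z = dotv x z + dotv y z.
Proof. by rewrite -big_split; apply: eq_bigr => j _ /=; rewrite mxE mulrDl. Qed.

Lemma dotvZl c x y : dotv (c *: x) y = c * dotv x y.
Proof. by rewrite mulr_sumr; apply: eq_bigr => j _; rewrite mxE mulrA. Qed.

Lemma dotvNl x y : dotv (- x) y = - dotv x y.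
Proof. by rewrite -scaleN1r dotvZl mulN1r. Qed.

Lemma dotvBl x y z : dotv (x - y) z = dotv x z - dotv y z.
Proof. by rewrite dotvDl dotvNl. Qed.

Lemma dotvDr x y z : dotv x (y + z) = dotv x y + dotv x z.
Proof. by rewrite dotvC dotvDl !(dotvC x). Qed.

Lemma dotvZr c x y : dotv x (c *: y) = c * dotv x y.
Proof. by rewrite dotvC dotvZl dotvC. Qed.

Lemma dotvNr x y : dotv x (- y) = - dotv x y.
Proof. by rewrite dotvC dotvNl dotvC. Qed.

Lemma dotv0l x : dotv 0 x = 0.
Proof. by rewrite -(scale0r x) dotvZl mul0r. Qed.

Lemma dotv0r x : dotv x 0 = 0.
Proof. by rewrite dotvC dotv0l. Qed.

Lemma dotv_suml (I : Type) (r : seq I) (F : I -> 'rV[R]_d) x :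
  dotv (\sum_(i <- r) F i) x = \sum_(i <- r) dotv (F i) x.
Proof.
elim/big_rec2 : _ => [|i a b _ <-]; first by rewrite dotv0l.
by rewrite dotvDl.
Qed.

Definition dotvE := (dotvDl, dotvDr, dotvNl, dotvNr, dotvZl, dotvZr).

Lemma dotv_ge0 x : 0 <= dotv x x.
Proof. by apply: sumr_ge0 => j _; rewrite -expr2 sqr_ge0. Qed.

Lemma enorm_ge0 x : 0 <= enorm x.
Proof. exact: sqrtr_ge0. Qed.

Lemma enorm_sqr x : enorm x ^+ 2 = dotv x x.
Proof. by rewrite sqr_sqrtr // dotv_ge0. Qed.

Lemma enorm0 : enorm (0 : 'rV[R]_d) = 0.
Proof. by rewrite /enorm dotv0l sqrtr0. Qed.

Lemma enormN x : enorm (- x) = enorm x.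
Proof. by rewrite /enorm dotvNl dotvNr opprK. Qed.

Lemma enormB x y : enorm (x - y) = enorm (y - x).
Proof. by rewrite -opprB enormN. Qed.

Lemma enormZ c x : enorm (c *: x) = `|c| * enorm x.
Proof.
by rewrite /enorm dotvZl dotvZr mulrA -expr2 sqrtrM ?sqr_ge0 // sqrtr_sqr.
Qed.

Lemma dotv_eq0 x : dotv x x = 0 -> x = 0.
Proof.
move=> /eqP; rewrite psumr_eq0 => [/allP x0|j _]; last by rewrite -expr2 sqr_ge0.
apply/rowP => j; have /= := x0 j (mem_index_enum _).
by rewrite mulf_eq0 orbb mxE => /eqP.
Qed.

Lemma enorm_eq0 x : enorm x = 0 -> x = 0.
Proof. by move=> x0; apply: dotv_eq0; rewrite -enorm_sqr x0 expr0n. Qed.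

(** Cauchy-Schwarz, by expanding the square of [enorm y *: x - enorm x *: y] and dividing by
    [2 * (enorm x * enorm y)]. *)
Lemma dotv_le x y : dotv x y <= enorm x * enorm y.
Proof.
have [x0|x0] := eqVneq (enorm x) 0.
  by rewrite (enorm_eq0 x0) dotv0l enorm0 mul0r.
have [y0|y0] := eqVneq (enorm y) 0.
  by rewrite (enorm_eq0 y0) dotv0r enorm0 mulr0.
have xp : 0 < enorm x by rewrite lt_neqAle eq_sym x0 enorm_ge0.
have yp : 0 < enorm y by rewrite lt_neqAle eq_sym y0 enorm_ge0.
have := dotv_ge0 (enorm y *: x - enorm x *: y).
rewrite !dotvE -!enorm_sqr (dotvC y x) => h.
have {}h : 0 <= 2 * (enorm x * enorm y) * (enorm x * enorm y - dotv x y).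
  by apply: le_trans h _; rewrite le_eqVlt; apply/orP; left; apply/eqP; ring.
rewrite pmulr_rge0 in h; first by lra.
by rewrite !mulr_gt0.
Qed.

Lemma normr_dotv_le x y : `|dotv x y| <= enorm x * enorm y.
Proof.
rewrite ler_norml dotv_le andbT lerNl -dotvNl (le_trans (dotv_le _ _)) //.
by rewrite enormN.
Qed.

Lemma enorm_triangle x y : enorm (x + y) <= enorm x + enorm y.
Proof.
rewrite -(@ler_pXn2r _ 2) ?nnegrE ?addr_ge0 ?enorm_ge0 //.
rewrite sqrrD !enorm_sqr !dotvE (dotvC y x).
by have := dotv_le x y; lra.
Qed.

Lemma enorm_sum (I : Type) (r : seq I) (F : I -> 'rV[R]_d) :
  enorm (\sum_(i <- r) F i) <= \sum_(i <- r) enorm (F i).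
Proof.
elim/big_rec2 : _ => [|i a b _ le_ba]; first by rewrite enorm0.
by rewrite (le_trans (enorm_triangle _ _)) // lerD2l.
Qed.

Lemma coord_le_norm x j : `|x 0 j| <= `|x|.
Proof.
rewrite [leRHS]/Num.Def.normr /= mx_normrE.
by apply/bigmax_geP; right => /=; exists (ord0, j).
Qed.

Lemma norm_le_enorm x : `|x| <= enorm x.
Proof.
rewrite [leLHS]/Num.Def.normr /= mx_normrE; apply/bigmax_leP; split => [|[i j] _] /=.
  exact: enorm_ge0.
rewrite (ord1 i) -(@ler_pXn2r _ 2) ?nnegrE ?enorm_ge0 //.
rewrite enorm_sqr -normrX ger0_norm ?sqr_ge0 // /dotv (bigD1 j) //= -expr2.
by rewrite lerDl sumr_ge0 // => k _; rewrite -expr2 sqr_ge0.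
Qed.

Lemma dotv_delta x j : dotv x (delta_mx 0 j) = x 0 j.
Proof.
rewrite /dotv (bigD1 j) //= mxE !eqxx mulr1 big1 ?addr0 // => k /negPf kj.
by rewrite mxE kj andbF mulr0.
Qed.

(** The triangle inequality over the coordinates gives the factor [d] rather than its square root;
    only the equivalence of the norms matters. *)
Lemma enorm_le_norm x : enorm x <= d%:R * `|x|.
Proof.
have -> : enorm x = enorm (\sum_(j < d) x 0 j *: delta_mx 0 j).
  by rewrite -row_sum_delta.
rewrite (le_trans (enorm_sum _ _)) //.
have -> : d%:R * `|x| = \sum_(j < d) `|x|.
  by rewrite sumr_const card_ord mulr_natl.
apply: ler_sum => j _; rewrite enormZ.
have -> : enorm (delta_mx 0 j : 'rV[R]_d) = 1.
  by rewrite /enorm dotv_delta mxE !eqxx sqrtr1.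
by rewrite mulr1 coord_le_norm.
Qed.

(** Bridge between the topology, which comes from the sup norm, and the estimates, which are all
    Euclidean. *)
Lemma cvg_enormP (T : Type) (F : set_system T) (FF : Filter F)
    (u : T -> 'rV[R]_d) (l : 'rV[R]_d) :
  u @ F --> l <-> enorm (u t - l) @[t --> F] --> (0 : R).
Proof.
split => [ul|ul].
  have n0 : d%:R * `|u t - l| @[t --> F] --> (0 : R).
    rewrite -[0](mulr0 d%:R); apply: cvgMr.
    by rewrite -[0](@normr0 _ 'rV[R]_d) -(subrr l); apply: cvg_norm; apply: cvgB => //; exact: cvg_cst.
  apply: (squeeze_cvgr _ (cvg_cst (0 : R)) n0).
  by apply: nearW => t; rewrite enorm_ge0 enorm_le_norm.
apply/cvgrPdist_le => e e0; move/cvgrPdist_le : ul => /(_ _ e0).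
apply: filterS => t; rewrite sub0r normrN ger0_norm ?enorm_ge0 // distrC.
by apply: le_trans; exact: norm_le_enorm.
Qed.

Section limits.
Context (T : Type) (F : set_system T) (FF : Filter F).

Lemma cvg_enorm (a : T -> 'rV[R]_d) (l : 'rV[R]_d) :
  a @ F --> l -> enorm (a t) @[t --> F] --> enorm l.
Proof.
move=> al; apply/cvgrPdist_le => e e0.
have /cvgrPdist_le/(_ _ e0) := (cvg_enormP FF a l).1 al.
apply: filterS => t; rewrite sub0r normrN ger0_norm ?enorm_ge0 // => h.
apply: le_trans h; rewrite ler_norml; apply/andP; split.
  by have := enorm_triangle (a t - l) l; rewrite subrK; lra.
by have := enorm_triangle (l - a t) (a t); rewrite subrK enormB; lra.
Qed.

Lemma cvg_coord (a : T -> 'rV[R]_d) (l : 'rV[R]_d) j :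
  a @ F --> l -> a t 0 j @[t --> F] --> l 0 j.
Proof.
move=> al; apply/cvgrPdist_le => e e0; move/cvgrPdist_le : al => /(_ _ e0).
apply: filterS => t; apply: le_trans.
by have := coord_le_norm (l - a t) j; rewrite !mxE.
Qed.

Lemma cvg_dotv (a b : T -> 'rV[R]_d) (l m : 'rV[R]_d) :
  a @ F --> l -> b @ F --> m -> dotv (a t) (b t) @[t --> F] --> dotv l m.
Proof.
move=> al bm; apply: cvg_big => //; first exact: add_continuous.
by move=> j _; apply: cvgM; exact: cvg_coord.
Qed.

End limits.

End euclidean_theory.

(** * Convex functions and proximal maps *)

Section convex_functions.
Context {R : realType} {d : nat}.
Implicit Types (x y z u v : 'rV[R]_d) (h : 'rV[R]_d -> R).

(** Convexity with a bare real parameter, suited to linear arithmetic; [convex_function] takes a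
    bundled element of the unit interval. *)
Definition convex_fun h := forall x y (t : R), 0 <= t <= 1 ->
  h (t *: x + (1 - t) *: y) <= t * h x + (1 - t) * h y.

Lemma convex_function_fun h :
  convex_function setT (h : _ -> R^o) -> convex_fun h.
Proof.
move=> hh x y t /andP[t0 t1].
have t01 : Itv.spec (@Itv.num_sem R) (Itv.Real `[0%Z, 1%Z]) t.
  rewrite /= /Itv.num_sem /= realE t0 /=.
  by rewrite in_itv /= t0 t1.
by have := hh (Itv.mk t01) x y (in_setT x) (in_setT y).
Qed.

Lemma convex_funZ (c : R) h : 0 <= c -> convex_fun h -> convex_fun (fun x => c * h x).
Proof.
move=> c0 hh x y t t01; have := ler_wpM2l c0 (hh x y t t01).
by rewrite mulrDr !mulrA ![_ * c]mulrC.
Qed.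

Lemma convex_fun_slope h x v (t : R) : convex_fun h -> 0 <= t <= 1 ->
  h (x + t *: v) - h x <= t * (h (x + v) - h x).
Proof.
move=> hh t01; have := hh (x + v) x t t01.
rewrite (_ : t *: (x + v) + (1 - t) *: x = x + t *: v); first lra.
by apply/rowP => j; rewrite !mxE; ring.
Qed.

(** Induction on the coordinates. A displacement is the midpoint of twice its component along one
    axis and twice the remainder, so convexity reduces it to a one-dimensional bound and the
    induction hypothesis. *)
Lemma convex_locally_bounded_above h a : convex_fun h ->
  exists2 C : R, 0 <= C & exists2 e : R, 0 < e &
    forall x, `|x| <= e -> h (a + x) - h a <= C * `|x|.
Proof.
move=> hh.
suff [C C0 [e e0 he]] : exists2 C : R, 0 <= C & exists2 e : R, 0 < e &
    forall x, `|x| <= e ->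
      h (a + \sum_(j <- index_enum 'I_d) x 0 j *: delta_mx 0 j) - h a <= C * `|x|.
  by exists C => //; exists e => // x /he; rewrite -row_sum_delta.
elim: (index_enum _) => [|j r [C C0 [e e0 he]]].
  by exists 0 => //; exists 1 => // x _; rewrite big_nil addr0 subrr mul0r.
pose ej : 'rV[R]_d := delta_mx 0 j.
(* Bounds the slope from [a] in both directions of the axis, by convexity between [a] and the points
   at distance 1. *)
pose Cj := `|h (a + ej) - h a| + `|h (a - ej) - h a|.
have Cj0 : 0 <= Cj by rewrite addr_ge0.
have hj (s : R) : `|s| <= 1 -> h (a + s *: ej) - h a <= `|s| * Cj.
  have [s0|s0] := leP 0 s; [rewrite ger0_norm //|rewrite ltr0_norm //] => s1.
    rewrite (le_trans (convex_fun_slope _ _ hh _)) ?s0 //.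
    by rewrite ler_wpM2l // (le_trans (ler_norm _)) // lerDl.
  have -> : a + s *: ej = a + - s *: - ej by rewrite scaleNr scalerN opprK.
  rewrite (le_trans (convex_fun_slope _ _ hh _)) ?oppr_ge0 ?(ltW s0) //.
  by rewrite ler_wpM2l ?oppr_ge0 ?(ltW s0) // (le_trans (ler_norm _)) // lerDr.
exists (Cj + C); first by rewrite addr_ge0.
(* Both halves of the displacement are doubled before being tested, so the admissible radii 1 and
   [e] are halved. *)
exists (Num.min 2^-1 (e / 2)); first by rewrite lt_min invr_gt0 ltr0n divr_gt0.
move=> x; rewrite le_min => /andP[x1 xe]; rewrite big_cons.
have n2x : `|2%:R *: x| = 2 * `|x| by rewrite normrZ ger0_norm.
have /he : `|2%:R *: x| <= e by rewrite n2x; lra.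
rewrite n2x => h2.
have /hj h1 : `|2 * x 0 j| <= 1.
  by rewrite normrM ger0_norm //; have := coord_le_norm x j; lra.
rewrite normrM (@ger0_norm _ 2) // in h1.
set S := \sum_(k <- r) x 0 k *: delta_mx 0 k.
have S2 : \sum_(k <- r) (2%:R *: x) 0 k *: delta_mx 0 k = 2%:R *: S.
  by rewrite scaler_sumr; apply: eq_bigr => k _; rewrite mxE scalerA.
rewrite S2 in h2.
have half01 : 0 <= (2^-1 : R) <= 1 by lra.
have := hh (a + (2 * x 0 j) *: ej) (a + 2%:R *: S) _ half01.
rewrite (_ : 2^-1 *: _ + _ = a + (x 0 j *: delta_mx 0 j + S)); last first.
  by apply/rowP => k; rewrite !mxE; field.
have : `|x 0 j| * Cj <= `|x| * Cj by rewrite ler_wpM2r // coord_le_norm.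
lra.
Qed.

(** The upper bound also gives the lower one: [a] is the midpoint of [a + x] and [a - x], so a small
    increase at [a - x] forbids a large decrease at [a + x]. *)
Lemma convex_continuous h : convex_fun h -> continuous h.
Proof.
move=> hh a; have [C C0 [e e0 he]] := convex_locally_bounded_above a hh.
have he2 x : `|x| <= e -> `|h (a + x) - h a| <= C * `|x|.
  move=> xe; rewrite ler_norml he // andbT.
  have /he : `|- x| <= e by rewrite normrN.
  rewrite normrN => h1.
  have half01 : 0 <= (2^-1 : R) <= 1 by lra.
  have := hh (a + x) (a - x) _ half01.
  rewrite (_ : 2^-1 *: _ + _ = a); first by lra.
  by apply/rowP => k; rewrite !mxE; field.
apply/(@cvgrPdist_le _ _ _ _ (nbhs_filter a)) => r r0.
apply/(@nbhs_normP R 'rV[R]_d); exists (Num.min e (r / (C + 1))).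
  by rewrite /= lt_min e0 divr_gt0 // ltr_wpDl.
move=> x /=; rewrite lt_min => /andP[xe xr].
have := he2 (x - a); rewrite (addrC a) subrK -(distrC a x) (distrC (h x)).
move=> /(_ (ltW xe))/le_trans; apply.
rewrite (le_trans (ler_wpM2l C0 (ltW xr))) // mulrA ler_pdivrMr ?ltr_wpDl //.
by rewrite mulrDr mulr1 mulrC lerDl ltW.
Qed.

(** Limit as [t] tends to 0. The restriction [t <= 1] lets [t] serve as a convexity parameter. *)
Lemma le_add_small (a b c : R) :
  (forall t, 0 < t <= 1 -> a <= b + t * c) -> a <= b.
Proof.
move=> H; apply/ler_addgt0Pl => e e0.
pose t := Num.min 1 (e / (`|c| + 1)).
have c1 : 0 < `|c| + 1 by rewrite ltr_wpDl.
have t0 : 0 < t by rewrite lt_min ltr01 divr_gt0.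
have t1 : t <= 1 by rewrite ge_min lexx.
rewrite (le_trans (H t _)) ?t0 // addrC lerD2r.
rewrite (le_trans (ler_norm _)) // normrM gtr0_norm //.
have : t <= e / (`|c| + 1) by rewrite ge_min lexx orbT.
rewrite ler_pdivlMr // mulrDr mulr1; have := ltW t0; lra.
Qed.

Lemma compact_closed_ball (y : 'rV[R]_d) (r : R) : compact [set x | `|x - y| <= r].
Proof.
apply: bounded_closed_compact.
  exists (r + `|y|); split; first by rewrite num_real.
  move=> M rM x /= xr; rewrite -(subrK y x) (le_trans (ler_normD _ _)) //.
  by rewrite (le_trans _ (ltW rM)) // lerD2r.
have -> : [set x | `|x - y| <= r] = (fun x => `|x - y|) @^-1` [set s | s <= r] by [].
apply: closed_comp; last exact: closed_le.
move=> x _; apply: (@cvg_norm _ _ _ (nbhs x)).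
by apply: (@cvgB _ _ _ (nbhs x)); [exact: cvg_id|exact: cvg_cst].
Qed.

Section proximal.
Variables (h : 'rV[R]_d -> R) (hh : convex_fun h).

Let q y x := h x + 2^-1 * enorm (x - y) ^+ 2.

Lemma prox_objective_continuous y : continuous (q y).
Proof.
move=> x; apply: (@cvgD _ _ _ (nbhs x)); first exact: convex_continuous.
apply: (@cvgMl_tmp _ _ (nbhs x)).
under [X in X @ _ --> _]eq_fun do rewrite enorm_sqr.
rewrite enorm_sqr.
have xy : z - y @[z --> x] --> x - y.
  by apply: (@cvgB _ _ _ (nbhs x)); [exact: cvg_id|exact: cvg_cst].
exact: (cvg_dotv (nbhs_filter x) xy xy).
Qed.

(** Coercivity: by convexity [h] decreases at most linearly away from [y], at a rate given by its
    minimum on the unit ball around [y], and the quadratic term wins. The minimum over a large ball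
    is therefore global. *)
Lemma prox_exists y : exists p, forall x, q y p <= q y x.
Proof.
have [m my hm] : exists2 m, m \in [set x | `|x - y| <= 1] &
    forall x, x \in [set x | `|x - y| <= 1] -> h m <= h x.
  apply: compact_EVT_min (@compact_closed_ball y 1) _.
    by exists y; rewrite /= subrr normr0.
  exact/continuous_subspaceT/convex_continuous.
(* At distance [t] from [y] the objective is at least [h y + t * (h m - h y) + t ^+ 2 / 2], which is
   no less than [h y] as soon as [t >= 2 * (h y - h m)]. The bound 1 makes the unit ball usable for
   the slope. *)
pose T := Num.max 1 (2 * (h y - h m)).
have [p pT hp] : exists2 p, p \in [set x | `|x - y| <= T] &
    forall x, x \in [set x | `|x - y| <= T] -> q y p <= q y x.
  apply: compact_EVT_min (@compact_closed_ball y T) _.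
    by exists y; rewrite /= subrr normr0 le_max ler01.
  exact/continuous_subspaceT/prox_objective_continuous.
exists p => x; have [xT|xT] := leP `|x - y| T; first by apply: hp; rewrite inE.
have qyy : q y y = h y by rewrite /q subrr enorm0 expr0n mulr0 addr0.
have : q y p <= q y y.
  by apply: hp; rewrite inE /= subrr normr0 le_max ler01.
rewrite qyy => /le_trans; apply.
set t := `|x - y| in xT.
move: xT; rewrite gt_max => /andP[t1 tm].
have t0 : 0 < t by rewrite (lt_trans _ t1).
have : h m <= h (y + t^-1 *: (x - y)).
  apply: hm; rewrite inE /= addrAC subrr add0r normrZ gtr0_norm ?invr_gt0 //.
  by rewrite mulVf // gt_eqF.
have : h (y + t^-1 *: (x - y)) - h y <= t^-1 * (h x - h y).
  rewrite -[in h x](subrK y x) [x - y + y]addrC convex_fun_slope //.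
  by rewrite invr_ge0 (ltW t0) /= invf_le1 // ltW.
move=> h1 h2; have : t * (h m - h y) <= h x - h y.
  by rewrite -ler_pdivlMl //; lra.
have : t ^+ 2 <= enorm (x - y) ^+ 2.
  by rewrite ler_pXn2r ?nnegrE ?enorm_ge0 ?(ltW t0) // norm_le_enorm.
rewrite /q expr2 => h3 h4; nra.
Qed.

Lemma proxP y x : q y (prox h y) <= q y x.
Proof. exact: (getPex (prox_exists y)). Qed.

(** Optimality condition of the proximal problem: moving from [p] towards [x] by a fraction [t]
    changes the quadratic part by a linear term and a term of order [t ^+ 2]; divide by [t] and let
    it vanish. *)
Lemma prox_subdiff y : subdiff h (prox h y) (y - prox h y).
Proof.
move=> x; set p := prox h y; rewrite addrC -lerBrDr.
apply: (@le_add_small _ _ (2^-1 * enorm (x - p) ^+ 2)) => t /andP[t0 t1].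
have := proxP y (p + t *: (x - p)); rewrite /q -/p.
have := @convex_fun_slope _ p (x - p) t hh; rewrite (ltW t0) t1 => /(_ isT).
rewrite [p + (x - p)]addrC subrK.
rewrite [p + _ - y]addrAC !enorm_sqr -[y - p]opprB.
move: (p - y) (x - p) => a b; rewrite !dotvE (dotvC b a) => h1 h2.
have : 0 <= t * (h x - h p + dotv a b + t * (2^-1 * dotv b b)) by lra.
by rewrite pmulr_rge0 //; lra.
Qed.

End proximal.

(** Monotonicity of the subdifferential and Cauchy-Schwarz. It is stated for points with a given
    residual, so that it also applies to a point known to be proximal only through a subgradient. *)
Lemma subdiff_nonexpansive h p q y z :
  subdiff h p (y - p) -> subdiff h q (z - q) -> enorm (p - q) <= enorm (y - z).
Proof.
move=> /(_ q) h1 /(_ p) h2.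
have [->|pq] := eqVneq (enorm (p - q)) 0; first exact: enorm_ge0.
have pq0 : 0 < enorm (p - q) by rewrite lt_neqAle eq_sym pq enorm_ge0.
rewrite -(ler_pM2r pq0) (le_trans _ (dotv_le _ _)) // -expr2 enorm_sqr.
move: h1 h2; rewrite !dotvE (dotvC q p); lra.
Qed.

Lemma subdiffZ (c : R) h x v :
  0 <= c -> subdiff h x v -> subdiff (fun y => c * h y) x (c *: v).
Proof.
by move=> c0 hv y; have := ler_wpM2l c0 (hv y); rewrite dotvZl mulrDr.
Qed.

Lemma grad_derive h x v : differentiable h x -> dotv (grad h x) v = 'D_v h x.
Proof.
move=> dh; rewrite deriveE // [in RHS](row_sum_delta v) linear_sum.
by apply: eq_bigr => j _; rewrite linearZ /= mxE deriveE // mulrC.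
Qed.

(** The steps are the inverses of integers because a sequence of quotients is what both the gradient
    inequality and the measurability of gradients pass to the limit in. *)
Lemma cvg_difference_quotient h x v : differentiable h x ->
  n.+1%:R * (h (x + n.+1%:R^-1 *: v) - h x) @[n --> \oo] --> 'D_v h x.
Proof.
move=> dh; have dhv : derivable h x v by exact: diff_derivable.
have n0 : (n.+1%:R^-1 : R) @[n --> \oo] --> dnbhs (0 : R).
  have h0 : (n.+1%:R^-1 : R) @[n --> \oo] --> (0 : R) by exact: cvg_harmonic.
  move=> A /nbhs_ballP[e /= e0 eA].
  move/cvgrPdist_lt : h0 => /(_ _ e0).
  by apply: filterS => n hn; apply: eA; rewrite // gt_eqF ?invr_gt0 ?ltr0n.
have := cvg_comp _ _ n0 dhv; apply: cvg_trans; apply: near_eq_cvg.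
by apply: nearW => n /=; rewrite invrK [_ *: v + x]addrC.
Qed.

End convex_functions.

(** * Inequalities for one gradient step and one proximal step *)

Section gradient_and_prox_bounds.
Context {R : realType} {d : nat}.
Implicit Types (x y z a u v phi : 'rV[R]_d) (h : 'rV[R]_d -> R).

Lemma grad_subdiff h x : convex_fun h -> differentiable h x ->
  subdiff h x (grad h x).
Proof.
move=> hh dh y; rewrite grad_derive // addrC -lerBrDr.
apply: (@cvgr_to_le _ _ _ _ _ _ _ (cvg_difference_quotient (v := y - x) dh)).
apply: nearW => n; rewrite -ler_pdivlMl ?ltr0n //.
rewrite -[in leRHS](subrK x y) [y - x + x]addrC convex_fun_slope //.
by rewrite invr_ge0 ler0n invf_le1 ?ltr0n // ler1n.
Qed.

(** The gradient inequality at [y] bounds [h y - h a] by the derivative at [y], which is then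
    compared with the one at [a]. No integration along the segment is involved, hence [K] instead of
    half of it. *)
Lemma lipschitz_grad_descent h a y (K : R) : convex_fun h ->
  differentiable h y ->
  enorm (grad h y - grad h a) <= K * enorm (y - a) ->
  h y <= h a + dotv (grad h a) (y - a) + K * enorm (y - a) ^+ 2.
Proof.
move=> hh dh hK.
have : h y + dotv (grad h y) (a - y) <= h a by exact: grad_subdiff.
have : dotv (grad h y - grad h a) (y - a) <= K * enorm (y - a) ^+ 2.
  by rewrite (le_trans (dotv_le _ _)) // expr2 mulrA ler_wpM2r // enorm_ge0.
have -> : a - y = - (y - a) by rewrite opprB.
by rewrite dotvNr dotvBl; lra.
Qed.

(* Test the descent inequality at the point [x + r w / |w|], where
   [w = grad h x - grad h a] and [r = |x - a|]. *)
Lemma descent_lipschitz_grad h a x (K : R) : 0 <= K -> convex_fun h ->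
  (forall y, differentiable h y) ->
  (forall y, h y <= h a + dotv (grad h a) (y - a) + K * enorm (y - a) ^+ 2) ->
  enorm (grad h x - grad h a) <= 4 * K * enorm (x - a).
Proof.
move=> K0 hh dh hK; set w := grad h x - grad h a; set r := enorm (x - a).
have r0 : 0 <= r by exact: enorm_ge0.
have [w0|w0] := eqVneq (enorm w) 0; first by rewrite w0 !mulr_ge0.
have wp : 0 < enorm w by rewrite lt_neqAle eq_sym w0 enorm_ge0.
have [xa|xa] := eqVneq r 0.
  by rewrite /w (_ : x = a) ?subrr ?enorm0 ?mulr_ge0 //; apply/subr0_eq/enorm_eq0.
have rp : 0 < r by rewrite lt_neqAle eq_sym xa r0.
pose v := (r / enorm w) *: w.
have vr : enorm v = r.
  rewrite enormZ ger0_norm ?divr_ge0 ?enorm_ge0 //.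
  by rewrite divfK // gt_eqF.
have wv : dotv w v = r * enorm w.
  by rewrite dotvZr -enorm_sqr expr2 mulrA divfK // gt_eqF.
have h1 := hK (x + v).
have h2 : h x + dotv (grad h x) (x + v - x) <= h (x + v) by exact: grad_subdiff.
have h3 : h a + dotv (grad h a) (x - a) <= h x by exact: grad_subdiff.
have h4 : enorm (x + v - a) ^+ 2 <= (2 * r) ^+ 2.
  rewrite ler_pXn2r ?nnegrE ?enorm_ge0 ?mulr_ge0 // addrAC.
  by rewrite (le_trans (enorm_triangle _ _)) // vr -/r mulr_natl.
have {h4} h4 := ler_wpM2l K0 h4.
rewrite [x + v - x]addrAC subrr add0r in h2.
rewrite (_ : x + v - a = x - a + v) ?[x + v - a]addrAC // in h1 h4.
rewrite dotvDr in h1.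
rewrite /w dotvBl -/w in wv.
rewrite -(ler_pM2l rp) -wv.
apply: (@le_trans _ _ (K * (2 * r) ^+ 2)); first lra.
by rewrite le_eqVlt; apply/orP; left; apply/eqP; ring.
Qed.

Section prox_bounds.
Variables (g : 'rV[R]_d -> R) (c : R) (a phi : 'rV[R]_d).
Hypotheses (gg : convex_fun g) (c0 : 0 < c) (aphi : subdiff g a phi).

Local Notation p := (prox (fun y => c * g y)).

Let cg := convex_funZ (ltW c0) gg.

(** The point [a] is the proximal point of [a + c *: phi], and the proximal map is nonexpansive. *)
Lemma prox_dist_fixed w : enorm (p w - a) <= enorm (w - a) + c * enorm phi.
Proof.
have h1 := prox_subdiff cg w.
have h2 : subdiff (fun y => c * g y) a (a + c *: phi - a).
  by rewrite addrAC subrr add0r; apply: subdiffZ => //; exact: ltW.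
rewrite (le_trans (subdiff_nonexpansive h1 h2)) // opprD addrA.
by rewrite (le_trans (enorm_triangle _ _)) // enormN enormZ gtr0_norm.
Qed.

(** Minimality at [p w] is tested against [z], and [g (p w)] is bounded below by the affine minorant
    at [a]. With [z] a fixed limit point and [c] small, this forces [p w] to stay close to [w]. *)
Lemma prox_displacement w z : enorm (p w - w) ^+ 2 <=
  enorm (z - w) ^+ 2
  + 2 * c * (g z - g a + enorm phi * (enorm (w - a) + c * enorm phi)).
Proof.
have := proxP cg w z => /=; have : g a + dotv phi (p w - a) <= g (p w) by exact: aphi.
have : - dotv phi (p w - a) <= enorm phi * (enorm (w - a) + c * enorm phi).
  rewrite -dotvNl (le_trans (dotv_le _ _)) // enormN.
  by rewrite ler_wpM2l ?enorm_ge0 ?prox_dist_fixed.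
move: (enorm phi * _) (dotv _ _) (g (p w)) => s t u h1 h2.
have : c * (g a + t) <= c * u by rewrite ler_pM2l.
have : c * (- t) <= c * s by rewrite ler_pM2l.
lra.
Qed.

End prox_bounds.

(* [<grad f y, a - z>] is split through [y], and [<grad f y, z - y>] is absorbed
   by half of [|z - y|^2]. *)
Lemma forward_backward_step (f g : 'rV[R]_d -> R) (c : R) (a y : 'rV[R]_d) :
  convex_fun f -> convex_fun g -> differentiable f y -> 0 < c ->
  let z := prox (fun x => c * g x) (y - c *: grad f y) in
  enorm (z - a) ^+ 2 <= enorm (y - a) ^+ 2
    - 2 * c * (g z - g a + (f y - f a))
    - 2^-1 * enorm (z - y) ^+ 2 + 2 * c ^+ 2 * enorm (grad f y) ^+ 2.
Proof.
move=> ff gg df c0 /=; set z := prox _ _.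
have h1 : c * g z + dotv (y - c *: grad f y - z) (a - z) <= c * g a.
  exact: (prox_subdiff (convex_funZ (ltW c0) gg) _ a).
have h2 : f y + dotv (grad f y) (a - y) <= f a by exact: grad_subdiff.
have h3 := dotv_ge0 (2 * c *: grad f y + (z - y)).
rewrite !enorm_sqr; move: z h1 h3 h2 => z; move: (grad f y) => b h1 h3 h2.
have {}h1 : 2 * (c * g z + dotv (y - c *: b - z) (a - z)) <= 2 * (c * g a) by lra.
have {}h2 : 2 * c * (f y + dotv b (a - y)) <= 2 * c * f a.
  by rewrite ler_pM2l ?mulr_gt0.
have ez : z - a = (z - y) + (y - a) by rewrite subrKA.
have eaz : a - z = - ((z - y) + (y - a)) by rewrite subrKA opprB.
have eyz : y - c *: b - z = - (z - y) - c *: b by rewrite opprB addrAC.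
have eay : a - y = - (y - a) by rewrite opprB.
rewrite ez eaz eyz eay in h1 h2 *.
move: (z - y) (y - a) => w e in h1 h2 h3 *.
move: h1 h2 h3; rewrite !dotvE (dotvC e w) (dotvC w b); lra.
Qed.

End gradient_and_prox_bounds.

(** * One pass of the algorithm *)

Lemma sqr_sum_le (R : realType) (L : nat) (F : 'I_L -> R) :
  (\sum_i F i) ^+ 2 <= L%:R * \sum_i F i ^+ 2.
Proof.
pose u : 'rV[R]_L := \row_i 1; pose v : 'rV[R]_L := \row_i F i.
have -> : \sum_i F i = dotv u v by apply: eq_bigr => i _; rewrite !mxE mul1r.
have -> : \sum_i F i ^+ 2 = enorm v ^+ 2.
  by rewrite enorm_sqr; apply: eq_bigr => i _; rewrite !mxE.
have -> : L%:R = enorm u ^+ 2.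
  rewrite enorm_sqr /dotv; under eq_bigr do rewrite !mxE mul1r.
  by rewrite sumr_const card_ord.
rewrite -exprMn -real_normK ?num_real // ler_pXn2r ?nnegrE //.
  exact: normr_dotv_le.
by rewrite mulr_ge0 ?enorm_ge0.
Qed.

Section one_pass.
Context {R : realType} {d L : nat}.
Variables (f g : 'I_L -> 'rV[R]_d -> R) (xs : 'rV[R]_d)
  (phi : 'I_L -> 'rV[R]_d) (K : 'I_L -> R).

(** The Bregman gap of each [g i] is taken after its step and that of [f i] before it, since the
    step is implicit in [g i] and explicit in [f i]. *)
Definition pass_gap (y : nat -> 'rV[R]_d) : R :=
  \sum_(i < L) (g i (y i.+1) - g i xs - dotv (phi i) (y i.+1 - xs)
    + (f i (y i) - f i xs - dotv (grad (f i) xs) (y i - xs))).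

Definition pass_move (y : nat -> 'rV[R]_d) : R :=
  \sum_(i < L) enorm (y i.+1 - y i) ^+ 2.

Definition pass_noise : 'rV[R]_d := \sum_(i < L) (phi i + grad (f i) xs).

Definition pass_size : R := \sum_(i < L) (enorm (phi i) + enorm (grad (f i) xs)).

(* The intermediate points grow at most by powers of [1 + sum_i K i], which is
   why all moments of the Lipschitz constants are needed. *)
Definition pass_bound : R :=
  (1 + \sum_i K i) ^+ L.+1 * (1 + pass_size).

(** Here [c] is an upper bound on the steps. The first term comes from recentring the cross terms at
    the start of the pass, the second from the squared gradients, whose bound is the squared
    expression; its factor 4 is 2 from the one-step inequality times 2 from
    [(1 + r) ^+ 2 <= 2 * (1 + r ^+ 2)]. *)
Definition pass_const (c : R) : R :=
  4 * L%:R + 4 * L%:R * (4 * L.+1%:R * c * (4 * c) ^+ L) ^+ 2.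

Hypotheses (L0 : (0 < L)%N)
  (ff : forall i, convex_fun (f i)) (gg : forall i, convex_fun (g i))
  (df : forall i x, differentiable (f i) x)
  (gphi : forall i, subdiff (g i) xs (phi i)) (K0 : forall i, 0 <= K i)
  (fK : forall i y, f i y <=
    f i xs + dotv (grad (f i) xs) (y - xs) + K i * enorm (y - xs) ^+ 2).

Variables (c c1 : R) (y : nat -> 'rV[R]_d).
Hypotheses (c0 : 0 < c) (cc1 : c <= c1) (c11 : 1 <= c1)
  (yS : forall i : 'I_L,
    y i.+1 = prox (fun x => c * g i x) (y i - c *: grad (f i) (y i))).

Let b i := enorm (grad (f i) (y i)).
Let D := \sum_(i < L) enorm (y i.+1 - y i).

Lemma pass_gap_ge0 : 0 <= pass_gap y.
Proof.
apply: sumr_ge0 => i _; apply: addr_ge0.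
  by have := gphi i (y i.+1); rewrite /subdiff /=; lra.
by have := grad_subdiff (ff i) (df i xs) (y i); rewrite /subdiff /=; lra.
Qed.

Lemma pass_size_ge0 : 0 <= pass_size.
Proof. by apply: sumr_ge0 => i _; rewrite addr_ge0 ?enorm_ge0. Qed.

Let dist_le i : (i <= L)%N -> enorm (y i - y 0) <= D.
Proof.
move=> iL; apply: (@le_trans _ _ (\sum_(0 <= k < i) enorm (y k.+1 - y k))).
  by rewrite -telescope_sumr // enorm_sum.
rewrite /D -(big_mkord predT (fun k => enorm (y k.+1 - y k))).
rewrite [leRHS](big_cat_nat _ iL) //= lerDl.
by rewrite sumr_ge0 // => k _; exact: enorm_ge0.
Qed.

(** The one-step inequalities telescope. Their linear terms are taken at the intermediate points;
    replacing those by [y 0] yields the noise, at the cost of [pass_size] times the path length [D],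
    which half of the available moves absorbs. *)
Let pass_descent : enorm (y L - xs) ^+ 2 <= enorm (y 0 - xs) ^+ 2
  - 2 * c * pass_gap y - 4^-1 * pass_move y
  - 2 * c * dotv pass_noise (y 0 - xs)
  + c ^+ 2 * (4 * L%:R * pass_size ^+ 2 + 2 * \sum_i b i ^+ 2).
Proof.
pose V x := enorm (x - xs) ^+ 2.
have L0' : 0 < L%:R :> R by rewrite ltr0n.
have D2 : D ^+ 2 <= L%:R * pass_move y by exact: sqr_sum_le.
have D0 : 0 <= D by apply: sumr_ge0 => i _; exact: enorm_ge0.
have move0 : 0 <= pass_move y by apply: sumr_ge0 => i _; exact: sqr_ge0.
have tele : V (y L) - V (y 0) = \sum_(i < L) (V (y i.+1) - V (y i)).
  by rewrite -(telescope_sumr (fun k => V (y k))) // big_mkord.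
pose cross i := dotv (phi i) (y i.+1 - xs) + dotv (grad (f i) xs) (y i - xs).
have h1 : V (y L) - V (y 0) <= - (2 * c) * (pass_gap y + \sum_i cross i)
    - 2^-1 * pass_move y + 2 * c ^+ 2 * \sum_i b i ^+ 2.
  rewrite tele -big_split /= !mulr_sumr -sumrN -!big_split /=.
  apply: ler_sum => i _.
  have := forward_backward_step xs (ff i) (gg i) (df i (y i)) c0.
  rewrite /= -yS /V /cross /b; lra.
have h2 : dotv pass_noise (y 0 - xs) - pass_size * D <= \sum_i cross i.
  rewrite /pass_noise dotv_suml mulr_suml -sumrN -big_split /=.
  apply: ler_sum => i _.
  have e1 : y i.+1 - xs = (y i.+1 - y 0) + (y 0 - xs) by rewrite subrKA.
  have e2 : y i - xs = (y i - y 0) + (y 0 - xs) by rewrite subrKA.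
  have aux (u z : 'rV[R]_d) : enorm z <= D -> - (enorm u * D) <= dotv u z.
    move=> zD; rewrite lerNl -dotvNl (le_trans (dotv_le _ _)) // enormN.
    by rewrite ler_wpM2l ?enorm_ge0.
  have := aux (phi i) _ (dist_le (ltn_ord i)).
  have := aux (grad (f i) xs) _ (dist_le (ltnW (ltn_ord i))).
  rewrite /cross e1 e2.
  move: (y i.+1 - y 0) (y i - y 0) (y 0 - xs) => u v w.
  rewrite !dotvDr dotvDl; lra.
(* Young's inequality combined with [D ^+ 2 <= L%:R * pass_move y]; this turns the coefficient of
   the moves from 1/2 into 1/4. *)
have h3 : 2 * c * (pass_size * D) <=
    4 * L%:R * c ^+ 2 * pass_size ^+ 2 + 4^-1 * pass_move y.
  have := sqr_ge0 (4 * L%:R * (c * pass_size) - D).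
  move: pass_size (pass_move y) D2 {h1 h2} => A Q D2 h3.
  rewrite -(ler_pM2l (_ : 0 < 4 * L%:R :> R)) ?mulr_gt0 //.
  nra.
have : 2 * c * (dotv pass_noise (y 0 - xs) - pass_size * D) <= 2 * c * \sum_i cross i.
  by rewrite ler_pM2l ?mulr_gt0.
rewrite -/(V (y L)) -/(V (y 0)); nra.
Qed.

Let W := \sum_i K i.
Let r := enorm (y 0 - xs).

Let gradB i : b i <= enorm (grad (f i) xs) + 4 * K i * enorm (y i - xs).
Proof.
have := descent_lipschitz_grad (y i) (K0 i) (ff i) (df i) (fK i).
by have := enorm_triangle (grad (f i) (y i) - grad (f i) xs) (grad (f i) xs);
  rewrite subrK /b; lra.
Qed.

Let Ki_W i : K i <= W.
Proof. by rewrite /W (bigD1 i) //= lerDl sumr_ge0. Qed.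

Let ai_A i : enorm (phi i) + enorm (grad (f i) xs) <= pass_size.
Proof.
rewrite /pass_size (bigD1 i) //= lerDl sumr_ge0 // => j _.
by rewrite addr_ge0 ?enorm_ge0.
Qed.

Let W0 : 0 <= W. Proof. exact: sumr_ge0. Qed.

(** Discrete Gronwall: a step multiplies the distance to [xs] by at most [1 + 4 * c * K i] and adds
    at most [c * pass_size]. The bound [c1] replaces [c] to make the estimate uniform in the
    step. *)
Let iter_bound i : (i <= L)%N ->
  enorm (y i - xs) <= (1 + 4 * c1 * W) ^+ i * (r + i%:R * c1 * pass_size).
Proof.
elim: i => [_|i IH iL]; first by rewrite expr0 mul1r !mul0r addr0.
have := IH (ltnW iL); set N := _ * _ => {}IH.
pose j := Ordinal iL.
have := yS j; rewrite [nat_of_ord j]/= => ->.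
have step := prox_dist_fixed (gg j) c0 (gphi j) (y i - c *: grad (f j) (y i)).
have step2 : enorm (y i - c *: grad (f j) (y i) - xs) <= enorm (y i - xs) + c * b j.
  by rewrite addrAC (le_trans (enorm_triangle _ _)) // enormN enormZ gtr0_norm //.
have bj := gradB j; have := ai_A j => aj; have Kj := Ki_W j; have Kj0 := K0 j.
rewrite [nat_of_ord j]/= in bj.
have y0 := enorm_ge0 (y i - xs).
have A0 := pass_size_ge0.
have c10 : 0 <= c1 := le_trans ler01 c11.
have P1 : 1 <= (1 + 4 * c1 * W) ^+ i by rewrite exprn_ege1 // lerDl !mulr_ge0.
apply: (@le_trans _ _ ((1 + 4 * c1 * W) * enorm (y i - xs) + c1 * pass_size)).
  have e1 : c * (enorm (phi j) + enorm (grad (f j) xs)) <= c1 * pass_size.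
    by rewrite ler_pM ?(ltW c0) ?addr_ge0 ?enorm_ge0.
  have e2 : c * (K j * enorm (y i - xs)) <= c1 * (W * enorm (y i - xs)).
    by rewrite ler_pM ?(ltW c0) ?ler_wpM2r ?mulr_ge0.
  have e3 : c * b j <= c * (enorm (grad (f j) xs) + 4 * K j * enorm (y i - xs)).
    by rewrite ler_pM2l.
  nra.
have q0 : 0 <= 1 + 4 * c1 * W by rewrite addr_ge0 // !mulr_ge0.
have := ler_wpM2l q0 IH.
have : c1 * pass_size <= (1 + 4 * c1 * W) ^+ i.+1 * (c1 * pass_size).
  by rewrite ler_peMl ?mulr_ge0 // exprn_ege1 // lerDl !mulr_ge0.
rewrite /N exprS -[i.+1%:R]natr1; lra.
Qed.

Let U1 : 1 <= 1 + W. Proof. by rewrite lerDl. Qed.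

(** Separates a deterministic factor, the sample-dependent [pass_bound], and the starting distance.
    Of the [L.+1] powers of [1 + W], [L] come from the growth of the points and one from the
    gradient at the last of them. *)
Let b_bound i :
  b i <= 4 * L.+1%:R * c1 * (4 * c1) ^+ L * (pass_bound * (1 + r)).
Proof.
have A0 := pass_size_ge0; have r0 : 0 <= r by exact: enorm_ge0.
have c10 : 0 <= c1 by rewrite (le_trans _ c11).
have iL := ltnW (ltn_ord i).
(* Since [1 + 4 * c1 * W <= q * (1 + W)], the step bound and the Lipschitz constants factor
   apart. *)
set q := 4 * c1; have q1 : 1 <= q by rewrite (le_trans c11) // ler_peMl // ler1n.
have qW : 1 + 4 * c1 * W <= q * (1 + W).
  by rewrite /q; have := c11; nra.
have qU1 : 1 <= q * (1 + W) by rewrite (le_trans _ qW) // lerDl !mulr_ge0.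
have hN : enorm (y i - xs) <= q ^+ L * (1 + W) ^+ L * (r + L%:R * c1 * pass_size).
  rewrite (le_trans (iter_bound iL)) // ler_pM //.
  - by rewrite exprn_ge0 // addr_ge0 // !mulr_ge0.
  - by rewrite addr_ge0 // !mulr_ge0.
  - rewrite -exprMn (@le_trans _ _ ((q * (1 + W)) ^+ i)) //.
      by rewrite lerXn2r ?nnegrE ?(le_trans ler01 qU1) // addr_ge0 // !mulr_ge0.
    exact: ler_weXn2l.
  - by rewrite lerD2l !ler_wpM2r // ler_nat.
have hb : b i <= pass_size + 4 * ((1 + W) * enorm (y i - xs)).
  have := gradB i; have := ai_A i; have := Ki_W i.
  have := enorm_ge0 (phi i); have := enorm_ge0 (y i - xs); nra.
have M1 : 1 <= q ^+ L by exact: exprn_ege1.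
have UL1 : 1 <= (1 + W) ^+ L by exact: exprn_ege1.
have U0 : 0 <= 1 + W by rewrite (le_trans _ U1).
have := ler_wpM2l U0 hN; rewrite /pass_bound exprS -/W -[L.+1%:R]natr1.
set M := q ^+ L in M1 *; set UL := (1 + W) ^+ L in UL1 *.
have MU1 : 1 <= M * (UL * (1 + W)).
  by rewrite mulr_ege1 // mulr_ege1.
have hA : pass_size <= 4 * (M * (UL * (1 + W))) * (c1 * pass_size).
  have : 1 * pass_size <= (M * (UL * (1 + W))) * (c1 * pass_size).
    by rewrite ler_pM // ler_peMl.
  have : 0 <= (M * (UL * (1 + W))) * (c1 * pass_size).
    by rewrite mulr_ge0 ?(le_trans ler01 MU1) // mulr_ge0.
  lra.
move=> h2.
apply: (@le_trans _ _ (4 * (M * (UL * (1 + W))) * (c1 * pass_size + (r + L%:R * c1 * pass_size)))).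
  lra.
rewrite [leRHS](_ : _ = 4 * (M * (UL * (1 + W))) * ((L%:R + 1) * c1 * ((1 + pass_size) * (1 + r)))); last ring.
rewrite ler_wpM2l ?(mulr_ge0 (ler0n R 4) (le_trans ler01 MU1)) //.
have L0' : 0 <= L%:R :> R by rewrite ler0n.
have Lc : 1 <= (L%:R + 1) * c1 by rewrite mulr_ege1 // lerDr.
have Ar : 0 <= pass_size * r by rewrite mulr_ge0.
have -> : c1 * pass_size + (r + L%:R * c1 * pass_size) =
    (L%:R + 1) * c1 * pass_size + r by ring.
move: ((L%:R + 1) * c1) Lc => t Lc; nra.
Qed.

Lemma pass_inequality : enorm (y L - xs) ^+ 2 <= enorm (y 0 - xs) ^+ 2
  - 2 * c * pass_gap y - 4^-1 * pass_move y
  - 2 * c * dotv pass_noise (y 0 - xs)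
  + c ^+ 2 * (pass_const c1 * pass_bound ^+ 2 * (1 + enorm (y 0 - xs) ^+ 2)).
Proof.
apply: (le_trans pass_descent); rewrite lerD2l ler_wpM2l ?sqr_ge0 // -/r.
have A0 := pass_size_ge0; have r0 : 0 <= r by exact: enorm_ge0.
have U0 : 0 <= 1 + W by rewrite (le_trans _ U1).
have pb : pass_size <= pass_bound.
  rewrite /pass_bound -/W (@le_trans _ _ (1 + pass_size)) ?lerDr //.
  by rewrite ler_peMl ?addr_ge0 // exprn_ege1.
have pb0 : 0 <= pass_bound by rewrite (le_trans A0).
set k := 4 * L.+1%:R * c1 * (4 * c1) ^+ L.
have hs : \sum_i b i ^+ 2 <= L%:R * (k * (pass_bound * (1 + r))) ^+ 2.
  rewrite (_ : L%:R * _ = \sum_(i < L) (k * (pass_bound * (1 + r))) ^+ 2).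
    by apply: ler_sum => i _; rewrite lerXn2r ?nnegrE ?enorm_ge0 // ?b_bound //
      (le_trans _ (b_bound i)) ?enorm_ge0.
  by rewrite sumr_const card_ord mulr_natl.
have r2 : (1 + r) ^+ 2 <= 2 * (1 + r ^+ 2) by have := sqr_ge0 (1 - r); nra.
have A2 : pass_size ^+ 2 <= pass_bound ^+ 2 * (1 + r ^+ 2).
  rewrite (@le_trans _ _ (pass_bound ^+ 2)) ?lerXn2r ?nnegrE //.
  by rewrite ler_peMr ?sqr_ge0 // lerDl sqr_ge0.
have h2 : L%:R * (k * (pass_bound * (1 + r))) ^+ 2 <=
   L%:R * k ^+ 2 * pass_bound ^+ 2 * (2 * (1 + r ^+ 2)).
  have := ler_wpM2l (mulr_ge0 (ler0n R L) (sqr_ge0 (k * pass_bound))) r2.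
  by clear hs; clearbody k; lra.
rewrite /pass_const -/k.
have := ler_wpM2l (ler0n R L) A2.
lra.
Qed.

End one_pass.

(** * Measurability *)

Section rational_vectors.
Context {R : realType} {d : nat}.

Definition ratv (q : 'rV[rat]_d) : 'rV[R]_d := map_mx ratr q.

Lemma norm_lt_coord (x : 'rV[R]_d) (e : R) :
  0 < e -> (forall j, `|x 0 j| < e) -> `|x| < e.
Proof.
move=> e0 xe; rewrite [ltLHS]/Num.Def.normr /= mx_normrE.
by apply/bigmax_ltP; split => // -[i j] _; rewrite (ord1 i).
Qed.

Lemma ratv_dense (x : 'rV[R]_d) (e : R) : 0 < e -> exists q, `|x - ratv q| < e.
Proof.
move=> e0.
have H j : {q : rat | `|x 0 j - ratr q| < e}.
  apply: cid; have /rat_in_itvoo[q] : x 0 j - e < x 0 j + e by lra.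
  by rewrite in_itv /= => /andP[q1 q2]; exists q; rewrite ltr_norml; lra.
exists (\row_j projT1 (H j)); apply: norm_lt_coord => // j.
by rewrite !mxE; exact: (projT2 (H j)).
Qed.

(** Reduces a condition at all points to countably many conditions, which makes the corresponding
    set of samples measurable. *)
Lemma continuous_ratv_le (h : 'rV[R]_d -> R) (c : R) : continuous h ->
  (forall q, c <= h (ratv q)) -> forall x, c <= h x.
Proof.
move=> ch hc x; rewrite leNgt; apply/negP => hx.
have : \forall y \near x, h y < c by exact: (cvgr_lt _ (ch x)).
move=> /(@nbhs_normP R 'rV[R]_d)[e /= e0 he]; have [q xq] := ratv_dense x e0.
by have := he _ xq; rewrite /= ltNge hc.
Qed.

End rational_vectors.

Section measurable_sets.
Context {R : realType} {dT : measure_display} {T : measurableType dT}.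

Lemma measurable_set_le (f g : T -> R) : measurable_fun setT f ->
  measurable_fun setT g -> measurable [set t | f t <= g t].
Proof.
by move=> mf mg; rewrite -[X in measurable X]setTI; exact: measurable_fun_le.
Qed.

Lemma measurable_set_lt (f g : T -> R) : measurable_fun setT f ->
  measurable_fun setT g -> measurable [set t | f t < g t].
Proof.
move=> mf mg; rewrite (_ : [set t | f t < g t] = ~` [set t | g t <= f t]).
  by apply: measurableC; exact: measurable_set_le.
by apply/seteqP; split => t /=; rewrite ltNge => /negP.
Qed.

End measurable_sets.

Section measurable_vectors.
Context {R : realType} {d : nat}.

Lemma continuous_measurable_rV (h : 'rV[R]_d -> R) :
  continuous h -> measurable_fun setT (h : borel_rV R d -> R).
Proof.
move=> /continuousP ch; apply: (measurability _ (measurable_realfun.RGenOpens.measurableE R)).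
move=> _ [_ [a [b ->] <-]]; rewrite setTI; apply: sub_sigma_algebra.
exact/ch/interval_open.
Qed.

Lemma measurable_coord j : measurable_fun setT (fun v : borel_rV R d => v 0 j).
Proof. by apply: continuous_measurable_rV; exact: coord_continuous. Qed.

Context {dT : measure_display} {T : measurableType dT}.

(** Every open set is a countable union of cubes with rational centre and radius [n.+1%:R^-1], and
    the preimage of a cube is a finite intersection of conditions on coordinates. *)
Lemma measurable_rV (u : T -> 'rV[R]_d) :
  (forall j, measurable_fun setT (fun t => u t 0 j)) ->
  measurable_fun setT (u : T -> borel_rV R d).
Proof.
move=> mu; apply: (@measurability _ _ T (borel_rV R d) setT u open) => //.
move=> _ [U oU <-]; rewrite setTI.
pose I := ('rV[rat]_d * nat)%type.
pose B (p : I) := [set x : 'rV[R]_d | forall j, `|x 0 j - ratv p.1 0 j| < p.2.+1%:R^-1].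
have -> : u @^-1` U = \bigcup_(p in [set p | B p `<=` U]) u @^-1` B p.
  apply/seteqP; split => [t Ut|t [p BU /BU]] //.
  have /(@nbhs_normP R 'rV[R]_d)[e /= e0 eU] : nbhs (u t) U by exact: open_nbhs_nbhs.
  have [n ne] : exists n, n.+1%:R^-1 < e / 2.
    by have [n] := ltr_add_invr (divr_gt0 e0 (ltr0n R 2)); rewrite add0r; exists n.
  have n0 : 0 < n.+1%:R^-1 :> R by rewrite invr_gt0 ltr0n.
  have [q uq] := ratv_dense (u t) n0.
  exists (q, n) => /=.
    move=> x /= xq; apply: eU => /=; rewrite distrC -(subrKA (ratv q)).
    rewrite (le_lt_trans (ler_normD _ _)) //.
    rewrite (splitr e) ltrD // (lt_trans _ ne) //; last by rewrite distrC.
    by apply: norm_lt_coord => // j; have := xq j; rewrite !mxE.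
  by move=> j; have := coord_le_norm (u t - ratv q) j; rewrite !mxE => /le_lt_trans; apply.
rewrite bigcup_mkcond; apply: countable_bigcupT_measurable => [|p].
  exact: countableP.
case: ifP => // _.
have -> : u @^-1` B p = \bigcap_(j in [set: 'I_d]) [set t | `|u t 0 j - ratv p.1 0 j| < p.2.+1%:R^-1].
  by apply/seteqP; split => [t Bt j _ //|t Bt j]; exact: Bt.
apply: fin_bigcap_measurable; first exact: finite_finset.
move=> j _; apply: measurable_set_lt => //.
by apply: measurableT_comp => //; exact: measurable_funB.
Qed.

Lemma measurable_rVP (u : T -> 'rV[R]_d) :
  measurable_fun setT (u : T -> borel_rV R d) ->
  forall j, measurable_fun setT (fun t => u t 0 j).
Proof.
by move=> mu j; apply: (measurableT_comp (measurable_coord j) mu).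
Qed.

Lemma measurable_rVD (u v : T -> 'rV[R]_d) :
  measurable_fun setT (u : T -> borel_rV R d) ->
  measurable_fun setT (v : T -> borel_rV R d) ->
  measurable_fun setT ((fun t => u t + v t) : T -> borel_rV R d).
Proof.
move=> mu mv; apply: measurable_rV => j.
under eq_fun do rewrite mxE.
by apply: measurable_funD; exact: measurable_rVP.
Qed.

Lemma measurable_rVZ (c : R) (u : T -> 'rV[R]_d) :
  measurable_fun setT (u : T -> borel_rV R d) ->
  measurable_fun setT ((fun t => c *: u t) : T -> borel_rV R d).
Proof.
move=> mu; apply: measurable_rV => j.
under eq_fun do rewrite mxE.
by apply: measurable_funM => //; exact: measurable_rVP.
Qed.

Lemma measurable_rVB (u v : T -> 'rV[R]_d) :
  measurable_fun setT (u : T -> borel_rV R d) ->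
  measurable_fun setT (v : T -> borel_rV R d) ->
  measurable_fun setT ((fun t => u t - v t) : T -> borel_rV R d).
Proof.
move=> mu mv; under eq_fun do rewrite -scaleN1r.
by apply: measurable_rVD => //; exact: measurable_rVZ.
Qed.

Lemma measurable_dotv (u v : T -> 'rV[R]_d) :
  measurable_fun setT (u : T -> borel_rV R d) ->
  measurable_fun setT (v : T -> borel_rV R d) ->
  measurable_fun setT (fun t => dotv (u t) (v t)).
Proof.
move=> mu mv; apply: measurable_sum => j.
by apply: measurable_funM; exact: measurable_rVP.
Qed.

Lemma measurable_enorm (u : T -> 'rV[R]_d) :
  measurable_fun setT (u : T -> borel_rV R d) ->
  measurable_fun setT (fun t => enorm (u t)).
Proof.
move=> mu; apply: (measurableT_comp _ mu).
apply: continuous_measurable_rV => x.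
exact: (@cvg_enorm _ _ _ _ (nbhs_filter x) id).
Qed.

End measurable_vectors.

(** * Moreau envelopes *)

Section moreau_envelope.
Context {R : realType} {d : nat}.
Variables (h : 'rV[R]_d -> R) (hh : convex_fun h).

Definition moreau y : R := h (prox h y) + 2^-1 * enorm (prox h y - y) ^+ 2.

Lemma moreau_le y x : moreau y <= h x + 2^-1 * enorm (x - y) ^+ 2.
Proof. exact: proxP. Qed.

(** The objective is continuous, so its infimum may be taken over rational points; this expresses
    the sublevel sets as countable unions. *)
Lemma moreau_ltP y (a : R) : moreau y < a <->
  exists q, h (ratv q) + 2^-1 * enorm (ratv q - y) ^+ 2 < a.
Proof.
split => [ya|[q]]; last exact: le_lt_trans (moreau_le _ _).
apply/not_existsP => H.
have : a <= moreau y.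
  apply: (continuous_ratv_le (@prox_objective_continuous _ _ _ hh y) _ (prox h y)) => q.
  by rewrite leNgt; apply/negP; exact: H.
by rewrite leNgt ya.
Qed.

(** The envelope has gradient [y - prox h y]. Testing [prox h y] in the problem at [y + v] gives the
    upper bound; testing [prox h (y + v)] in the problem at [y] gives the lower one, where
    nonexpansiveness controls the change of proximal point. *)
Lemma moreau_taylor y v :
  `|moreau (y + v) - moreau y - dotv (y - prox h y) v| <= 2^-1 * enorm v ^+ 2.
Proof.
have h1 := moreau_le (y + v) (prox h y).
have h2 := moreau_le y (prox h (y + v)).
have h3 := subdiff_nonexpansive (prox_subdiff hh (y + v)) (prox_subdiff hh y).
rewrite [y + v - y]addrAC subrr add0r in h3.
have h4 : `|dotv (prox h (y + v) - prox h y) v| <= enorm v ^+ 2.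
  by rewrite (le_trans (normr_dotv_le _ _)) // expr2 ler_wpM2r ?enorm_ge0.
move: h1 h2 h4; rewrite /moreau; move: (prox h (y + v)) (prox h y) => p' p.
rewrite !enorm_sqr ler_norml => h1 h2 /andP[h4 h5].
have e1 : p - (y + v) = (p - y) - v by rewrite opprD addrA.
have e2 : p' - (y + v) = (p' - p) + (p - y) - v by rewrite subrKA opprD addrA.
have e3 : p' - y = (p' - p) + (p - y) by rewrite subrKA.
have e4 : y - p = - (p - y) by rewrite opprB.
rewrite ?e1 ?e2 ?e3 ?e4 in h1 h2 h4 h5 *.
move: (p' - p) (p - y) h1 h2 h4 h5 => a b.
rewrite ler_norml !dotvE (dotvC v a) (dotvC v b) (dotvC b a) => h1 h2 h4 h5.
by apply/andP; split; lra.
Qed.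

Lemma cvg_moreau_quotient (y : 'rV[R]_d) j :
  y 0 j - n.+1%:R * (moreau (y + n.+1%:R^-1 *: delta_mx 0 j) - moreau y)
    @[n --> \oo] --> prox h y 0 j.
Proof.
apply/cvgrPdist_le => e e0.
have h0 : (n.+1%:R^-1 : R) @[n --> \oo] --> (0 : R) by exact: cvg_harmonic.
move/cvgrPdist_le : h0 => /(_ _ e0); apply: filterS => n.
rewrite sub0r normrN ger0_norm ?invr_ge0 // => ne.
have n0 : 0 < n.+1%:R :> R by rewrite ltr0n.
have := moreau_taylor y (n.+1%:R^-1 *: delta_mx 0 j).
have -> : enorm (n.+1%:R^-1 *: delta_mx 0 j : 'rV[R]_d) ^+ 2 = n.+1%:R^-1 ^+ 2.
  by rewrite enorm_sqr dotvZl dotvZr mulrA dotv_delta mxE !eqxx mulr1 expr2.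
have -> : dotv (y - prox h y) (n.+1%:R^-1 *: delta_mx 0 j) = n.+1%:R^-1 * (y 0 j - prox h y 0 j).
  by rewrite dotvZr dotv_delta !mxE.
move: (moreau _ - moreau _) => D hD.
have -> : prox h y 0 j - (y 0 j - n.+1%:R * D) =
    n.+1%:R * (D - n.+1%:R^-1 * (y 0 j - prox h y 0 j)).
  by rewrite mulrBr mulrA divff ?gt_eqF // mul1r; ring.
rewrite normrM gtr0_norm //; apply: le_trans ne.
rewrite -ler_pdivlMl // (le_trans hD) //.
rewrite expr2 -[leRHS]mul1r ler_wpM2r ?mulr_ge0 ?invr_ge0 //; lra.
Qed.

End moreau_envelope.

Section measurable_integrands.
Context {R : realType} {d : nat} {dX : measure_display} {Xi : measurableType dX}.
Context {dT : measure_display} {T : measurableType dT}.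
Variables (f : 'rV[R]_d -> Xi -> R)
  (mf : measurable_fun [set: borel_rV R d * Xi] (fun p => f p.1 p.2)).

Lemma measurable_integrand (u : T -> 'rV[R]_d) (s : T -> Xi) :
  measurable_fun setT (u : T -> borel_rV R d) -> measurable_fun setT s ->
  measurable_fun setT (fun t => f (u t) (s t)).
Proof.
by move=> mu ms; exact: (measurableT_comp mf (measurable_fun_pair mu ms)).
Qed.

Lemma measurable_grad (u : T -> 'rV[R]_d) (s : T -> Xi) :
  (forall s x, differentiable (f ^~ s) x) ->
  measurable_fun setT (u : T -> borel_rV R d) -> measurable_fun setT s ->
  measurable_fun setT ((fun t => grad (f ^~ (s t)) (u t)) : T -> borel_rV R d).
Proof.
move=> df mu ms; apply: measurable_rV => j; under eq_fun do rewrite mxE.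
apply: measurable_fun_cvg => [n|t _]; last exact: cvg_difference_quotient.
apply: measurable_funM => //; apply: measurable_funB.
  by apply: measurable_integrand => //; exact: measurable_rVD.
exact: measurable_integrand.
Qed.

Hypothesis cf : forall s, convex_fun (f ^~ s).

Let measurable_moreau (c : R) (u : T -> 'rV[R]_d) (s : T -> Xi) : 0 <= c ->
  measurable_fun setT (u : T -> borel_rV R d) -> measurable_fun setT s ->
  measurable_fun setT (fun t => moreau (fun y => c * f y (s t)) (u t)).
Proof.
move=> c0 mu ms; apply: (measurability _ (measurable_realfun.RGenInftyO.measurableE R)).
move=> /= _ [_ [a ->] <-]; rewrite setTI.
rewrite (_ : _ @^-1` _ = \bigcup_q [set t |
    c * f (ratv q) (s t) + 2^-1 * enorm (ratv q - u t) ^+ 2 < a]).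
  apply: countable_bigcupT_measurable => [|q]; first exact: countableP.
  apply: measurable_set_lt => //; apply: measurable_funD.
    by apply: measurable_funM => //; apply: measurable_integrand.
  apply: measurable_funM => //; apply: measurable_funX.
  by apply: measurable_enorm; exact: measurable_rVB.
apply/seteqP; split => t /=; rewrite in_itv /=.
  by move=> /(moreau_ltP (convex_funZ c0 (cf _)))[q qa]; exists q.
by move=> [q _ qa]; apply/(moreau_ltP (convex_funZ c0 (cf _))); exists q.
Qed.

(* The proximal map is the gradient of [|y|^2 / 2 - moreau y], hence a limit of
   difference quotients of the Moreau envelope, which is measurable as an
   infimum over rational points. *)
Lemma measurable_prox (c : R) (u : T -> 'rV[R]_d) (s : T -> Xi) : 0 <= c ->
  measurable_fun setT (u : T -> borel_rV R d) -> measurable_fun setT s ->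
  measurable_fun setT
    ((fun t => prox (fun y => c * f y (s t)) (u t)) : T -> borel_rV R d).
Proof.
move=> c0 mu ms; apply: measurable_rV => j.
apply: measurable_fun_cvg => [n|t _]; last first.
  exact: (cvg_moreau_quotient (convex_funZ c0 (cf (s t)))).
apply: measurable_funB; first exact: measurable_rVP.
apply: measurable_funM => //; apply: measurable_funB; apply: measurable_moreau => //.
exact: measurable_rVD.
Qed.

End measurable_integrands.

(** * Independence from the past *)

Section independent_pair.
Local Open Scope ereal_scope.
Context {dO dU dS : measure_display} {Omega : measurableType dO}
  {U : measurableType dU} {S : measurableType dS} {R : realType}
  (P : probability Omega R) (Y : {RV P >-> U}) (X : {RV P >-> S}).
Hypothesis indep : forall A B, measurable A -> measurable B ->
  P (Y @^-1` A `&` X @^-1` B) = P (Y @^-1` A) * P (X @^-1` B).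

Let pair w := (Y w, X w).
Let mpair : measurable_fun setT pair.
Proof. by apply: measurable_fun_pair; exact: measurable_funP. Qed.
Let YX : {RV P >-> (U * S)%type} :=
  HB.pack pair (isMeasurableFun.Build _ _ _ _ _ mpair).

Let joint_law A : measurable A ->
  distribution P YX A = (distribution P Y \x distribution P X) A.
Proof.
by move=> mA; apply/esym/product_measure_unique => // B C mB mC; exact: indep.
Qed.

(** Takes the place of conditioning on [Y]: the joint law is the product of the laws, and Tonelli's
    theorem integrates [X] out first. *)
Lemma ge0_integral_independent (h : U * S -> \bar R) :
  measurable_fun setT h -> (forall z, 0 <= h z) ->
  \int[P]_w h (Y w, X w) = \int[P]_w \int[distribution P X]_s h (Y w, s).
Proof.
move=> mh h0; transitivity (\int[distribution P YX]_z h z).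
  by rewrite ge0_integral_distribution.
rewrite (eq_measure_integral (distribution P Y \x distribution P X)); last first.
  by move=> A mA _; exact: joint_law.
rewrite fubini_tonelli1 // ge0_integral_distribution //.
  exact: measurable_fun_fubini_tonelli_F.
by move=> y; apply: integral_ge0.
Qed.

(** Integrability of the product is obtained first, from the nonnegative case applied to its
    absolute value; Fubini's theorem then factors the integral. *)
Lemma integrable_independentM (y : U -> R) (z : S -> R) :
  measurable_fun setT y -> measurable_fun setT z ->
  P.-integrable setT (EFin \o (y \o Y)) -> P.-integrable setT (EFin \o (z \o X)) ->
  P.-integrable setT (fun w => (y (Y w) * z (X w))%:E) /\
  \int[P]_w (y (Y w) * z (X w))%:E =
    (\int[P]_w (y (Y w))%:E) * \int[P]_w (z (X w))%:E.
Proof.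
move=> my mz iy iz.
pose h (p : U * S) := (y p.1 * z p.2)%:E.
have mh : measurable_fun setT h.
  by apply/measurable_EFinP; apply: measurable_funM; exact: measurableT_comp.
have iz' : (distribution P X).-integrable setT (EFin \o z).
  by apply: integrable_pushforward => //; exact/measurable_EFinP.
have iy' : (distribution P Y).-integrable setT (EFin \o y).
  by apply: integrable_pushforward => //; exact/measurable_EFinP.
have inth : P.-integrable setT (fun w => h (Y w, X w)).
  apply/integrableP; split; first exact: (measurableT_comp mh mpair).
  rewrite (ge0_integral_independent (h := fun p => `|h p|)) //; last first.
    exact: measurableT_comp.
  have zfin := integrable_fin_num measurableT (integrable_abse iz').
  under eq_integral => w _.
    under eq_integral do rewrite /h /= normrM EFinM.
    rewrite ge0_integralZl_EFin //; last first.
      by apply/measurable_EFinP; exact: measurableT_comp.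
    rewrite -(fineK zfin).
    over.
  rewrite -(@ge0_integral_distribution _ _ _ _ _ P Y (fun u => `|y u|%:E * (fine (\int[distribution P X]_s `|(EFin \o z) s|))%:E)) //; last 2 first.
  - apply/measurable_EFinP; apply: measurable_funM => //; exact: measurableT_comp.
  - by move=> u; rewrite -EFinM lee_fin mulr_ge0 // fine_ge0 // integral_ge0.
  rewrite ge0_integralZr //; last 2 first.
  - by apply/measurable_EFinP; exact: measurableT_comp.
  - by rewrite lee_fin fine_ge0 // integral_ge0.
  rewrite lte_mul_pinfty ?integral_ge0 //.
    by apply: integrable_fin_num => //; exact: (integrable_abse iy').
  by rewrite ltry.
split => //.
transitivity (\int[distribution P YX]_z h z).
  by rewrite integral_distribution.
have ih : (distribution P Y \x distribution P X).-integrable setT h.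
  apply/integrableP; split => //; move/integrableP : inth => [_].
  rewrite -(@ge0_integral_distribution _ _ _ _ _ P YX (fun p => `|h p|)) //; last first.
    exact: measurableT_comp.
  rewrite (eq_measure_integral (distribution P Y \x distribution P X)) //.
  by move=> A mA _; exact: joint_law.
rewrite (eq_measure_integral (distribution P Y \x distribution P X)); last first.
  by move=> A mA _; exact: joint_law.
have zfin : \int[P]_w (z (X w))%:E \is a fin_num by exact: integrable_fin_num.
rewrite -integral12_prod_meas1 // /fubini_F.
under eq_integral => u _.
  under eq_integral do rewrite /h /= EFinM.
  rewrite integralZl // (@integral_distribution _ _ _ _ _ P X (EFin \o z)) //; last exact/measurable_EFinP.
  rewrite -(fineK zfin).
  over.
rewrite integralZr //= fineK // (@integral_distribution _ _ _ _ _ P Y (EFin \o y)) //.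
exact/measurable_EFinP.
Qed.

End independent_pair.

Section history.
Context {dO dS : measure_display} {Omega : measurableType dO}
  {S : measurableType dS} {R : realType} (P : probability Omega R)
  (X : {RV P >-> S}) (Xs : nat -> {RV P >-> S}).

(* A pi-system generating the sigma-algebra of [Xs 0, ..., Xs (n - 1)]. *)
Definition history (n : nat) : set (set Omega) :=
  [set A | exists2 B : nat -> set S, (forall k, measurable (B k)) &
    A = \bigcap_(k in `I_n) (Xs k @^-1` B k)].

Local Notation F n := (g_sigma_algebraType (history n)).

Lemma measurable_preimage_RV k (B : set S) : measurable B -> measurable (Xs k @^-1` B).
Proof.
by move=> mB; rewrite -[X in measurable X]setTI; exact: (measurable_funP (Xs k)).
Qed.

Lemma history_measurable n : history n `<=` measurable.
Proof.
move=> _ [B mB ->]; apply: fin_bigcap_measurable; first exact: finite_II.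
by move=> k _; exact: measurable_preimage_RV.
Qed.

Lemma history_setI n : setI_closed (history n).
Proof.
move=> _ _ [B mB ->] [C mC ->]; exists (fun k => B k `&` C k).
  by move=> k; exact: measurableI.
by rewrite -bigcapI; apply: eq_bigcapr => k _; rewrite preimage_setI.
Qed.

Lemma sub_history m n : (m <= n)%N -> history m `<=` history n.
Proof.
move=> mn _ [B mB ->]; exists (fun k => if (k < m)%N then B k else setT).
  by move=> k; case: ifP.
apply/seteqP; split => [w Bw k /= kn|w Bw k /= km].
  by case: ifP => // km; exact: Bw.
by have := Bw k (leq_trans km mn); rewrite km.
Qed.

Lemma sigma_history_measurable n : <<s history n >> `<=` measurable.
Proof.
apply: smallest_sub; last exact: history_measurable.
exact: sigma_algebra_measurable.
Qed.

Section measurable_wrt_history.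
Context {dU : measure_display} {U : measurableType dU}.

Lemma measurable_history n (u : Omega -> U) :
  measurable_fun setT (u : F n -> U) -> measurable_fun setT u.
Proof.
by move=> mu _ B mB; apply: sigma_history_measurable (mu _ B mB); exact: measurableT.
Qed.

Lemma measurable_historyW m n (u : Omega -> U) : (m <= n)%N ->
  measurable_fun setT (u : F m -> U) -> measurable_fun setT (u : F n -> U).
Proof.
move=> mn mu _ B mB; have := mu measurableT B mB.
exact: sub_smallest2r (sub_history mn) _.
Qed.

End measurable_wrt_history.

Lemma measurable_history_RV k n : (k < n)%N ->
  measurable_fun setT (Xs k : F n -> S).
Proof.
move=> kn _ B mB; rewrite setTI; apply: sub_sigma_algebra.
exists (fun j => if j == k then B else setT); first by move=> j; case: ifP.
apply/seteqP; split => [w Bw j /= jn|w /(_ k kn)]; last by rewrite /= eqxx.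
by case: eqVneq => // ->.
Qed.

Hypothesis iid : iid_copies X Xs.

Lemma iid_preimage k (B : set S) : measurable B ->
  P (Xs k @^-1` B) = P (X @^-1` B).
Proof. by move=> mB; exact: iid.2. Qed.

Let prob_bigcap n (B : nat -> set S) : (forall k, measurable (B k)) ->
  P (\bigcap_(k in `I_n) (Xs k @^-1` B k)) =
  (\prod_(0 <= k < n) P (Xs k @^-1` B k))%E.
Proof.
move=> mB; have := iid.1 [fset k | k in iota 0 n]%fset B mB.
rewrite (_ : [set` _] = `I_n); last first.
  by apply/seteqP; split => k /=; rewrite !inE mem_iota add0n.
move=> ->; rewrite /index_iota subn0; apply: perm_big.
apply: uniq_perm; [exact: fset_uniq|exact: iota_uniq|].
by move=> k; rewrite inE.
Qed.

(** For fixed [B] both sides are finite measures of [A]; they agree on the pi-system [history n] by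
    mutual independence, hence on the sigma-algebra it generates. *)
Lemma history_independent n (A : set Omega) (B : set S) :
  <<s history n >> A -> measurable B ->
  P (A `&` Xs n @^-1` B) = (P A * P (Xs n @^-1` B))%E.
Proof.
move=> sA mB; have mXB := measurable_preimage_RV n mB.
have pfin : P (Xs n @^-1` B) \is a fin_num by exact: fin_num_measure.
have p0 : 0 <= fine (P (Xs n @^-1` B)) by rewrite fine_ge0.
have := @g_sigma_algebra_measure_unique _ _ _ (history n)
  (@history_measurable n) (fun=> setT) _ _
  (mrestr P mXB) (mscale (NngNum p0) P) (@history_setI n).
move=> /(_ _ _ _ _ A sA).
rewrite /= /mrestr /mscale /= fineK // muleC; apply.
- move=> _; exists (fun=> setT) => //.
  by apply/seteqP; split.
- by rewrite bigcup_const //; exists 0%N.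
- move=> _ [C mC ->]; rewrite muleC.
  (* With [B] in position [n], the event of the past and that of the new sample form a single
     cylinder of length [n.+1]. *)
  pose C' k := if (k < n)%N then C k else B.
  have mC' k : measurable (C' k) by rewrite /C'; case: ifP.
  have -> : \bigcap_(k in `I_n) (Xs k @^-1` C k) = \bigcap_(k in `I_n) (Xs k @^-1` C' k).
    by apply: eq_bigcapr => k /= kn; rewrite /C' kn.
  have C'n : C' n = B by rewrite /C' ltnn.
  have -> : \bigcap_(k in `I_n) (Xs k @^-1` C' k) `&` Xs n @^-1` B =
      \bigcap_(k in `I_n.+1) (Xs k @^-1` C' k).
    by rewrite IISl bigcap_setU1 C'n setIC.
  by rewrite -[in RHS]C'n !prob_bigcap // big_nat_recr.
- by move=> _; rewrite setTI ltey_eq pfin.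
Qed.

(** The identity, seen as a random variable with values in [Omega] equipped with the sigma-algebra
    of the past. Independence of this variable from [Xs n] covers all functions of the past at
    once. *)
Let id_fun n (w : Omega) : F n := w.

Let measurable_id_fun n : measurable_fun setT (id_fun n).
Proof.
by move=> _ B mB; rewrite setTI; exact: (@sigma_history_measurable n B mB).
Qed.

Let id_history n : {RV P >-> F n} :=
  HB.pack (id_fun n) (isMeasurableFun.Build _ _ _ _ _ (@measurable_id_fun n)).

Let indep_history n (A : set (F n)) (B : set S) : measurable A -> measurable B ->
  P (id_history n @^-1` A `&` Xs n @^-1` B)
  = (P (id_history n @^-1` A) * P (Xs n @^-1` B))%E.
Proof. by move=> mA mB; exact: (@history_independent n A B mA mB). Qed.

Lemma iid_ge0_integral k (h : S -> \bar R) : measurable_fun setT h ->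
  (forall s, 0 <= h s)%E -> (\int[P]_w h (Xs k w) = \int[P]_w h (X w))%E.
Proof.
move=> mh h0; rewrite -(@ge0_integral_distribution _ _ _ _ _ P (Xs k)) //.
rewrite -(@ge0_integral_distribution _ _ _ _ _ P X) //.
by apply: eq_measure_integral => B mB _; exact: iid.2.
Qed.

Lemma iid_integrable k (z : S -> R) : measurable_fun setT z ->
  P.-integrable setT (EFin \o (z \o X)) ->
  P.-integrable setT (EFin \o (z \o Xs k)) /\
  (\int[P]_w (z (Xs k w))%:E = \int[P]_w (z (X w))%:E)%E.
Proof.
move=> mz iz.
have izk : P.-integrable setT (EFin \o (z \o Xs k)).
  move/integrableP : iz => [_ iz]; apply/integrableP; split.
    by apply/measurable_EFinP; exact: measurableT_comp.
  rewrite (@iid_ge0_integral k (fun s => `|(z s)%:E|%E)) //.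
  by apply: measurableT_comp => //; exact/measurable_EFinP.
split => //.
rewrite -(@integral_distribution _ _ _ _ _ P (Xs k) (EFin \o z)) //; last first.
  exact/measurable_EFinP.
rewrite -(@integral_distribution _ _ _ _ _ P X (EFin \o z)) //; last first.
  exact/measurable_EFinP.
by apply: eq_measure_integral => B mB _; exact: iid.2.
Qed.

(** The inner integral is the conditional expectation given the past; the law of [Xs n] is replaced
    by the common law of the samples. *)
Lemma history_ge0_integral n (h : Omega -> S -> \bar R) :
  measurable_fun [set: F n * S] (fun p => h p.1 p.2) ->
  (forall w s, 0 <= h w s)%E ->
  (\int[P]_w h w (Xs n w) = \int[P]_w \int[distribution P X]_s h w s)%E.
Proof.
move=> mh h0.
rewrite (ge0_integral_independent (@indep_history n) mh) //.
apply: eq_integral => w _.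
by apply: eq_measure_integral => B mB _; exact: iid.2.
Qed.

Lemma history_integrableM n (y : Omega -> R) (z : S -> R) :
  measurable_fun setT (y : F n -> R) -> measurable_fun setT z ->
  P.-integrable setT (EFin \o y) -> P.-integrable setT (EFin \o (z \o X)) ->
  P.-integrable setT (fun w => (y w * z (Xs n w))%:E) /\
  (\int[P]_w (y w * z (Xs n w))%:E =
    (\int[P]_w (y w)%:E) * \int[P]_w (z (X w))%:E)%E.
Proof.
move=> my mz iy iz; have [izn <-] := iid_integrable n mz iz.
exact: (integrable_independentM (@indep_history n) my mz).
Qed.

End history.

(** * Integrals of real functions and almost sure summability *)

Section real_integrals.
Context {dO : measure_display} {Omega : measurableType dO} {R : realType}
  (P : probability Omega R).
Implicit Types u v : Omega -> R.

Lemma integrable_measurable u : P.-integrable setT (EFin \o u) ->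
  measurable_fun setT u.
Proof. by move=> /measurable_int/measurable_EFinP. Qed.

Lemma integrable_le u v : measurable_fun setT u ->
  P.-integrable setT (EFin \o v) -> (forall w, `|u w| <= v w) ->
  P.-integrable setT (EFin \o u).
Proof.
move=> mu iv uv; apply: le_integrable iv => //; first exact/measurable_EFinP.
by move=> w _ /=; rewrite lee_fin (le_trans (uv w)) // ler_norm.
Qed.

Lemma integrable_cst (c : R) : P.-integrable setT (EFin \o cst c).
Proof. exact: finite_measure_integrable_cst. Qed.

Lemma Rintegral_probability_cst (c : R) : \int[P]_w c = c.
Proof.
have P1 : fine (P setT) = 1 by rewrite [P setT]probability_setT.
by rewrite Rintegral_cst // P1 mulr1.
Qed.

Lemma integrable_add u v : P.-integrable setT (EFin \o u) ->
  P.-integrable setT (EFin \o v) -> P.-integrable setT (EFin \o (fun w => u w + v w)).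
Proof. by move=> iu iv; apply: (eq_integrable _ _ _ _ (integrableD _ iu iv)). Qed.

Lemma integrable_scale (c : R) u : P.-integrable setT (EFin \o u) ->
  P.-integrable setT (EFin \o (fun w => c * u w)).
Proof. by move=> iu; apply: (eq_integrable _ _ _ _ (integrableZl _ c iu)). Qed.

Lemma integrable_of_sqr u : measurable_fun setT u ->
  P.-integrable setT (EFin \o (fun w => u w ^+ 2)) ->
  P.-integrable setT (EFin \o u).
Proof.
move=> mu iu; apply: (integrable_le mu (integrable_add (integrable_cst 1) iu)).
move=> w /=; rewrite -(real_normK (num_real (u w))).
by have := sqr_ge0 (`|u w| - 1); nra.
Qed.

Lemma integrable_bounded_mul (c : R) u v : measurable_fun setT u ->
  (forall w, `|u w| <= c) -> P.-integrable setT (EFin \o v) ->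
  P.-integrable setT (EFin \o (fun w => u w * v w)).
Proof.
move=> mu uc iv; apply: (@integrable_le _ (fun w => c * `|v w|)).
- by apply: measurable_funM => //; exact: integrable_measurable.
- by apply: integrable_scale; exact: (integrable_abse iv).
- by move=> w; rewrite normrM ler_wpM2r.
Qed.

Lemma chebyshev_sqr u (l : R) : 0 < l ->
  P.-integrable setT (EFin \o (fun w => u w ^+ 2)) -> measurable_fun setT u ->
  (P [set w | (l < `|u w|)%R] <= (l ^- 2 * \int[P]_w (u w ^+ 2))%:E)%E.
Proof.
move=> l0 iu mu; set A := [set w | _].
have mA : measurable A.
  rewrite (_ : A = (fun w => `|u w|) @^-1` `]l, +oo[%classic); last first.
    by apply/seteqP; split => w /=; rewrite in_itv /= andbT.
  by rewrite -[X in measurable X]setTI; apply: measurableT_comp.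
have pfin : P A \is a fin_num by exact: fin_num_measure.
have i1 : P.-integrable setT (EFin \o \1_A) by exact: integrable_indic.
have -> : P A = (\int[P]_w \1_A w)%:E.
  by rewrite /Rintegral integral_indic // setIT fineK.
rewrite lee_fin ler_pdivlMl ?exprn_gt0 // -(RintegralZl _ measurableT i1).
apply: le_Rintegral => //; first exact: integrable_scale.
move=> w _; rewrite indicE; case: (boolP (w \in A)) => /= [wA|_]; rewrite ?mulr1 ?mulr0 ?sqr_ge0 //.
rewrite -[leRHS]real_normK ?num_real // lerXn2r ?nnegrE ?(ltW l0) //.
by move: wA; rewrite inE /A /= => /ltW.
Qed.

(** By monotone convergence the sum has an integral of at most [C], so it is finite almost
    everywhere. *)
Lemma ae_nneseries_lty (g : nat -> Omega -> \bar R) (C : R) :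
  (forall n w, (0 <= g n w)%E) -> (forall n, measurable_fun setT (g n)) ->
  (forall n, (\sum_(0 <= k < n) \int[P]_w g k w <= C%:E)%E) ->
  {ae P, forall w, (\sum_(n <oo) g n w < +oo)%E}.
Proof.
move=> g0 mg gC; pose h w := (\sum_(n <oo) g n w)%E.
have mh : measurable_fun setT h.
  by apply: (@ge0_emeasurable_sum _ _ _ _ g predT) => [n w Dw Pn|n _].
have ih : P.-integrable setT h.
  apply/integrableP; split => //.
  under eq_integral => w _.
    rewrite gee0_abs; last by apply: nneseries_ge0.
    over.
  rewrite /= integral_nneseries // (@le_lt_trans _ _ C%:E) ?ltry //.
  apply: lime_le; last exact: nearW.
  by apply: is_cvg_nneseries => n _ _; exact: integral_ge0.
have := integrable_ae measurableT ih; apply: filterS => w /(_ I).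
by rewrite ge0_fin_numE // nneseries_ge0.
Qed.

Lemma ae_summable (u : nat -> Omega -> R) (C : R) :
  (forall n w, 0 <= u n w) ->
  (forall n, P.-integrable setT (EFin \o u n)) ->
  (forall n, \sum_(0 <= k < n) \int[P]_w u k w <= C) ->
  {ae P, forall w, cvgn (series (u ^~ w))}.
Proof.
move=> u0 iu uC.
have : {ae P, forall w, (\sum_(n <oo) (u n w)%:E < +oo)%E}.
  apply: (@ae_nneseries_lty _ C) => [n w|n|n]; first by rewrite lee_fin.
    exact: measurable_int (iu n).
  rewrite (@le_trans _ _ (\sum_(0 <= k < n) \int[P]_w u k w)%:E) ?lee_fin //.
  rewrite -sumEFin; apply: lee_sum => k _.
  by rewrite /Rintegral fineK //; exact: (integrable_fin_num measurableT (iu k)).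
apply: filterS => w uw.
have {}uw : (\sum_(n <oo) (u n w)%:E)%E \is a fin_num.
  by rewrite ge0_fin_numE // nneseries_ge0 // => n _ _; rewrite lee_fin.
apply: nondecreasing_is_cvgn.
  by apply: nondecreasing_series => n _ _.
exists (fine (\sum_(n <oo) (u n w)%:E)%E) => _ [n _ <-].
rewrite -lee_fin fineK // /series /= -sumEFin.
by apply: nneseries_lim_ge => k _ _; rewrite lee_fin.
Qed.

End real_integrals.

(** * Convergence of martingales bounded in L2 *)

(** Cauchy's criterion with tolerances indexed by integers, so that almost sure convergence follows
    from countably many almost sure events. *)
Lemma series_cauchy_cvg (R : realType) (u : nat -> R) :
  (forall i : nat, exists m, forall k, `|\sum_(m <= j < m + k) u j| <= i.+1%:R^-1) ->
  cvgn (series u).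
Proof.
move=> H; apply: cauchy_cvg; apply: cauchy_exP => e e0.
have [i ie] : exists i, i.+1%:R^-1 < e.
  by have [i] := ltr_add_invr e0; rewrite add0r; exists i.
have [m Hm] := H i; exists (series u m); exists m => // n /= mn.
rewrite -ball_normE /= distrC; apply: le_lt_trans ie.
have -> : series u n - series u m = \sum_(m <= j < n) u j by rewrite sub_series_geq.
by have := Hm (n - m)%N; rewrite subnKC.
Qed.

Section martingale_convergence.
Context {dO dS : measure_display} {Omega : measurableType dO}
  {S : measurableType dS} {R : realType} (P : probability Omega R)
  (Xs : nat -> {RV P >-> S}).

Local Notation F n := (g_sigma_algebraType (history Xs n)).

Variables (D : nat -> Omega -> R) (C : R).
Hypotheses (mD : forall n, measurable_fun setT (D n : F n.+1 -> R))
  (iD2 : forall n, P.-integrable setT (EFin \o (fun w => D n w ^+ 2)))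
  (orthD : forall n (eta : Omega -> R) (c : R),
    measurable_fun setT (eta : F n -> R) -> (forall w, `|eta w| <= c) ->
    \int[P]_w (eta w * D n w) = 0)
  (D2C : forall n, \sum_(0 <= k < n) \int[P]_w (D k w ^+ 2) <= C).

Section stopped_sum.
Variables (m : nat) (l : R).
Hypothesis l0 : 0 < l.

(* The sum of the increments [D m, D m.+1, ...], stopped when it leaves [-l, l]. *)
Fixpoint stopped_sum (k : nat) (w : Omega) : R :=
  if k isn't k'.+1 then 0 else
  if `|stopped_sum k' w| <= l then stopped_sum k' w + D (m + k') w
  else stopped_sum k' w.

Local Notation N := stopped_sum.

Let measurable_alive k : measurable_fun setT (N k : F (m + k)%N -> R) ->
  measurable_fun setT ((fun w => `|N k w| <= l) : F (m + k)%N -> bool).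
Proof.
by move=> mN; apply: measurable_fun_ler => //; exact: measurableT_comp.
Qed.

Let measurable_stopped k : measurable_fun setT (N k : F (m + k)%N -> R).
Proof.
elim: k => [|k IH] /=; first exact: measurable_cst.
have IH' := measurable_historyW (leqnSn (m + k)) IH.
rewrite addnS; apply: measurable_fun_ifT => //.
  exact: (measurable_historyW (leqnSn (m + k)) (measurable_alive IH)).
by apply: measurable_funD => //; exact: mD.
Qed.

Let alive k w : R := if `|N k w| <= l then 1 else 0.

Let malive k : measurable_fun setT (alive k : F (m + k)%N -> R).
Proof. by apply: measurable_fun_ifT => //; exact: measurable_alive. Qed.

Let alive01 k w : `|alive k w| <= 1.
Proof. by rewrite /alive; case: ifP; rewrite ?normr0 ?normr1. Qed.

(** Stopping makes the cross term harmless: [alive k w * N k w] is bounded by [l] and depends on the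
    past only, so [orthD] gives that term a zero integral. The sum itself need not be bounded, as
    its last increment may overshoot. *)
Let stopped_sqr k w : N k.+1 w ^+ 2 =
  N k w ^+ 2 + (2 * (alive k w * N k w) * D (m + k) w + alive k w * D (m + k) w ^+ 2).
Proof. by rewrite /= /alive; case: ifP => _; ring. Qed.

Let iD n : P.-integrable setT (EFin \o D n).
Proof.
exact: (integrable_of_sqr (measurable_history (@mD n)) (iD2 n)).
Qed.

Let aliveN_bound k w : `|2 * (alive k w * N k w)| <= 2 * l.
Proof.
rewrite normrM ger0_norm // ler_pM2l // /alive; case: ifP => [Nl|_].
  by rewrite mul1r.
by rewrite mul0r normr0 ltW.
Qed.

Let maliveN k : measurable_fun setT ((fun w => 2 * (alive k w * N k w)) : F (m + k)%N -> R).
Proof. by apply: measurable_funM => //; exact: measurable_funM. Qed.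

Let stopped_moment k : P.-integrable setT (EFin \o (fun w => N k w ^+ 2)) /\
  \int[P]_w (N k w ^+ 2) <= \sum_(m <= j < m + k) \int[P]_w (D j w ^+ 2).
Proof.
elim: k => [|k [iN leN]].
  rewrite addn0 big_geq //; split.
    by rewrite [X in EFin \o X](_ : _ = cst 0); [exact: integrable_cst|rewrite /= expr0n].
  by under eq_Rintegral do rewrite /= expr0n /=; rewrite Rintegral_cst // mul0r.
have i1 : P.-integrable setT (EFin \o (fun w => 2 * (alive k w * N k w) * D (m + k) w)).
  exact: (integrable_bounded_mul (measurable_history (@maliveN k)) (aliveN_bound k) (iD _)).
have i2 : P.-integrable setT (EFin \o (fun w => alive k w * D (m + k) w ^+ 2)).
  exact: (integrable_bounded_mul (measurable_history (@malive k)) (alive01 k) (iD2 _)).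
have i12 := integrable_add i1 i2.
rewrite [X in EFin \o X](_ : _ = (fun w => N k w ^+ 2 + (2 * (alive k w * N k w) * D (m + k) w + alive k w * D (m + k) w ^+ 2))); last first.
  by apply/funext => w; exact: stopped_sqr.
split; first exact: integrable_add.
under eq_Rintegral do rewrite stopped_sqr.
rewrite RintegralD // RintegralD // (orthD (@maliveN k) (aliveN_bound k)) add0r.
rewrite addnS big_nat_recr ?leq_addr //= lerD //.
apply: le_Rintegral => // w _.
by rewrite ler_piMl ?sqr_ge0 // (le_trans (ler_norm _)).
Qed.

Let stopped_absorbed k w : l < `|N k w| -> l < `|N k.+1 w|.
Proof. by move=> Nl; rewrite /= leNgt Nl. Qed.

Let stopped_alive k w : `|N k w| <= l -> N k w = \sum_(m <= j < m + k) D j w.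
Proof.
elim: k => [|k IH] Nl; first by rewrite addn0 big_geq.
have Nk : `|N k w| <= l by rewrite leNgt; apply/negP => /stopped_absorbed; rewrite ltNge Nl.
by rewrite addnS big_nat_recr ?leq_addr //= Nk -IH.
Qed.

(** Kolmogorov's inequality. A stopped sum that has left [[-l, l]] stays outside, so the exit events
    increase, and Chebyshev's inequality bounds each of them by the second moment of the stopped
    sum. *)
Lemma maximal_inequality :
  exists A : set Omega, [/\ measurable A,
    forall w, ~ A w -> forall k, `|\sum_(m <= j < m + k) D j w| <= l &
    forall c, (forall k, \sum_(m <= j < m + k) \int[P]_w (D j w ^+ 2) <= c) ->
      (P A <= (l ^- 2 * c)%:E)%E].
Proof.
pose A k := [set w | l < `|N k w|].
have mN k : measurable_fun setT (N k) by exact: (measurable_history (@measurable_stopped k)).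
have mA k : measurable (A k).
  rewrite (_ : A k = ~` [set w | `|N k w| <= l]); last first.
    by apply/seteqP; split => w /=; rewrite /A /= ltNge => /negP.
  apply: measurableC; rewrite -[X in measurable X]setTI.
  by apply: measurable_fun_le => //; exact: measurableT_comp.
have mUA : measurable (\bigcup_k A k) by exact: bigcupT_measurable.
exists (\bigcup_k A k); split => //.
  move=> w nA k; have Nk : `|N k w| <= l.
    by rewrite leNgt; apply/negP => ?; apply: nA; exists k.
  by rewrite -stopped_alive.
move=> c Hc.
have ndA : nondecreasing_seq A.
  apply/nondecreasing_seqP => k; apply/subsetPset => w; exact: stopped_absorbed.
have cvA := nondecreasing_cvg_mu (mu := P) mA mUA ndA.
rewrite -(cvg_lim _ cvA) //; apply: lime_le; first by apply/cvg_ex; eexists; exact: cvA.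
apply: nearW => k /=; have [iN leN] := stopped_moment k.
apply: (le_trans (chebyshev_sqr l0 iN (mN k))); rewrite lee_fin.
by rewrite ler_wpM2l ?invr_ge0 ?exprn_ge0 ?(ltW l0) // (le_trans leN).
Qed.

End stopped_sum.

(** The martingale property enters as [orthD]. For each tolerance, the paths whose tails are never
    small lie in every exit event [A m], and the probability of [A m] tends to 0 with the tail of
    the variances. *)
Lemma martingale_cvg : {ae P, forall w, cvgn (series (D ^~ w))}.
Proof.
pose q k := \int[P]_w (D k w ^+ 2).
have q0 k : 0 <= q k by apply: Rintegral_ge0 => w _; exact: sqr_ge0.
have cq : cvgn (series q).
  apply: nondecreasing_is_cvgn; first by apply: nondecreasing_series => k _ _.
  by exists C => _ [n _ <-]; exact: D2C.
have tail m k : \sum_(m <= j < m + k) q j <= limn (series q) - series q m.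
  have : series q (m + k)%N <= limn (series q).
    by apply: nondecreasing_cvgn_le => //; apply: nondecreasing_series => j _ _.
  by rewrite -(sub_series_geq _ (leq_addr k m)) lerD2r.
suff H (i : nat) : {ae P, forall w, exists m, forall k, `|\sum_(m <= j < m + k) D j w| <= i.+1%:R^-1}.
  by have /ae_foralln := H; apply: filterS => w; exact: series_cauchy_cvg.
have l0 : 0 < i.+1%:R^-1 :> R by rewrite invr_gt0 ltr0n.
have [A HA] := choice (fun m => @maximal_inequality m _ l0).
exists (\bigcap_m A m); split.
- by apply: bigcapT_measurable => m; have [] := HA m.
- apply/eqP; rewrite eq_le measure_ge0 andbT; apply/lee_addgt0Pr => e e0.
  rewrite add0e.
  (* Choice of an [m] beyond which the variances sum to at most [l ^+ 2 * e] for the tolerance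
     [l = i.+1%:R^-1], so that the maximal inequality bounds the probability by [e]. *)
  have : series q m @[m --> \oo] --> limn (series q) by [].
  move/cvgrPdist_le => /(_ (i.+1%:R^-1 ^+ 2 * e)) []; first by rewrite mulr_gt0 // exprn_gt0.
  move=> m _ /(_ m (leqnn m)) /= hm.
  have [mA _ /(_ _ (tail m)) PA] := HA m.
  apply: (@le_trans _ _ (P (A m))).
    apply: le_measure; rewrite ?inE //; last by move=> w; exact.
    by apply: bigcapT_measurable => k; have [] := HA k.
  apply: (le_trans PA); rewrite lee_fin ler_pdivrMl ?exprn_gt0 //.
  exact: le_trans (ler_norm _) hm.
- move=> w nw m _; apply: contrapT => nA; apply: nw; exists m.
  by have [_ /(_ w nA)] := HA m.
Qed.

End martingale_convergence.

(** * Stochastic quasi-Fejer sequences *)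

(** Discrete Gronwall, from [1 + a <= expR a]. *)
Lemma sum_growth_bound (R : realType) (v a : nat -> R) (C : R) :
  (forall n, 0 <= a n) -> 0 <= v 0%N -> (forall n, v n.+1 <= (1 + a n) * v n) ->
  (forall n, \sum_(0 <= k < n) a k <= C) -> forall n, v n <= expR C * v 0%N.
Proof.
move=> a0 v0 va aC n.
suff : v n <= expR (\sum_(0 <= k < n) a k) * v 0%N.
  by move/le_trans; apply; rewrite ler_wpM2r // ler_expR.
elim: n => [|n IH]; first by rewrite big_geq // expR0 mul1r.
rewrite (le_trans (va n)) // big_nat_recr //= expRD.
rewrite (le_trans (ler_wpM2l _ IH)) ?addr_ge0 // mulrA ler_wpM2r //.
by rewrite mulrC ler_wpM2l ?expR_ge0 // expR_ge1Dx.
Qed.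

(** Adding the partial sums of [D] and removing those of [e] makes [V] nonincreasing, and it stays
    bounded below because both series converge. *)
Lemma quasi_fejer_cvg (R : realType) (V D e : nat -> R) :
  (forall n, 0 <= V n) -> (forall n, V n.+1 <= V n - D n + e n) ->
  cvgn (series D) -> cvgn (series e) -> cvgn V.
Proof.
move=> V0 VS cD ce.
pose W n := V n + series D n - series e n.
have VE : V = W \- series D \+ series e.
  by apply/funext => n /=; rewrite /W; ring.
have niW : nonincreasing_seq W.
  apply/nonincreasing_seqP => n; rewrite /W !seriesEnat /= !big_nat_recr //=.
  by have := VS n; lra.
have lbW : has_lbound (range W).
  have /cvg_seq_bounded/bounded_fun_has_lbound[M HM] : cvgn (series D \- series e).
    exact: is_cvgB.
  exists M => _ [n _ <-]; have := HM _ (imageT _ n).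
  by have := V0 n; rewrite /W /=; lra.
have cW : cvgn W by exact: nonincreasing_is_cvgn.
by rewrite VE; apply: is_cvgD => //; exact: is_cvgB.
Qed.

Section stochastic_fejer.
Context {dO dS : measure_display} {Omega : measurableType dO}
  {S : measurableType dS} {R : realType} (P : probability Omega R)
  (X : {RV P >-> S}) (Xs : nat -> {RV P >-> S}) (iid : iid_copies X Xs) {d : nat}.

Local Notation F n := (g_sigma_algebraType (history Xs n)).

Section adapted.
Variables (Phi : nat -> 'rV[R]_d -> S -> 'rV[R]_d) (x0 : 'rV[R]_d)
  (x : nat -> Omega -> 'rV[R]_d).
Hypotheses (mPhi : forall n, measurable_fun [set: borel_rV R d * S]
    ((fun p => Phi n p.1 p.2) : _ -> borel_rV R d))
  (x00 : forall w, x 0%N w = x0)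
  (xS : forall n w, x n.+1 w = Phi n (x n w) (Xs n w)).

Lemma adapted n : measurable_fun setT (x n : F n -> borel_rV R d).
Proof.
elim: n => [|n IH].
  rewrite (_ : x 0%N = cst x0); last by apply/funext.
  exact: measurable_cst.
rewrite (_ : x n.+1 = (fun p => Phi n p.1 p.2) \o (fun w => (x n w, Xs n w))); last first.
  by apply/funext => w /=; exact: xS.
apply: (measurableT_comp (mPhi n)); apply: measurable_fun_pair.
  exact: (measurable_historyW (leqnSn n) IH).
exact: measurable_history_RV.
Qed.

Lemma adapted_pair n {dU : measure_display} {U : measurableType dU}
    (h : 'rV[R]_d -> S -> U) :
  measurable_fun [set: borel_rV R d * S] (fun p => h p.1 p.2) ->
  measurable_fun [set: F n * S] (fun p => h (x n p.1) p.2).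
Proof.
move=> mh; apply: (measurableT_comp mh (g := fun p : F n * S => (x n p.1 : borel_rV R d, p.2))).
apply: measurable_fun_pair => //.
by apply: (measurableT_comp (@adapted n)).
Qed.

Lemma adapted_sample n {dU : measure_display} {U : measurableType dU}
    (h : 'rV[R]_d -> S -> U) :
  measurable_fun [set: borel_rV R d * S] (fun p => h p.1 p.2) ->
  measurable_fun setT ((fun w => h (x n w) (Xs n w)) : F n.+1 -> U).
Proof.
move=> mh; apply: (measurableT_comp mh (g := fun w : F n.+1 => (x n w : borel_rV R d, Xs n w))).
apply: measurable_fun_pair.
  exact: (measurable_historyW (leqnSn n) (@adapted n)).
exact: measurable_history_RV.
Qed.

End adapted.

Section everywhere.
Variables (Phi : nat -> 'rV[R]_d -> S -> 'rV[R]_d) (x0 : 'rV[R]_d)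
  (x : nat -> Omega -> 'rV[R]_d) (z : 'rV[R]_d) (c : nat -> R) (C : R)
  (zeta : S -> 'rV[R]_d) (B : S -> R) (D : nat -> 'rV[R]_d -> S -> R).
Hypotheses (mPhi : forall n, measurable_fun [set: borel_rV R d * S]
    ((fun p => Phi n p.1 p.2) : _ -> borel_rV R d))
  (x00 : forall w, x 0%N w = x0)
  (xS : forall n w, x n.+1 w = Phi n (x n w) (Xs n w))
  (cC : forall n, \sum_(0 <= k < n) c k ^+ 2 <= C)
  (mzeta : measurable_fun setT (zeta : S -> borel_rV R d))
  (izeta2 : P.-integrable setT (EFin \o (fun w => enorm (zeta (X w)) ^+ 2)))
  (Ezeta : forall j, (\int[P]_w (zeta (X w) 0 j)%:E = 0)%E)
  (mB : measurable_fun setT B) (B0 : forall s, 0 <= B s)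
  (iB : P.-integrable setT (EFin \o (B \o X)))
  (mD : forall n, measurable_fun [set: borel_rV R d * S] (fun p => D n p.1 p.2))
  (D0 : forall n y s, 0 <= D n y s)
  (fejer : forall n y s, enorm (Phi n y s - z) ^+ 2 <=
     enorm (y - z) ^+ 2 - D n y s - c n * dotv (zeta s) (y - z)
     + c n ^+ 2 * (B s * (1 + enorm (y - z) ^+ 2))).

Let V n w := enorm (x n w - z) ^+ 2.
Let Delta n w := c n * dotv (zeta (Xs n w)) (x n w - z).
Let err n w := c n ^+ 2 * ((1 + V n w) * B (Xs n w)).
Let Dx n w := D n (x n w) (Xs n w).
Let b := \int[P]_w B (X w).
Let bz := \int[P]_w (enorm (zeta (X w)) ^+ 2).

Let V0 n w : 0 <= V n w. Proof. exact: sqr_ge0. Qed.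
Let b0 : 0 <= b. Proof. by apply: Rintegral_ge0 => w _. Qed.
Let bz0 : 0 <= bz. Proof. by apply: Rintegral_ge0 => w _; exact: sqr_ge0. Qed.

Let mxz n : measurable_fun setT ((fun w => x n w - z) : F n -> borel_rV R d).
Proof. by apply: measurable_rVB => //; exact: (adapted mPhi x00 xS). Qed.

Let mV n : measurable_fun setT (V n : F n -> R).
Proof. by apply: measurable_funX; apply: measurable_enorm; exact: mxz. Qed.

Let mDx n : measurable_fun setT (Dx n : F n.+1 -> R).
Proof. exact: (adapted_sample mPhi x00 xS). Qed.

Let mDelta n : measurable_fun setT (Delta n : F n.+1 -> R).
Proof.
apply: measurable_funM => //; apply: measurable_dotv.
  by apply: (measurableT_comp mzeta); exact: measurable_history_RV.
exact: (measurable_historyW (leqnSn n) (@mxz n)).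
Qed.

Let path_ineq n w : V n.+1 w <= V n w - Dx n w - Delta n w + err n w.
Proof.
by rewrite {1}/V xS (le_trans (fejer _ _ _)) // /err /Dx /Delta (mulrC (B _)).
Qed.

Section one_step.
Variable n : nat.
Hypothesis iV : P.-integrable setT (EFin \o V n).

Let i1V : P.-integrable setT (EFin \o (fun w => 1 + V n w)).
Proof. by apply: integrable_add => //; exact: integrable_cst. Qed.

Let err_facts : P.-integrable setT (EFin \o err n) /\
  \int[P]_w err n w = c n ^+ 2 * ((1 + \int[P]_w V n w) * b).
Proof.
have m1V : measurable_fun setT ((fun w => 1 + V n w) : F n -> R).
  by apply: measurable_funD => //; exact: mV.
have [i1 e1] := history_integrableM iid m1V mB i1V iB.
split; first exact: integrable_scale.
rewrite RintegralZl // /Rintegral e1 fineM; last 2 first.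
- exact: (integrable_fin_num measurableT i1V).
- exact: (integrable_fin_num measurableT iB).
congr (_ * (_ * _)); have := @RintegralD _ _ _ P setT (cst 1) (V n).
rewrite Rintegral_probability_cst => <- //; exact: integrable_cst.
Qed.

Let zeta_coord_integrable j : P.-integrable setT (EFin \o ((fun s => zeta s 0 j) \o X)).
Proof.
have mz : measurable_fun setT (fun w => zeta (X w) 0 j).
  by apply: (measurableT_comp (measurable_rVP mzeta j)).
apply: (integrable_le mz (integrable_add (integrable_cst P 1) izeta2)) => w /=.
have := coord_le_norm (zeta (X w)) j; have := norm_le_enorm (zeta (X w)).
by have := sqr_ge0 (enorm (zeta (X w)) - 1); nra.
Qed.

(** In coordinates, [eta w * Delta n w] is a sum of products of a function of the past and a centred
    function of the new sample; each product integrates to 0. *)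
Lemma Delta_orthogonal (eta : Omega -> R) (a : R) :
  measurable_fun setT (eta : F n -> R) -> (forall w, `|eta w| <= a) ->
  P.-integrable setT (EFin \o (fun w => eta w * Delta n w)) /\
  \int[P]_w (eta w * Delta n w) = 0.
Proof.
move=> meta etaa.
pose y j w := eta w * c n * (x n w - z) 0 j.
have my j : measurable_fun setT (y j : F n -> R).
  by apply: measurable_funM; [exact: measurable_funM|exact: (measurable_rVP (@mxz n))].
have iy j : P.-integrable setT (EFin \o y j).
  apply: (integrable_le (measurable_history (@my j)) (integrable_scale (a * `|c n|) i1V)) => w.
  rewrite !normrM -!mulrA ler_pM ?mulr_ge0 // ler_wpM2l //.
  have := coord_le_norm (x n w - z) j; have := norm_le_enorm (x n w - z).
  by rewrite /V; have := sqr_ge0 (enorm (x n w - z) - 1); nra.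
have Hj j := history_integrableM iid (@my j) (measurable_rVP mzeta j) (iy j) (zeta_coord_integrable j).
have eq w : (eta w * Delta n w)%:E = (\sum_(j < d) (y j w * zeta (Xs n w) 0 j)%:E)%E.
  rewrite sumEFin /Delta /dotv !mulr_sumr; congr (_%:E).
  by apply: eq_bigr => j _; rewrite /y; ring.
have isum : P.-integrable setT (fun w => \sum_(j < d) (y j w * zeta (Xs n w) 0 j)%:E)%E.
  by apply: integrable_sum => // j _; exact: (Hj j).1.
split.
  by apply: (eq_integrable _ _ _ _ isum) => // w _; rewrite -eq.
rewrite /Rintegral (eq_integral (fun w => \sum_(j < d) (y j w * zeta (Xs n w) 0 j)%:E)%E); last first.
  by move=> w _; exact: eq.
rewrite integral_sum // ?big1 // => j; last exact: (Hj j).1.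
by move=> _; rewrite (Hj j).2 Ezeta mule0.
Qed.

Lemma Delta_moment : P.-integrable setT (EFin \o (fun w => Delta n w ^+ 2)) /\
  \int[P]_w (Delta n w ^+ 2) <= c n ^+ 2 * ((\int[P]_w V n w) * bz).
Proof.
have mz2 : measurable_fun setT (fun s => enorm (zeta s) ^+ 2).
  by apply: measurable_funX; exact: measurable_enorm.
have [i1 e1] := history_integrableM iid (@mV n) mz2 iV izeta2.
have i2 : P.-integrable setT (EFin \o (fun w => c n ^+ 2 * (V n w * enorm (zeta (Xs n w)) ^+ 2))).
  exact: integrable_scale.
have le2 w : Delta n w ^+ 2 <= c n ^+ 2 * (V n w * enorm (zeta (Xs n w)) ^+ 2).
  rewrite exprMn ler_wpM2l ?sqr_ge0 // /V mulrC -exprMn.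
  rewrite -(real_normK (num_real (dotv _ _))).
  by rewrite lerXn2r ?nnegrE ?mulr_ge0 ?enorm_ge0 // normr_dotv_le.
have i3 : P.-integrable setT (EFin \o (fun w => Delta n w ^+ 2)).
  apply: (integrable_le _ i2) => [|w].
    by apply: measurable_funX; exact: (measurable_history (@mDelta n)).
  by rewrite ger0_norm ?sqr_ge0.
split => //; rewrite (le_trans (le_Rintegral _ i3 i2 _)) // RintegralZl //.
rewrite ler_wpM2l ?sqr_ge0 // /Rintegral e1 fineM //.
- exact: (integrable_fin_num measurableT iV).
- exact: (integrable_fin_num measurableT izeta2).
Qed.

(** Integrability of [V n.+1] is part of the conclusion: [V n.+1] and [Dx n] are nonnegative and
    their sum is dominated by an integrable function. This is what lets an induction on [n] start
    from the constant [V 0]. *)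
Lemma one_step : [/\ P.-integrable setT (EFin \o V n.+1),
  P.-integrable setT (EFin \o Dx n), P.-integrable setT (EFin \o err n),
  \int[P]_w err n w = c n ^+ 2 * ((1 + \int[P]_w V n w) * b) &
  \int[P]_w V n.+1 w + \int[P]_w Dx n w <=
    \int[P]_w V n w + c n ^+ 2 * ((1 + \int[P]_w V n w) * b)].
Proof.
have [ierr Eerr] := err_facts.
have [iDel EDel] : P.-integrable setT (EFin \o Delta n) /\ \int[P]_w Delta n w = 0.
  have := @Delta_orthogonal (cst 1) 1 (measurable_cst _) (fun=> ltac:(by rewrite normr1)).
  rewrite (_ : (fun w => cst 1 w * Delta n w) = Delta n) //.
  by apply/funext => w; rewrite mul1r.
pose rhs w := V n w + (- 1 * Delta n w + err n w).
have i2 : P.-integrable setT (EFin \o (fun w => - 1 * Delta n w + err n w)).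
  by apply: integrable_add => //; exact: integrable_scale.
have irhs : P.-integrable setT (EFin \o rhs) by exact: integrable_add.
have le_rhs w : V n.+1 w + Dx n w <= rhs w.
  by have := path_ineq n w; rewrite /rhs; lra.
have iV1 : P.-integrable setT (EFin \o V n.+1).
  apply: (integrable_le (measurable_history (@mV n.+1)) irhs) => w.
  by rewrite ger0_norm //; have := le_rhs w; have := D0 n (x n w) (Xs n w); rewrite /Dx; lra.
have iD1 : P.-integrable setT (EFin \o Dx n).
  apply: (integrable_le (measurable_history (@mDx n)) irhs) => w.
  by rewrite ger0_norm ?D0 //; have := le_rhs w; have := V0 n.+1 w; lra.
split => //; rewrite -RintegralD // -Eerr.
apply: (@le_trans _ _ (\int[P]_w rhs w)).
  by apply: le_Rintegral => //; exact: integrable_add.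
have inD : P.-integrable setT (EFin \o (fun w => - 1 * Delta n w)) by exact: integrable_scale.
have e2 : \int[P]_w (- 1 * Delta n w + err n w) = \int[P]_w err n w.
  by rewrite (RintegralD measurableT inD ierr) RintegralZl // EDel mulr0 add0r.
by rewrite /rhs (RintegralD measurableT iV i2) e2.
Qed.

End one_step.

Let v n := \int[P]_w V n w.

Let v0 n : 0 <= v n. Proof. by apply: Rintegral_ge0 => w _. Qed.

Let iV n : P.-integrable setT (EFin \o V n).
Proof.
elim: n => [|n IH]; last by have [] := one_step IH.
rewrite (_ : V 0%N = cst (enorm (x0 - z) ^+ 2)); first exact: integrable_cst.
by apply/funext => w; rewrite /V x00.
Qed.

Let M := expR (b * C) * (1 + v 0%N).

(** The error is proportional to [1 + v n], so Gronwall's bound is applied to that quantity rather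
    than to [v n]. *)
Let v_le n : 1 + v n <= M.
Proof.
apply: (@sum_growth_bound _ (fun n => 1 + v n) (fun n => c n ^+ 2 * b)).
- by move=> k; rewrite mulr_ge0 ?sqr_ge0.
- by rewrite addr_ge0.
- move=> k; have [_ _ _ _] := one_step (iV k); rewrite -/(v k) -/(v k.+1).
  have : 0 <= \int[P]_w Dx k w by apply: Rintegral_ge0 => w _; exact: D0.
  lra.
- by move=> k; rewrite -mulr_suml mulrC ler_wpM2l.
Qed.

Let M0 : 0 <= M. Proof. by apply: le_trans (v_le 0%N); rewrite addr_ge0. Qed.

Let weighted_sum_le (u : nat -> R) (a : R) n : 0 <= a -> (forall k, 0 <= u k <= M) ->
  \sum_(0 <= k < n) c k ^+ 2 * (u k * a) <= C * (M * a).
Proof.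
move=> a0 uM; apply: (@le_trans _ _ (\sum_(0 <= k < n) c k ^+ 2 * (M * a))).
  apply: ler_sum => k _; rewrite ler_wpM2l ?sqr_ge0 // ler_wpM2r //.
  by have /andP[] := uM k.
by rewrite -mulr_suml; apply: ler_wpM2r (cC n); exact: mulr_ge0 M0 a0.
Qed.

Let v_bounds k : 0 <= 1 + v k <= M.
Proof. by rewrite v_le andbT addr_ge0. Qed.

Let sum_err n : \sum_(0 <= k < n) \int[P]_w err k w <= C * (M * b).
Proof.
rewrite (eq_bigr (fun k => c k ^+ 2 * ((1 + v k) * b))); last first.
  by move=> k _; have [_ _ _ -> _] := one_step (iV k).
exact: (@weighted_sum_le (fun k => 1 + v k) b n b0 v_bounds).
Qed.

Let sum_Dx n : \sum_(0 <= k < n) \int[P]_w Dx k w <= v 0%N + C * (M * b).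
Proof.
have H : v n + \sum_(0 <= k < n) \int[P]_w Dx k w
    <= v 0%N + \sum_(0 <= k < n) \int[P]_w err k w.
  elim: n => [|n IH]; first by rewrite !big_geq.
  have [_ _ _ Ee] := one_step (iV n); rewrite -Ee !big_nat_recr //= -/(v n) -/(v n.+1).
  by lra.
by have := sum_err n; have := v0 n; lra.
Qed.

Let sum_Delta n : \sum_(0 <= k < n) \int[P]_w (Delta k w ^+ 2) <= C * (M * bz).
Proof.
apply: (@le_trans _ _ (\sum_(0 <= k < n) c k ^+ 2 * (v k * bz))).
  by apply: ler_sum => k _; have [_] := Delta_moment (iV k).
apply: weighted_sum_le => // k; rewrite v0 /=.
by have := v_le k; lra.
Qed.

(** Conditional expectation of [Dx n] given the past: the current point is frozen and the sample is
    integrated out. *)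
Let gap n w : \bar R := (\int[distribution P X]_s (D n (x n w) s)%:E)%E.

Let mgap n : measurable_fun setT (gap n).
Proof.
apply: (@measurable_history _ _ _ _ _ _ Xs _ _ n).
have mh : measurable_fun [set: F n * S] (fun p => (D n (x n p.1) p.2)%:E).
  by apply/measurable_EFinP; exact: (adapted_pair mPhi x00 xS).
have h0 (p : F n * S) : (0 <= (D n (x n p.1) p.2)%:E)%E by rewrite lee_fin.
exact: (measurable_fun_fubini_tonelli_F (m2 := distribution P X) _ mh h0).
Qed.

Let Egap n : (\int[P]_w gap n w = (\int[P]_w Dx n w)%:E)%E.
Proof.
have mh : measurable_fun [set: F n * S] (fun p => (D n (x n p.1) p.2)%:E).
  by apply/measurable_EFinP; exact: (adapted_pair mPhi x00 xS).
rewrite -(@history_ge0_integral _ _ _ _ _ _ _ _ iid n (fun w s => (D n (x n w) s)%:E)) //.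
  have [_ iD _ _ _] := one_step (iV n).
  by rewrite /Rintegral fineK //; exact: (integrable_fin_num measurableT iD).
by move=> w s; rewrite lee_fin.
Qed.

(** The three conclusions have different uses: the distances feed Opial's argument, the pathwise
    series of [D] makes the moves inside a pass vanish, and the integrated series makes the mean gap
    small along a subsequence. *)
Lemma fejer_everywhere : {ae P, forall w, [/\
  cvgn (fun n => enorm (x n w - z) ^+ 2),
  cvgn (series (fun n => D n (x n w) (Xs n w))) &
  (\sum_(n <oo) \int[distribution P X]_s (D n (x n w) s)%:E < +oo)%E]}.
Proof.
have ae_err : {ae P, forall w, cvgn (series (err ^~ w))}.
  apply: (ae_summable _ _ sum_err) => [n w|n]; last by have [] := one_step (iV n).
  by rewrite /err mulr_ge0 ?sqr_ge0 // mulr_ge0 // addr_ge0.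
have ae_D : {ae P, forall w, cvgn (series (Dx ^~ w))}.
  apply: (ae_summable _ _ sum_Dx) => [n w|n]; first exact: D0.
  by have [] := one_step (iV n).
have ae_Delta : {ae P, forall w, cvgn (series (Delta ^~ w))}.
  apply: (martingale_cvg mDelta _ _ sum_Delta) => n; first by have [] := Delta_moment (iV n).
  by move=> eta a meta etaa; have [] := Delta_orthogonal (iV n) meta etaa.
have ae_gap : {ae P, forall w, (\sum_(n <oo) gap n w < +oo)%E}.
  apply: (@ae_nneseries_lty _ _ _ _ _ (v 0%N + C * (M * b))) => [n w|n|n].
  - by apply: integral_ge0 => s _; rewrite lee_fin.
  - exact: mgap.
  - by under eq_bigr do rewrite Egap; rewrite sumEFin lee_fin sum_Dx.
near=> w.
have cerr : cvgn (series (err ^~ w)) by near: w.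
have cD : cvgn (series (Dx ^~ w)) by near: w.
have cDelta : cvgn (series (Delta ^~ w)) by near: w.
split => //; last by near: w.
apply: (@quasi_fejer_cvg _ _ (Dx ^~ w) (fun n => err n w - Delta n w)) => //.
- by move=> n; exact: V0.
- by move=> n; have := path_ineq n w; rewrite /V; lra.
- rewrite (_ : series _ = series (err ^~ w) \- series (Delta ^~ w)); first exact: is_cvgB.
  by apply/funext => n; rewrite /series /= sumrB.
Unshelve. all: by end_near. Qed.

End everywhere.
End stochastic_fejer.

(** * Fejer inequalities valid for almost every sample *)

Section almost_sure_fejer.
Context {dO dS : measure_display} {Omega : measurableType dO}
  {S : measurableType dS} {R : realType} (P : probability Omega R)
  (X : {RV P >-> S}) (Xs : nat -> {RV P >-> S}) (iid : iid_copies X Xs) {d : nat}.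

Variables (G : set S) (mG : measurable G) (PG : P (X @^-1` (~` G)) = 0%E).

Lemma ae_samples : {ae P, forall w, forall n, G (Xs n w)}.
Proof.
apply/ae_foralln => n; exists (Xs n @^-1` (~` G)); split => //.
  by apply: measurable_preimage_RV; exact: measurableC.
exact: etrans (iid_preimage iid n (measurableC mG)) PG.
Qed.

Lemma ae_sample : {ae P, forall w, G (X w)}.
Proof.
exists (X @^-1` (~` G)); split => //.
by rewrite -[X in measurable X]setTI; apply: measurable_funP => //; exact: measurableC.
Qed.

Variables (Phi : nat -> 'rV[R]_d -> S -> 'rV[R]_d) (x0 : 'rV[R]_d)
  (x : nat -> Omega -> 'rV[R]_d) (z : 'rV[R]_d) (c : nat -> R) (C : R)
  (zeta : S -> 'rV[R]_d) (B : S -> R) (D : nat -> 'rV[R]_d -> S -> R).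
Hypotheses (mPhi : forall n, measurable_fun [set: borel_rV R d * S]
    ((fun p => Phi n p.1 p.2) : _ -> borel_rV R d))
  (x00 : forall w, x 0%N w = x0)
  (xS : forall n w, x n.+1 w = Phi n (x n w) (Xs n w))
  (cC : forall n, \sum_(0 <= k < n) c k ^+ 2 <= C)
  (mzeta : measurable_fun setT (zeta : S -> borel_rV R d))
  (izeta2 : P.-integrable setT (EFin \o (fun w => enorm (zeta (X w)) ^+ 2)))
  (Ezeta : forall j, (\int[P]_w (zeta (X w) 0 j)%:E = 0)%E)
  (mB : measurable_fun setT B) (B0 : forall s, 0 <= B s)
  (iB : P.-integrable setT (EFin \o (B \o X)))
  (mD : forall n, measurable_fun [set: borel_rV R d * S] (fun p => D n p.1 p.2))
  (D0 : forall n y s, G s -> 0 <= D n y s)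
  (fejer : forall n y s, G s -> enorm (Phi n y s - z) ^+ 2 <=
     enorm (y - z) ^+ 2 - D n y s - c n * dotv (zeta s) (y - z)
     + c n ^+ 2 * (B s * (1 + enorm (y - z) ^+ 2))).

(* Off [G] the dynamics jumps to [z]: the inequality then holds everywhere,
   and the iterates change only on a negligible event. *)
Let Phi' n y s := if s \in G then Phi n y s else z.
Let zeta' s := if s \in G then zeta s else 0.
Let D' n y s := if s \in G then D n y s else 0.

Let x' := fix x' n w := if n isn't k.+1 then x0 else Phi' k (x' k w) (Xs k w).

Let measurable_in_G {dT : measure_display} {T : measurableType dT} (s : T -> S) :
  measurable_fun setT s -> measurable_fun setT (fun t => s t \in G).
Proof.
move=> ms; apply: (measurable_fun_bool true).
rewrite setTI (_ : _ @^-1` _ = s @^-1` G); last first.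
  by apply/seteqP; split => t /=; [exact: set_mem|exact: mem_set].
by rewrite -[X in measurable X]setTI; exact: ms.
Qed.

Lemma fejer_almost_sure : {ae P, forall w, [/\
  cvgn (fun n => enorm (x n w - z) ^+ 2),
  cvgn (series (fun n => D n (x n w) (Xs n w))) &
  (\sum_(n <oo) \int[distribution P X]_(s in G) (D n (x n w) s)%:E < +oo)%E]}.
Proof.
have mPhi' n : measurable_fun [set: borel_rV R d * S]
    ((fun p => Phi' n p.1 p.2) : _ -> borel_rV R d).
  apply: measurable_fun_ifT => //; exact: measurable_in_G.
have mzeta' : measurable_fun setT (zeta' : S -> borel_rV R d).
  by apply: measurable_fun_ifT => //; exact: measurable_in_G.
have mD' n : measurable_fun [set: borel_rV R d * S] (fun p => D' n p.1 p.2).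
  by apply: measurable_fun_ifT => //; exact: measurable_in_G.
have zeta'X : {ae P, forall w, zeta' (X w) = zeta (X w)}.
  by have := ae_sample; apply: filterS => w wG; rewrite /zeta' mem_set.
have izeta2' : P.-integrable setT (EFin \o (fun w => enorm (zeta' (X w)) ^+ 2)).
  apply: (integrable_le _ izeta2) => [|w].
    by apply: measurable_funX; apply: measurable_enorm; exact: measurableT_comp.
  rewrite ger0_norm ?sqr_ge0 // /zeta'; case: ifP => // _.
  by rewrite enorm0 expr0n sqr_ge0.
have Ezeta' j : (\int[P]_w (zeta' (X w) 0 j)%:E = 0)%E.
  rewrite -(Ezeta j); apply: ae_eq_integral => //.
  - apply/measurable_EFinP.
    by apply: (measurableT_comp (measurable_rVP mzeta' j)).
  - apply/measurable_EFinP.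
    by apply: (measurableT_comp (measurable_rVP mzeta j)).
  - by apply: filterS zeta'X => w -> _.
have fejer' n y s : enorm (Phi' n y s - z) ^+ 2 <=
     enorm (y - z) ^+ 2 - D' n y s - c n * dotv (zeta' s) (y - z)
     + c n ^+ 2 * (B s * (1 + enorm (y - z) ^+ 2)).
  rewrite /Phi' /D' /zeta'; case: ifPn => [/set_mem|_]; first exact: fejer.
  (* Off [G] the new point is [z], so the left side is 0 and the terms in [D'] and [zeta'] vanish on
     the right. *)
  rewrite subrr enorm0 expr0n dotv0l mulr0 !subr0 /= addr_ge0 ?sqr_ge0 //.
  by rewrite mulr_ge0 ?sqr_ge0 // mulr_ge0 // addr_ge0 // sqr_ge0.
have D'0 n y s : 0 <= D' n y s.
  by rewrite /D'; case: ifPn => [/set_mem|//]; exact: D0.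
have := fejer_everywhere iid mPhi' (x := x') (fun=> erefl) (fun n w => erefl) cC
  mzeta' izeta2' Ezeta' mB B0 iB mD' D'0 fejer'.
have := ae_samples; apply: filterS2 => w wG.
have xx' n : x' n w = x n w.
  by elim: n => [|n IH] /=; rewrite ?x00 // xS IH /Phi' mem_set.
have -> : (fun n => enorm (x' n w - z) ^+ 2) = (fun n => enorm (x n w - z) ^+ 2).
  by apply/funext => n; rewrite xx'.
have -> : (fun n => D' n (x' n w) (Xs n w)) = (fun n => D n (x n w) (Xs n w)).
  by apply/funext => n; rewrite xx' /D' mem_set.
move=> [? ? h]; split => //; move: h; congr (_ < _)%E.
apply: eq_eseriesr => n _; rewrite xx' [RHS]integral_mkcond.
by apply: eq_integral => s _; rewrite /D' /patch; case: ifP.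
Qed.

End almost_sure_fejer.

(** * The algorithm along samples *)

Section moments.
Context {dO : measure_display} {Omega : measurableType dO} {R : realType}
  (P : probability Omega R).
Implicit Types u v : Omega -> R.

Definition moment (a : R) u := P.-integrable setT (EFin \o (fun w => u w `^ a)).

Lemma expectation_moment (a : R) u : measurable_fun setT u ->
  ('E_P[fun w => (u w `^ a)%R] < +oo)%E -> moment a u.
Proof.
move=> mu; rewrite unlock => ua; apply/integrableP; split.
  by apply/measurable_EFinP; exact: (measurableT_comp (measurable_powR a) mu).
apply: le_lt_trans ua; rewrite le_eqVlt; apply/orP; left; apply/eqP.
by apply: eq_integral => w _ /=; rewrite ger0_norm ?powR_ge0.
Qed.

Lemma powRD_le (a r s : R) : 0 <= a -> 0 <= r -> 0 <= s ->
  (r + s) `^ a <= 2 `^ a * (r `^ a + s `^ a).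
Proof.
move=> a0 r0 s0; wlog rs : r s r0 s0 / r <= s.
  move=> H; have [rs|/ltW sr] := leP r s; first exact: H.
  by rewrite addrC [r `^ a + _]addrC; exact: H.
apply: (@le_trans _ _ ((2 * s) `^ a)).
  by apply: ge0_ler_powR; rewrite ?nnegrE ?addr_ge0 ?mulr_ge0 //; lra.
by rewrite powRM // ler_wpM2l ?powR_ge0 // lerDr powR_ge0.
Qed.

Lemma moment_cst (a c : R) : moment a (cst c).
Proof. exact: (integrable_cst P (c `^ a)). Qed.

Lemma momentD (a : R) u v : 0 <= a -> (forall w, 0 <= u w) -> (forall w, 0 <= v w) ->
  measurable_fun setT u -> measurable_fun setT v ->
  moment a u -> moment a v -> moment a (fun w => u w + v w).
Proof.
move=> a0 u0 v0 mu mv au av.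
apply: (integrable_le _ (integrable_scale (2 `^ a) (integrable_add au av))) => [|w].
  apply: (measurableT_comp (measurable_powR a)); exact: measurable_funD.
by rewrite ger0_norm ?powR_ge0 // powRD_le.
Qed.

Lemma moment1D (a : R) v : 0 <= a -> (forall w, 0 <= v w) ->
  measurable_fun setT v -> moment a v -> moment a (fun w => 1 + v w).
Proof. by move=> a0 v0 mv; apply: momentD => //; exact: (moment_cst a 1). Qed.

Lemma moment_sum (a : R) (I : Type) (r : seq I) (u : I -> Omega -> R) : 0 <= a ->
  (forall i w, 0 <= u i w) -> (forall i, measurable_fun setT (u i)) ->
  (forall i, moment a (u i)) -> moment a (fun w => \sum_(i <- r) u i w).
Proof.
move=> a0 u0 mu au; elim: r => [|i r IH].
  rewrite (_ : (fun w => _) = cst 0); first exact: moment_cst.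
  by apply/funext => w; rewrite big_nil.
rewrite (_ : (fun w => _) = (fun w => u i w + \sum_(j <- r) u j w)).
  by apply: momentD => // [w|]; [exact: sumr_ge0|exact: measurable_sum].
by apply/funext => w; rewrite big_cons.
Qed.

(** Young's inequality without its constants: if [r <= s]^ t[the product is at most the second term,
    otherwise]s <= r [^ t^-1] and it is at most the first. *)
Lemma young_le (t r s : R) : 0 < t -> 0 <= r -> 0 <= s ->
  r * s <= r `^ (1 + t^-1) + s `^ (1 + t).
Proof.
move=> t0 r0 s0; have [rs|sr] := leP r (s `^ t).
  rewrite (le_trans (ler_wpM2r s0 rs)) // (le_trans _ (_ : s `^ (1 + t) <= _)) ?lerDr ?powR_ge0 //.
  by rewrite powRD ?powRr1 1?mulrC //; apply/implyP; rewrite gt_eqF // addr_gt0.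
have : s <= r `^ t^-1.
  rewrite -[leLHS](powRr1 s0) -(divff (lt0r_neq0 t0)) powRrM.
  by apply: ge0_ler_powR; rewrite ?nnegrE ?powR_ge0 ?invr_ge0 ?(ltW t0) // ltW.
move=> /(ler_wpM2l r0)/le_trans; apply.
rewrite (le_trans _ (_ : r `^ (1 + t^-1) <= _)) ?lerDl ?powR_ge0 //.
by rewrite powRD ?powRr1 //; apply/implyP; rewrite gt_eqF // addr_gt0 ?invr_gt0.
Qed.

(** With [t = e / 2] in [young_le], the factor [v w ^+ 2] is raised to the power [1 + e / 2], giving
    exactly the available moment [2 + e]. *)
Lemma integrable_powM (e : R) (m : nat) u v : 0 < e -> (0 < m)%N ->
  (forall w, 0 <= u w) -> (forall w, 0 <= v w) ->
  measurable_fun setT u -> measurable_fun setT v ->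
  (forall a, 0 < a -> moment a u) -> moment (2 + e) v ->
  P.-integrable setT (EFin \o (fun w => u w ^+ m * v w ^+ 2)).
Proof.
move=> e0 m0 u0 v0 mu mv au av.
have t0 : 0 < e / 2 by rewrite divr_gt0.
(* The exponent left for [u]. It blows up as [e] tends to 0, which is why moments of every order are
   asked of [u]. *)
pose a := m%:R * (1 + (e / 2)^-1).
have a0 : 0 < a by rewrite mulr_gt0 ?ltr0n // addr_gt0 ?invr_gt0.
apply: (integrable_le _ (integrable_add (au a a0) av)) => [|w].
  by apply: measurable_funM; exact: measurable_funX.
rewrite ger0_norm ?mulr_ge0 ?exprn_ge0 //.
rewrite (le_trans (young_le t0 _ _)) ?exprn_ge0 //.
rewrite -!powR_mulrn // -!powRrM lerD2l.
by rewrite (_ : 2%:R * (1 + e / 2) = 2 + e) //; field.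
Qed.

End moments.

Section forward_backward_pass.
Context {dX : measure_display} {Xi : measurableType dX} {R : realType} {d L : nat}.
Variables (f g : 'I_L -> 'rV[R]_d -> Xi -> R).

(* The [i]-th intermediate point of a pass with step [c] started at [y]; it is
   constant in [i] beyond [L]. *)
Fixpoint fb_pass (c : R) (y : 'rV[R]_d) (s : L.-tuple Xi) (i : nat) : 'rV[R]_d :=
  if i isn't k.+1 then y else
  oapp (fun j => forward_backward f g c j (fb_pass c y s k) (tnth s j))
    (fb_pass c y s k) (insub k).

Lemma fb_passS c y s (i : 'I_L) : fb_pass c y s i.+1 =
  prox (fun x => c * g i x (tnth s i))
    (fb_pass c y s i - c *: grad (f i ^~ (tnth s i)) (fb_pass c y s i)).
Proof. by rewrite /= valK. Qed.

Hypotheses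
  (mf : forall i, measurable_fun [set: borel_rV R d * Xi] (fun p => f i p.1 p.2))
  (mg : forall i, measurable_fun [set: borel_rV R d * Xi] (fun p => g i p.1 p.2))
  (cf : forall i s, convex_fun (f i ^~ s)) (cg : forall i s, convex_fun (g i ^~ s))
  (df : forall i s x, differentiable (f i ^~ s) x).

Lemma measurable_fb_pass (c : R) i : 0 <= c ->
  measurable_fun [set: borel_rV R d * L.-tuple Xi]
    ((fun p => fb_pass c p.1 p.2 i) : _ -> borel_rV R d).
Proof.
move=> c0; elim: i => [|k IH] /=; first exact: measurable_fst.
case: insubP => [j _ _|_] //=.
have mt : measurable_fun [set: borel_rV R d * L.-tuple Xi] (fun p => tnth p.2 j).
  by apply: (measurableT_comp (measurable_tnth j)).
apply: measurable_prox => //.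
by apply: measurable_rVB => //; apply: measurable_rVZ; exact: measurable_grad.
Qed.

Section certificates.
Variables (z : 'rV[R]_d) (phi : 'I_L -> Xi -> 'rV[R]_d) (K : 'I_L -> Xi -> R).
Hypotheses (mphi : forall i, measurable_fun setT (phi i : Xi -> borel_rV R d))
  (mK : forall i, measurable_fun setT (K i)) (K0 : forall i s, 0 <= K i s).

(* The subgradient and descent inequalities at [z], tested on rational points
   only, so that this set of samples is measurable. *)
Definition good : set (L.-tuple Xi) :=
  [set s | forall p : 'I_L * 'rV[rat]_d, let: (i, y) := (p.1, ratv p.2) in
    g i z (tnth s i) + dotv (phi i (tnth s i)) (y - z) <= g i y (tnth s i) /\
    f i y (tnth s i) <= f i z (tnth s i)
      + dotv (grad (f i ^~ (tnth s i)) z) (y - z)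
      + K i (tnth s i) * enorm (y - z) ^+ 2].

Lemma good_subdiff s i : good s ->
  subdiff (g i ^~ (tnth s i)) z (phi i (tnth s i)).
Proof.
move=> gs y; rewrite -subr_ge0.
apply: (@continuous_ratv_le _ _ (fun y => g i y (tnth s i) - (g i z (tnth s i) +
  dotv (phi i (tnth s i)) (y - z))) 0) => [x|q]; last first.
  by rewrite subr_ge0; have [] := gs (i, q).
have cz : y - z @[y --> x] --> x - z.
  by apply: (@cvgB _ _ _ (nbhs x)); [exact: cvg_id|exact: cvg_cst].
apply: (@cvgB _ _ _ (nbhs x)); first exact: (@convex_continuous _ _ _ (@cg i (tnth s i)) x).
apply: (@cvgD _ _ _ (nbhs x)); first exact: cvg_cst.
by apply: (cvg_dotv (nbhs_filter x) _ cz); exact: cvg_cst.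
Qed.

Lemma good_descent s i y : good s -> f i y (tnth s i) <=
  f i z (tnth s i) + dotv (grad (f i ^~ (tnth s i)) z) (y - z)
  + K i (tnth s i) * enorm (y - z) ^+ 2.
Proof.
move=> gs; rewrite -subr_ge0.
apply: (@continuous_ratv_le _ _ (fun y => f i z (tnth s i) + dotv (grad (f i ^~ (tnth s i)) z) (y - z)
  + K i (tnth s i) * enorm (y - z) ^+ 2 - f i y (tnth s i)) 0) => [x|q]; last first.
  by rewrite subr_ge0; have [] := gs (i, q).
have cz : y - z @[y --> x] --> x - z.
  by apply: (@cvgB _ _ _ (nbhs x)); [exact: cvg_id|exact: cvg_cst].
apply: (@cvgB _ _ _ (nbhs x)); last exact: (@convex_continuous _ _ _ (@cf i (tnth s i)) x).
apply: (@cvgD _ _ _ (nbhs x)).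
  apply: (@cvgD _ _ _ (nbhs x)); first exact: cvg_cst.
  by apply: (cvg_dotv (nbhs_filter x) _ cz); exact: cvg_cst.
apply: (@cvgMl_tmp _ _ (nbhs x)).
by apply: (@cvgM _ _ (nbhs x)); exact: (cvg_enorm (nbhs_filter x) cz).
Qed.

Lemma measurable_tnth_comp {dY : measure_display} {Y : measurableType dY} i (h : Xi -> Y) :
  measurable_fun setT h -> measurable_fun setT (fun s : L.-tuple Xi => h (tnth s i)).
Proof. by move=> mh; exact: (measurableT_comp mh (measurable_tnth i)). Qed.

Lemma measurable_gradz i :
  measurable_fun setT ((fun s => grad (f i ^~ s) z) : Xi -> borel_rV R d).
Proof. by apply: measurable_grad. Qed.

Lemma measurable_f_at i y : measurable_fun setT (f i y).
Proof. by apply: (measurable_integrand (mf i) (u := fun=> y)). Qed.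

Lemma measurable_g_at i y : measurable_fun setT (g i y).
Proof. by apply: (measurable_integrand (mg i) (u := fun=> y)). Qed.

Lemma measurable_good : measurable good.
Proof.
pose A (p : 'I_L * 'rV[rat]_d) := [set s : L.-tuple Xi | let: (i, y) := (p.1, ratv p.2) in
    g i z (tnth s i) + dotv (phi i (tnth s i)) (y - z) <= g i y (tnth s i) /\
    f i y (tnth s i) <= f i z (tnth s i)
      + dotv (grad (f i ^~ (tnth s i)) z) (y - z)
      + K i (tnth s i) * enorm (y - z) ^+ 2].
have mA p : measurable (A p).
  case: p => i q.
  have mgi y := measurable_tnth_comp i (@measurable_g_at i y).
  have mfi y := measurable_tnth_comp i (@measurable_f_at i y).
  apply: measurableI; apply: measurable_set_le => //.
  - apply: measurable_funD; first exact: mgi.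
    by apply: measurable_dotv => //; exact: (measurable_tnth_comp i (@mphi i)).
  - apply: measurable_funD; last first.
      by apply: measurable_funM => //; exact: (measurable_tnth_comp i (@mK i)).
    apply: measurable_funD; first exact: mfi.
    apply: measurable_dotv => //.
    exact: (measurable_tnth_comp i (@measurable_gradz i)).
rewrite (_ : good = ~` \bigcup_p ~` A p).
  apply: measurableC; apply: countable_bigcupT_measurable => [|p]; first exact: countableP.
  exact: measurableC.
by rewrite setC_bigcup; apply/seteqP; split => s gs p => [_|]; [rewrite setCK; exact: gs|have := gs p I; rewrite setCK].
Qed.

(** The two almost sure properties place the sample in [good], the second through
    [lipschitz_grad_descent]. As [good] is measurable, its negligible complement has probability
    0. *)
Lemma prob_good {dO : measure_display} {Omega : measurableType dO}
    (P : probability Omega R) (X : {RV P >-> L.-tuple Xi}) :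
  (forall i, {ae P, forall w, subdiff (g i ^~ (tnth (X w) i)) z (phi i (tnth (X w) i))}) ->
  (forall i, {ae P, forall w, forall x y,
    enorm (grad (f i ^~ (tnth (X w) i)) x - grad (f i ^~ (tnth (X w) i)) y)
      <= K i (tnth (X w) i) * enorm (x - y)}) ->
  P (X @^-1` (~` good)) = 0%E.
Proof.
move=> aeg aef.
have mX : measurable (X @^-1` (~` good)).
  rewrite -[X in measurable X]setTI; apply: measurable_funP => //.
  by apply: measurableC; exact: measurable_good.
apply/(negligibleP _ mX).
have : {ae P, forall w, good (X w)}.
  have aegf : {ae P, forall w, forall i : 'I_L,
      subdiff (g i ^~ (tnth (X w) i)) z (phi i (tnth (X w) i)) /\
      forall x y, enorm (grad (f i ^~ (tnth (X w) i)) x - grad (f i ^~ (tnth (X w) i)) y)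
        <= K i (tnth (X w) i) * enorm (x - y)}.
    by apply: filter_forall => i; apply: filterS2 (aeg i) (aef i) => w; split.
  apply: filterS aegf => w gw [i q] /=; have [h1 h2] := gw i.
  split; first exact: h1.
  exact: (lipschitz_grad_descent (@cf i _) (@df i _ _) (h2 _ _)).
by [].
Qed.

End certificates.
End forward_backward_pass.

Section pass_statistics.
Context {dO dX : measure_display} {Omega : measurableType dO}
  {Xi : measurableType dX} {R : realType} {d L : nat}
  (P : probability Omega R) (f g : 'I_L -> 'rV[R]_d -> Xi -> R)
  (X : {RV P >-> L.-tuple Xi}).
Hypotheses (L0 : (0 < L)%N)
  (mf : forall i, measurable_fun [set: borel_rV R d * Xi] (fun p => f i p.1 p.2))
  (mg : forall i, measurable_fun [set: borel_rV R d * Xi] (fun p => g i p.1 p.2))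
  (cf : forall i s, convex_fun (f i ^~ s)) (cg : forall i s, convex_fun (g i ^~ s))
  (df : forall i s x, differentiable (f i ^~ s) x).

Variables (z : 'rV[R]_d) (phi : 'I_L -> Xi -> 'rV[R]_d) (K : 'I_L -> Xi -> R).
Hypotheses (mphi : forall i, measurable_fun setT (phi i : Xi -> borel_rV R d))
  (mK : forall i, measurable_fun setT (K i)) (K0 : forall i s, 0 <= K i s).

Let fs (s : L.-tuple Xi) i y := f i y (tnth s i).
Let gs (s : L.-tuple Xi) i y := g i y (tnth s i).
Let phis (s : L.-tuple Xi) i := phi i (tnth s i).

Definition sample_gap c y s := pass_gap (fs s) (gs s) z (phis s) (fb_pass f g c y s).
Definition sample_move c y s := @pass_move R d L (fb_pass f g c y s).
Definition sample_noise s := pass_noise (fs s) z (phis s).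
Definition sample_bound s := pass_bound (fs s) z (phis s) (fun i => K i (tnth s i)).

Local Notation good := (good f g z phi K).

Lemma sample_gap_ge0 c y s : good s -> 0 <= sample_gap c y s.
Proof.
move=> Gs; apply: pass_gap_ge0 => [i|i x|i]; [exact: cf|exact: df|].
exact: (good_subdiff (fun i s => @cg i s) i Gs).
Qed.

(** A restatement of [pass_inequality] in the shape of a Fejer inequality: gap and moves form one
    nonnegative decrease, and the factor 2 goes into the noise. *)
Lemma sample_inequality c c1 y s : 0 < c -> c <= c1 -> 1 <= c1 -> good s ->
  enorm (fb_pass f g c y s L - z) ^+ 2 <= enorm (y - z) ^+ 2
  - (2 * c * sample_gap c y s + 4^-1 * sample_move c y s)
  - c * dotv (2 *: sample_noise s) (y - z)
  + c ^+ 2 * (@pass_const R L c1 * sample_bound s ^+ 2 * (1 + enorm (y - z) ^+ 2)).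
Proof.
move=> c0 cc1 c11 Gs.
have := @pass_inequality R d L (fs s) (gs s) z (phis s) (fun i => K i (tnth s i)) L0
  (fun i => @cf i _) (fun i => @cg i _) (fun i x => @df i _ x)
  (fun i => good_subdiff (fun i s => @cg i s) i Gs) (fun i => K0 i _)
  (fun i y => good_descent (fun i s => @cf i s) i y Gs) c c1 (fb_pass f g c y s)
  c0 cc1 c11 (fun i => fb_passS f g c y s i).
by rewrite dotvZl /sample_gap /sample_move /sample_noise /sample_bound /=; lra.
Qed.

Let mgradz i : measurable_fun setT ((fun s : L.-tuple Xi => grad (fs s i) z) : _ -> borel_rV R d).
Proof. exact: (measurable_tnth_comp i (measurable_gradz mf df z i)). Qed.

Let mphis i : measurable_fun setT ((fun s : L.-tuple Xi => phis s i) : _ -> borel_rV R d).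
Proof. exact: (measurable_tnth_comp i (@mphi i)). Qed.

Lemma measurable_sample_noise :
  measurable_fun setT (sample_noise : L.-tuple Xi -> borel_rV R d).
Proof.
apply: measurable_rV => j.
rewrite (_ : (fun s => _) = (fun s => \sum_(i < L) (phis s i 0 j + grad (fs s i) z 0 j))).
  apply: measurable_sum => i; apply: measurable_funD.
    exact: (measurable_rVP (@mphis i)).
  exact: (measurable_rVP (@mgradz i)).
by apply/funext => s; rewrite /sample_noise /pass_noise summxE; apply: eq_bigr => i _; rewrite mxE.
Qed.

Let size s := pass_size (fs s) z (phis s).

Let msize : measurable_fun setT size.
Proof.
by apply: measurable_sum => i; apply: measurable_funD; exact: measurable_enorm.
Qed.

Let mKs : measurable_fun setT (fun s : L.-tuple Xi => \sum_i K i (tnth s i)).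
Proof. by apply: measurable_sum => i; exact: (measurable_tnth_comp i (@mK i)). Qed.

Lemma measurable_sample_bound : measurable_fun setT sample_bound.
Proof.
apply: measurable_funM; last by apply: measurable_funD.
by apply: measurable_funX; apply: measurable_funD.
Qed.

Lemma sample_bound_ge0 s : 0 <= sample_bound s.
Proof.
have h1 : 0 <= \sum_i K i (tnth s i) by apply: sumr_ge0.
have h2 : 0 <= pass_size (fs s) z (phis s) by exact: pass_size_ge0.
by rewrite mulr_ge0 ?exprn_ge0 // addr_ge0.
Qed.

Let measurable_step c i : 0 <= c ->
  measurable_fun [set: borel_rV R d * L.-tuple Xi]
    ((fun p => fb_pass f g c p.1 p.2 i) : _ -> borel_rV R d).
Proof. by move=> c0; apply: measurable_fb_pass. Qed.

Lemma measurable_sample_move c : 0 <= c ->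
  measurable_fun [set: borel_rV R d * L.-tuple Xi] (fun p => sample_move c p.1 p.2).
Proof.
move=> c0; apply: measurable_sum => i; apply: measurable_funX.
by apply: measurable_enorm; apply: measurable_rVB; exact: measurable_step.
Qed.

Lemma measurable_sample_gap c : 0 <= c ->
  measurable_fun [set: borel_rV R d * L.-tuple Xi] (fun p => sample_gap c p.1 p.2).
Proof.
move=> c0; apply: measurable_sum => i.
have mt : measurable_fun [set: borel_rV R d * L.-tuple Xi] (fun p => tnth p.2 i).
  by apply: (measurableT_comp (measurable_tnth i)).
have mz : measurable_fun [set: borel_rV R d * L.-tuple Xi] ((fun=> z) : _ -> borel_rV R d).
  exact: measurable_cst.
apply: measurable_funD; apply: measurable_funB.
- by apply: measurable_funB; apply: measurable_integrand => //; exact: measurable_step.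
- apply: measurable_dotv; first exact: (measurableT_comp (@mphi i) mt).
  by apply: measurable_rVB => //; exact: measurable_step.
- by apply: measurable_funB; apply: measurable_integrand => //; exact: measurable_step.
- apply: measurable_dotv; first by apply: measurable_grad.
  by apply: measurable_rVB => //; exact: measurable_step.
Qed.

Section integrability.
Variable e : R.
Hypotheses (e0 : 0 < e)
  (rep : integrable_representation f g X (2 + e) z phi)
  (Kmom : forall i a, 0 < a -> ('E_P[fun w => (K i (tnth (X w) i) `^ a)%R] < +oo)%E).

Let mX (h : L.-tuple Xi -> R) : measurable_fun setT h -> measurable_fun setT (fun w => h (X w)).
Proof. by move=> mh; exact: (measurableT_comp mh). Qed.

(** The square splits into a power of [1 + \sum_i K i], which has all moments, and the square of
    [1 + size], which has a moment of order [2 + e]; [integrable_powM] combines them. *)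
Lemma integrable_sample_bound :
  P.-integrable setT (EFin \o (fun w => sample_bound (X w) ^+ 2)).
Proof.
have e20 : 0 <= 2 + e by rewrite addr_ge0 // ltW.
have me (h : L.-tuple Xi -> 'rV[R]_d) : measurable_fun setT (h : _ -> borel_rV R d) ->
    measurable_fun setT (fun w => enorm (h (X w))).
  by move=> mh; apply: (mX (h := fun s => enorm (h s))); exact: measurable_enorm.
have mom_size : moment P (2 + e) (fun w => 1 + size (X w)).
  have size0 w : 0 <= size (X w) by exact: pass_size_ge0.
  apply: (moment1D e20 size0 (mX msize)).
  apply: moment_sum => // i.
  - by move=> w; rewrite addr_ge0 ?enorm_ge0.
  - exact: (measurable_funD (me _ (@mphis i)) (me _ (@mgradz i))).
  have [hg hphi] := rep.2 i.
  have m1 := expectation_moment (me _ (@mphis i)) hphi.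
  have m2 := expectation_moment (me _ (@mgradz i)) hg.
  exact: (momentD e20 (fun w => enorm_ge0 _) (fun w => enorm_ge0 _) (me _ (@mphis i)) (me _ (@mgradz i)) m1 m2).
have mom_K a : 0 < a -> moment P a (fun w => 1 + \sum_i K i (tnth (X w) i)).
  have mKX i : measurable_fun setT (fun w => K i (tnth (X w) i)).
    exact: (mX (measurable_tnth_comp i (@mK i))).
  move=> a0; have sK0 w : 0 <= \sum_i K i (tnth (X w) i) by exact: sumr_ge0.
  apply: (moment1D (ltW a0) sK0 (mX mKs)).
  apply: moment_sum => // [|i]; first exact: ltW.
  by apply: expectation_moment => //; exact: Kmom.
have <- : (fun w => (1 + \sum_i K i (tnth (X w) i)) ^+ (L.+1 * 2) * (1 + size (X w)) ^+ 2)
    = (fun w => sample_bound (X w) ^+ 2).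
  by apply/funext => w; rewrite /sample_bound /pass_bound exprMn -exprM.
apply: (integrable_powM e0 _ _ _ _ _ mom_K mom_size) => // [w|w||].
- by rewrite addr_ge0 ?sumr_ge0.
- by rewrite addr_ge0 // pass_size_ge0.
- by apply: measurable_funD => //; exact: (mX mKs).
- by apply: measurable_funD => //; exact: (mX msize).
Qed.

Lemma noise_le_bound s : enorm (sample_noise s) <= sample_bound s.
Proof.
apply: (@le_trans _ _ (size s)).
  rewrite (le_trans (enorm_sum _ _)) //; apply: ler_sum => i _.
  exact: enorm_triangle.
have s0 : 0 <= size s by exact: pass_size_ge0.
rewrite (@le_trans _ _ (1 + size s)) ?lerDr // /sample_bound /pass_bound.
by rewrite ler_peMl ?addr_ge0 // exprn_ege1 // lerDl sumr_ge0.
Qed.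

Lemma integrable_sample_noise :
  P.-integrable setT (EFin \o (fun w => enorm (2 *: sample_noise (X w)) ^+ 2)).
Proof.
apply: (integrable_le _ (integrable_scale 4 integrable_sample_bound)) => [|w].
  apply: measurable_funX; apply: (mX (h := fun s => enorm (2 *: sample_noise s))).
  by apply: measurable_enorm; apply: measurable_rVZ; exact: measurable_sample_noise.
rewrite ger0_norm ?sqr_ge0 // enormZ ger0_norm // exprMn -natrX ler_pM2l //.
by rewrite lerXn2r ?nnegrE ?enorm_ge0 ?sample_bound_ge0 // noise_le_bound.
Qed.

(** The subgradients are integrable by definition of a representation, the gradients by their moment
    of order [2 + e]; the zero mean is the last clause of a representation, read coordinatewise. *)
Lemma integrable_noise_coord j :
  P.-integrable setT (EFin \o (fun w => sample_noise (X w) 0 j)) /\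
  \int[P]_w (sample_noise (X w) 0 j) = 0.
Proof.
have [[_ iphi _ zero] _] := rep.
have igrad i : P.-integrable setT (EFin \o (fun w => grad (f i ^~ (tnth (X w) i)) z 0 j)).
  have [hg _] := rep.2 i.
  have mg' : measurable_fun setT (fun w => enorm (grad (f i ^~ (tnth (X w) i)) z)).
    apply: (mX (h := fun s => enorm (grad (fs s i) z))).
    by apply: measurable_enorm; exact: mgradz.
  have := expectation_moment mg' hg; rewrite /moment => i2.
  apply: (integrable_le _ (integrable_add (integrable_cst P 1) i2)) => [|w].
    exact: (mX (measurable_rVP (@mgradz i) j)).
  have := coord_le_norm (grad (f i ^~ (tnth (X w) i)) z) j.
  have := norm_le_enorm (grad (f i ^~ (tnth (X w) i)) z).
  move: (enorm_ge0 (grad (f i ^~ (tnth (X w) i)) z)).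
  move: (enorm _) => r r0 h1 h2; have [r1|r1] := leP r 1.
    by have := powR_ge0 r (2 + e); rewrite /=; lra.
  have : r <= r `^ (2 + e).
    by rewrite -[leLHS]powRr1 // ler_powR ?(ltW r1) //; have := e0; lra.
  by rewrite /=; lra.
have iphi' i : P.-integrable setT (EFin \o (fun w => phi i (tnth (X w) i) 0 j)).
  exact: iphi.
have noiseE w : sample_noise (X w) 0 j =
    \sum_(i < L) (phi i (tnth (X w) i) 0 j + grad (f i ^~ (tnth (X w) i)) z 0 j).
  by rewrite /sample_noise /pass_noise summxE; apply: eq_bigr => i _; rewrite mxE.
have ii i := integrable_add (iphi' i) (igrad i).
have eqE w : (sample_noise (X w) 0 j)%:E =
  (\sum_(i < L) (phi i (tnth (X w) i) 0 j + grad (f i ^~ (tnth (X w) i)) z 0 j)%:E)%E.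
  by rewrite noiseE sumEFin.
split.
  have isum : P.-integrable setT (fun w => (\sum_(i < L) (phi i (tnth (X w) i) 0 j + grad (f i ^~ (tnth (X w) i)) z 0 j)%:E)%E).
    by apply: integrable_sum => // i _; exact: (ii i).
  by apply: (eq_integrable _ _ _ _ isum) => // w _; rewrite /= -eqE.
rewrite /Rintegral (eq_integral (fun w => (\sum_(i < L) (phi i (tnth (X w) i) 0 j + grad (f i ^~ (tnth (X w) i)) z 0 j)%:E)%E)); last first.
  by move=> w _; exact: eqE.
rewrite integral_sum //.
have Ei i : (\int[P]_w ((phi i (tnth (X w) i) 0 j + grad (f i ^~ (tnth (X w) i)) z 0 j)%:E) =
   (\int[P]_w (phi i (tnth (X w) i) 0 j) + \int[P]_w (grad (f i ^~ (tnth (X w) i)) z 0 j))%R%:E)%E.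
  rewrite -RintegralD // /Rintegral fineK //; exact: (integrable_fin_num measurableT (ii i)).
under eq_bigr do rewrite Ei.
rewrite sumEFin /=.
move/rowP : zero => /(_ j); rewrite mxE summxE => zj; rewrite [RHS]zj.
by apply: eq_bigr => i _; rewrite !mxE addrC.
Qed.

End integrability.
End pass_statistics.

(** * Limit points are minimizers *)

Section prox_limit.
Context {R : realType} {d : nat}.

(** Apply [prox_displacement] with the limit [x] as test point: both [enorm (x - w k)] and the term
    carrying the factor [c k] vanish. *)
Lemma cvg_prox_small_step (h : 'rV[R]_d -> R) (a phi x : 'rV[R]_d)
    (c : nat -> R) (w : nat -> 'rV[R]_d) :
  convex_fun h -> subdiff h a phi -> (forall k, 0 < c k) ->
  c @ \oo --> (0 : R) -> w @ \oo --> x ->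
  prox (fun y => c k * h y) (w k) @[k --> \oo] --> x.
Proof.
move=> hh aphi c0 cc wx; apply/cvg_enormP.
pose b k := enorm (x - w k) ^+ 2 + 2 * c k *
  (h x - h a + enorm phi * (enorm (w k - a) + c k * enorm phi)).
have xw : enorm (x - w k) @[k --> \oo] --> (0 : R).
  have := (cvg_enormP eventually_filter w x).1 wx.
  by under eq_fun do rewrite enormB.
have b0 : b k @[k --> \oo] --> (0 : R).
  have -> : 0 = 0 * 0 + 2 * 0 * (h x - h a + enorm phi * (enorm (x - a) + 0 * enorm phi)) :> R by ring.
  apply: cvgD; first by apply: cvgM.
  apply: cvgM; first by apply: cvgMl_tmp.
  apply: cvgD; first exact: cvg_cst.
  apply: cvgMl_tmp; apply: cvgD; last by apply: cvgMr_tmp.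
  by apply: cvg_enorm; apply: cvgB => //; exact: cvg_cst.
have s0 : Num.sqrt (b k) + enorm (x - w k) @[k --> \oo] --> (0 : R).
  rewrite -[0]addr0; apply: cvgD => //.
  by rewrite -sqrtr0; apply: (continuous_cvg _ (@sqrt_continuous R 0)).
apply: (squeeze_cvgr _ (cvg_cst (0 : R)) s0); apply: nearW => k.
rewrite enorm_ge0 /= -(subrKA (w k)) (le_trans (enorm_triangle _ _)) // [enorm (w k - x)]enormB lerD2r.
rewrite -(ger0_norm (enorm_ge0 _)) -sqrtr_sqr ler_wsqrtr //.
exact: prox_displacement.
Qed.

(** Boundedness of the gradients along [y] suffices: the descent inequality bounds them by an affine
    function of the distance to [a], and [c k] tends to 0. *)
Lemma cvg_forward_step (f : 'rV[R]_d -> R) (a x : 'rV[R]_d) (K : R)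
    (c : nat -> R) (y : nat -> 'rV[R]_d) :
  0 <= K -> convex_fun f -> (forall y, differentiable f y) ->
  (forall y, f y <= f a + dotv (grad f a) (y - a) + K * enorm (y - a) ^+ 2) ->
  (forall k, 0 < c k) -> c @ \oo --> (0 : R) -> y @ \oo --> x ->
  y k - c k *: grad f (y k) @[k --> \oo] --> x.
Proof.
move=> K0 ff df fK c0 cc yx; apply/cvg_enormP.
have yx0 := (cvg_enormP eventually_filter y x).1 yx.
have b0 : enorm (y k - x) + c k * (enorm (grad f a) + 4 * K * enorm (y k - a))
    @[k --> \oo] --> (0 : R).
  have -> : 0 = 0 + 0 * (enorm (grad f a) + 4 * K * enorm (x - a)) :> R by ring.
  apply: cvgD => //; apply: cvgM => //; apply: cvgD; first exact: cvg_cst.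
  by apply: cvgMl_tmp; apply: cvg_enorm; apply: cvgB => //; exact: cvg_cst.
apply: (squeeze_cvgr _ (cvg_cst (0 : R)) b0); apply: nearW => k.
rewrite enorm_ge0 /= addrAC (le_trans (enorm_triangle _ _)) // lerD2l enormN enormZ gtr0_norm //.
rewrite ler_pM2l //; have := descent_lipschitz_grad (y k) K0 ff df fK.
by have := enorm_triangle (grad f (y k) - grad f a) (grad f a); rewrite subrK; lra.
Qed.

End prox_limit.

Section optimality_of_limits.
Context {dO dX : measure_display} {Omega : measurableType dO}
  {Xi : measurableType dX} {R : realType} {d L : nat}
  (P : probability Omega R) (f g : 'I_L -> 'rV[R]_d -> Xi -> R)
  (X : {RV P >-> L.-tuple Xi}).
Hypotheses
  (mf : forall i, measurable_fun [set: borel_rV R d * Xi] (fun p => f i p.1 p.2))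
  (mg : forall i, measurable_fun [set: borel_rV R d * Xi] (fun p => g i p.1 p.2))
  (cf : forall i s, convex_fun (f i ^~ s)) (cg : forall i s, convex_fun (g i ^~ s))
  (df : forall i s x, differentiable (f i ^~ s) x)
  (Ef : forall i x, ('E_P[fun w => `|f i x (tnth (X w) i)|%R] < +oo)%E)
  (Eg : forall i x, ('E_P[fun w => `|g i x (tnth (X w) i)|%R] < +oo)%E).

Let fg i x w := f i x (tnth (X w) i) + g i x (tnth (X w) i).

(** Real-valued form of the extended-real sum that defines [minimizers]; the two agree by
    integrability. *)
Definition objective x := \sum_(i < L) \int[P]_w fg i x w.

Let mtX i (h : Xi -> R) : measurable_fun setT h ->
  measurable_fun setT (fun w => h (tnth (X w) i)).
Proof.
move=> mh; exact: (measurableT_comp (measurable_tnth_comp i mh) (measurable_funP X)).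
Qed.

Let if_ i x : P.-integrable setT (EFin \o (fun w => f i x (tnth (X w) i))).
Proof.
apply/integrableP; split.
  by apply/measurable_EFinP; apply: mtX; exact: measurable_f_at.
by have := Ef i x; rewrite unlock.
Qed.

Let ig_ i x : P.-integrable setT (EFin \o (fun w => g i x (tnth (X w) i))).
Proof.
apply/integrableP; split.
  by apply/measurable_EFinP; apply: mtX; exact: measurable_g_at.
by have := Eg i x; rewrite unlock.
Qed.

Let ifg i x : P.-integrable setT (EFin \o fg i x).
Proof. exact: integrable_add. Qed.

Lemma minimizersE : minimizers f g X = [set x | forall y, objective x <= objective y].
Proof.
have FE x : (\sum_(i < L) 'E_P[fun w => (f i x (tnth (X w) i) + g i x (tnth (X w) i))%R])%E
    = (objective x)%:E.
  rewrite -sumEFin; apply: eq_bigr => i _; rewrite unlock /Rintegral fineK //.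
  exact: (integrable_fin_num measurableT (ifg i x)).
by apply/seteqP; split => x Hx y; have := Hx y; rewrite /= !FE lee_fin.
Qed.

Lemma objective_convex : convex_fun objective.
Proof.
move=> x y t t01; rewrite !mulr_sumr -big_split /=; apply: ler_sum => i _.
have i1 := integrable_scale t (ifg i x); have i2 := integrable_scale (1 - t) (ifg i y).
rewrite -!RintegralZl // -RintegralD //; apply: le_Rintegral => //.
  exact: integrable_add.
move=> w _; have := @cf i (tnth (X w) i) x y t t01; have := @cg i (tnth (X w) i) x y t t01.
by rewrite /fg /=; lra.
Qed.

(** The objective is finite and convex, hence continuous. Closedness makes the event that the limit
    is a minimizer measurable. *)
Lemma closed_minimizers : closed (minimizers f g X).
Proof.
rewrite minimizersE (_ : [set x | _] = \bigcap_y [set x | objective x <= objective y]).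
  apply: closed_bigI => y _.
  have -> : [set x | objective x <= objective y] = objective @^-1` [set r | r <= objective y] by [].
  apply: closed_comp; last exact: closed_le.
  by move=> x _; apply: convex_continuous; exact: objective_convex.
by apply/seteqP; split => [x H y _|x H y]; [exact: H|exact: (H y I)].
Qed.

Lemma measurable_minimizers : measurable (minimizers f g X : set (borel_rV R d)).
Proof.
rewrite -[X in measurable X]setCK; apply: measurableC; apply: sub_sigma_algebra.
exact/closed_openC/closed_minimizers.
Qed.

Section at_a_minimizer.
Variables (z : 'rV[R]_d) (phi : 'I_L -> Xi -> 'rV[R]_d) (K : 'I_L -> Xi -> R) (e : R).
Hypotheses (mphi : forall i, measurable_fun setT (phi i : Xi -> borel_rV R d))
  (mK : forall i, measurable_fun setT (K i)) (K0 : forall i s, 0 <= K i s)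
  (e0 : 0 < e) (rep : integrable_representation f g X (2 + e) z phi)
  (PG : P (X @^-1` (~` good f g z phi K)) = 0%E).

Local Notation good := (good f g z phi K).

(** The gap of a constant path: as the step vanishes, all intermediate points of a pass collapse to
    its starting point. *)
Definition limit_gap (x : 'rV[R]_d) (s : L.-tuple Xi) : R :=
  pass_gap (fun i y => f i y (tnth s i)) (fun i y => g i y (tnth s i)) z
    (fun i => phi i (tnth s i)) (fun=> x).

Lemma cvg_fb_pass s (c : nat -> R) (y : nat -> 'rV[R]_d) (x : 'rV[R]_d) i : good s ->
  (forall k, 0 < c k) -> c @ \oo --> (0 : R) -> y @ \oo --> x ->
  fb_pass f g (c k) (y k) s i @[k --> \oo] --> x.
Proof.
move=> Gs c0 cc yx; elim: i => [//|i IH] /=.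
case: insubP => [j _ ji|_] //=.
apply: cvg_prox_small_step => //; first exact: (good_subdiff (fun i s => @cg i s) j Gs).
apply: (cvg_forward_step (K0 j (tnth s j))) => //.
by move=> v; exact: (good_descent (fun i s => @cf i s) j v Gs).
Qed.

Lemma cvg_sample_gap s (c : nat -> R) (y : nat -> 'rV[R]_d) (x : 'rV[R]_d) : good s ->
  (forall k, 0 < c k) -> c @ \oo --> (0 : R) -> y @ \oo --> x ->
  sample_gap f g z phi (c k) (y k) s @[k --> \oo] --> limit_gap x s.
Proof.
move=> Gs c0 cc yx; apply: cvg_big => //; first exact: add_continuous.
move=> i _; have H j := @cvg_fb_pass s c y x j Gs c0 cc yx.
have cz j : fb_pass f g (c k) (y k) s j - z @[k --> \oo] --> x - z.
  by apply: cvgB => //; exact: cvg_cst.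
have cont (h : 'rV[R]_d -> R) j : convex_fun h ->
    h (fb_pass f g (c k) (y k) s j) @[k --> \oo] --> h x.
  by move=> hh; apply: (continuous_cvg _ (@convex_continuous _ _ _ hh x)).
apply: cvgD; apply: cvgB.
- by apply: cvgB; [exact: (cont (g i ^~ (tnth s i)))|exact: cvg_cst].
- by apply: cvg_dotv => //; exact: cvg_cst.
- by apply: cvgB; [exact: (cont (f i ^~ (tnth s i)))|exact: cvg_cst].
- by apply: cvg_dotv => //; exact: cvg_cst.
Qed.

Let limit_gap_ge0 x s : good s -> 0 <= limit_gap x s.
Proof.
move=> Gs; apply: pass_gap_ge0 => [i|i v|i]; [exact: cf|exact: df|].
exact: (good_subdiff (fun i s => @cg i s) i Gs).
Qed.

Let measurable_limit_gap x : measurable_fun setT (limit_gap x).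
Proof.
apply: measurable_sum => i.
have mfi y := measurable_tnth_comp i (@measurable_f_at _ _ _ _ _ _ mf i y).
have mgi y := measurable_tnth_comp i (@measurable_g_at _ _ _ _ _ _ mg i y).
have mz : measurable_fun [set: L.-tuple Xi] ((fun=> x - z) : _ -> borel_rV R d).
  exact: measurable_cst.
apply: measurable_funD; apply: measurable_funB.
- by apply: measurable_funB; [exact: mgi|exact: mgi].
- by apply: measurable_dotv => //; exact: (measurable_tnth_comp i (@mphi i)).
- by apply: measurable_funB; [exact: mfi|exact: mfi].
- by apply: measurable_dotv => //; exact: (measurable_tnth_comp i (measurable_gradz mf df z i)).
Qed.

(** On a constant path the linear terms of the Bregman gaps add up to the scalar product of the
    noise with [x - z], which is centred. Only the difference of the objectives remains. *)
Let integral_limit_gap x : P.-integrable setT (EFin \o (fun w => limit_gap x (X w))) /\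
  \int[P]_w limit_gap x (X w) = objective x - objective z.
Proof.
pose nz w := \sum_(j < d) (x - z) 0 j * sample_noise f z phi (X w) 0 j.
have noise j := integrable_noise_coord mf df e0 rep j.
have sumint (n : nat) (u : 'I_n -> Omega -> R) : (forall i, P.-integrable setT (EFin \o u i)) ->
    P.-integrable setT (EFin \o (fun w => \sum_(i < n) u i w)) /\
    \int[P]_w (\sum_(i < n) u i w) = \sum_(i < n) \int[P]_w u i w.
  move=> iu.
  have isum : P.-integrable setT (fun w => (\sum_(i < n) (u i w)%:E)%E).
    by apply: integrable_sum => // i _; exact: (iu i).
  have eqE w : (\sum_(i < n) (u i w)%:E)%E = (\sum_(i < n) u i w)%:E by rewrite sumEFin.
  split; first by apply: (eq_integrable _ _ _ _ isum) => // w _; rewrite /= eqE.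
  rewrite /Rintegral (eq_integral (fun w => (\sum_(i < n) (u i w)%:E)%E)); last first.
    by move=> w _; rewrite eqE.
  rewrite integral_sum // -[RHS]/(fine _%:E) -sumEFin; congr fine.
  by apply: eq_bigr => i _; rewrite fineK //; exact: (integrable_fin_num measurableT (iu i)).
have [inz Enz] := sumint _ (fun j w => (x - z) 0 j * sample_noise f z phi (X w) 0 j)
  (fun j => integrable_scale _ (noise j).1).
have Enz0 : \int[P]_w nz w = 0.
  by rewrite Enz big1 // => j _; rewrite RintegralZl ?(noise j).2 ?mulr0 //; exact: (noise j).1.
have [isx Esx] := sumint _ (fun i => fg i x) (fun i => ifg i x).
have [isz Esz] := sumint _ (fun i => fg i z) (fun i => ifg i z).
have gapE w : limit_gap x (X w) =
    \sum_(i < L) fg i x w + (- 1 * \sum_(i < L) fg i z w + - 1 * nz w).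
  have -> : nz w = dotv (sample_noise f z phi (X w)) (x - z).
    by rewrite /nz /dotv; apply: eq_bigr => j _; rewrite mulrC.
  rewrite /sample_noise /pass_noise dotv_suml !mulr_sumr -!big_split /=.
  apply: eq_bigr => i _; rewrite dotvDl /fg; ring.
have i2 := integrable_add (integrable_scale (- 1) isz) (integrable_scale (- 1) inz).
have i3 := integrable_add isx i2.
rewrite (_ : (fun w => limit_gap x (X w)) = (fun w => \sum_(i < L) fg i x w +
  (- 1 * \sum_(i < L) fg i z w + - 1 * nz w))); last by apply/funext.
split; first exact: i3.
rewrite (RintegralD measurableT isx i2) (RintegralD measurableT (integrable_scale (- 1) isz) (integrable_scale (- 1) inz)).
rewrite (RintegralZl _ measurableT isz) (RintegralZl _ measurableT inz) -/(nz) Enz0 Esx Esz /objective.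
by rewrite mulr0 addr0 mulN1r.
Qed.

(** The gaps are nonnegative on [good] and converge there pointwise to [limit_gap x]. Fatou's lemma
    then gives [objective x - objective z <= 0]. *)
Lemma cvg_gap_minimizer (c : nat -> R) (y : nat -> 'rV[R]_d) x :
  (forall k, 0 < c k) -> c @ \oo --> (0 : R) -> y @ \oo --> x ->
  (\int[distribution P X]_(s in good) (sample_gap f g z phi (c k) (y k) s)%:E)%E
    @[k --> \oo] --> 0%E ->
  minimizers f g X z -> minimizers f g X x.
Proof.
move=> c0 cc yx gap0; rewrite minimizersE => minz v.
have mG : measurable good by exact: measurable_good.
have msg k : measurable_fun good (fun s => (sample_gap f g z phi (c k) (y k) s)%:E).
  apply: measurable_funTS; apply/measurable_EFinP.
  have msk := measurable_sample_gap mf mg cg df z mphi (ltW (c0 k)).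
  have mp : measurable_fun setT (fun s : L.-tuple Xi => (y k : borel_rV R d, s)).
    by apply: measurable_fun_pair => //; exact: measurable_cst.
  exact: (measurableT_comp msk mp).
have ge0 k s : good s -> (0 <= (sample_gap f g z phi (c k) (y k) s)%:E)%E.
  by move=> Gs; rewrite lee_fin; apply: (sample_gap_ge0 cf cg df (K := K)).
have := fatou (distribution P X) mG msg ge0.
rewrite (cvg_limn_einf_sup gap0).1 (eq_integral (fun s => (limit_gap x s)%:E)); last first.
  move=> s /set_mem Gs; apply: (cvg_limn_einf_sup _).1.
  by apply/fine_cvgP; split; [exact: nearW|exact: cvg_sample_gap].
have mlg : measurable_fun setT (EFin \o limit_gap x) by exact/measurable_EFinP.
have mX : measurable_fun setT X by exact: measurable_funP.
have mr : measurable_fun setT ((fun s => (limit_gap x s)%:E) \_ good).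
  exact: (measurable_restrictT _ mG).1 (measurable_funTS mlg).
have [ilg Elg] := integral_limit_gap x.
have -> : (\int[distribution P X]_(s in good) (limit_gap x s)%:E = (\int[P]_w limit_gap x (X w))%:E)%E.
  rewrite integral_mkcond ge0_integral_distribution; last 2 first.
  - exact: mr.
  - by move=> s; rewrite /patch; case: ifPn => // /set_mem Gs; rewrite lee_fin limit_gap_ge0.
  rewrite /Rintegral fineK; last exact: (integrable_fin_num measurableT ilg).
  apply: ae_eq_integral; first exact: measurableT.
  - exact: (measurableT_comp mr mX).
  - exact: (measurableT_comp mlg mX).
  - exists (X @^-1` (~` good)); split => //.
      by rewrite -[X in measurable X]setTI; apply: mX => //; exact: measurableC.
    by move=> w /= H Gw; apply: H => _ /=; rewrite /patch mem_set.
rewrite lee_fin Elg => le0; apply: (@le_trans _ _ (objective z)); last exact: minz.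
by rewrite -subr_le0.
Qed.

End at_a_minimizer.
End optimality_of_limits.

(** * Step sequences *)

Section steps.
Context {R : realType}.
Implicit Types c : nat -> R.

Lemma nneseries_bounded_sums c (m : nat) : (forall n, (m <= n)%N -> 0 <= c n) ->
  (\sum_(m <= n <oo) (c n)%:E < +oo)%E ->
  exists C, forall n, \sum_(m <= k < n) c k <= C.
Proof.
move=> c0 clt; have c0' n : (m <= n)%N -> true -> (0 <= (c n)%:E)%E.
  by move=> mn _; rewrite lee_fin c0.
have fin : (\sum_(m <= n <oo) (c n)%:E)%E \is a fin_num.
  by rewrite ge0_fin_numE // nneseries_ge0.
exists (fine (\sum_(m <= n <oo) (c n)%:E)%E) => n.
by rewrite -lee_fin fineK // -sumEFin; exact: nneseries_lim_ge.
Qed.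

Lemma nneseries_unbounded_sums c (m : nat) : (forall n, (m <= n)%N -> 0 <= c n) ->
  (\sum_(m <= n <oo) (c n)%:E = +oo)%E ->
  forall C, exists n, C < \sum_(m <= k < n) c k.
Proof.
move=> c0 cy C; apply: contrapT => H.
have HC n : \sum_(m <= k < n) c k <= C.
  by rewrite leNgt; apply/negP => Cn; apply: H; exists n.
have : (\sum_(m <= n <oo) (c n)%:E <= C%:E)%E.
  apply: lime_le; first by apply: is_cvg_nneseries => n mn _; rewrite lee_fin c0.
  by apply: nearW => n; rewrite sumEFin lee_fin.
by rewrite cy leye_eq.
Qed.

Lemma cvg0_summable_sqr c (C : R) : (forall n, 0 < c n) ->
  (forall n, \sum_(0 <= k < n) c k ^+ 2 <= C) -> c @ \oo --> (0 : R).
Proof.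
move=> c0 cC.
have cs : cvgn (series (fun n => c n ^+ 2)).
  apply: nondecreasing_is_cvgn; first by apply: nondecreasing_series => n _ _; exact: sqr_ge0.
  by exists C => _ [n _ <-]; exact: cC.
have := cvg_series_cvg_0 cs => c20.
have -> : c = (fun n => Num.sqrt (c n ^+ 2)).
  by apply/funext => n; rewrite sqrtr_sqr gtr0_norm.
by rewrite -sqrtr0; apply: (continuous_cvg _ (@sqrt_continuous R 0)).
Qed.

(** If [u] stayed above [e] from [N] on, the weighted series would dominate [e] times the divergent
    series of the steps. *)
Lemma weighted_liminf c (u : nat -> \bar R) : (forall n, 0 < c n) ->
  (forall C, exists n, C < \sum_(0 <= k < n) c k) -> (forall n, (0 <= u n)%E) ->
  (\sum_(n <oo) (c n)%:E * u n < +oo)%E ->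
  forall (e : R) N, 0 < e -> exists2 n, (N <= n)%N & (u n < e%:E)%E.
Proof.
move=> c0 cy u0 cu e N e0; apply: contrapT => H.
have ue n : (N <= n)%N -> (e%:E <= u n)%E.
  by move=> Nn; rewrite leNgt; apply/negP => ?; apply: H; exists n.
have cu0 n : (0 <= (c n)%:E * u n)%E by rewrite mule_ge0 // lee_fin ltW.
have fin : (\sum_(n <oo) (c n)%:E * u n)%E \is a fin_num.
  by rewrite ge0_fin_numE // nneseries_ge0.
pose T := fine (\sum_(n <oo) (c n)%:E * u n)%E.
have le_T n : (\sum_(0 <= k < n) (c k)%:E * u k <= T%:E)%E.
  by rewrite fineK //; apply: nneseries_lim_ge.
(* The steps before [N] are unconstrained, and those after [N] can sum to at most [T / e]; exceeding
   this total is the contradiction. *)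
have [n] := cy (\sum_(0 <= k < N) c k + T / e).
apply/negP; rewrite -leNgt; have [nN|Nn] := leqP n N.
  rewrite [in leRHS](@big_cat_nat _ _ _ n 0 N) //= -addrA lerDl addr_ge0 //.
    by rewrite sumr_ge0 // => k _; exact: ltW.
  by rewrite divr_ge0 ?(ltW e0) // fine_ge0 // nneseries_ge0.
have Nn' : (N <= n)%N by exact: ltnW.
rewrite (big_cat_nat (leq0n N) Nn') /= lerD2l ler_pdivlMr // mulr_suml.
rewrite -lee_fin -sumEFin; apply: le_trans (le_T n).
rewrite [in leRHS](big_cat_nat (leq0n N) Nn') /=.
rewrite (@le_trans _ _ (\sum_(N <= k < n) (c k)%:E * u k)%E) //.
  rewrite big_nat [leRHS]big_nat; apply: lee_sum => k /andP[Nk _].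
  by rewrite EFinM lee_wpmul2l ?lee_fin ?(ltW (c0 _)) // ue.
by rewrite leeDr // sume_ge0.
Qed.

End steps.

(** * Opial's argument *)

Section opial.
Context {R : realType} {d : nat}.

(** First select indices [t] along which [u] is small, then extract from the bounded sequence
    [x \o t], so that both properties hold together. Indices with [k <= s k] are enough for passing
    to limits. *)
Lemma cluster_subsequence (x : nat -> 'rV[R]_d) (u : nat -> \bar R) (z : 'rV[R]_d) :
  cvgn (fun n => enorm (x n - z) ^+ 2) ->
  (forall (e : R) N, 0 < e -> exists2 n, (N <= n)%N & (u n < e%:E)%E) ->
  exists (xb : 'rV[R]_d) (s : nat -> nat), forall k, [/\ (k <= s k)%N,
    (u (s k) < k.+1%:R^-1%:E)%E & enorm (x (s k) - xb) < k.+1%:R^-1].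
Proof.
move=> cx Hu.
have k0 k : 0 < k.+1%:R^-1 :> R by rewrite invr_gt0 ltr0n.
have /choice[t Ht] : forall k, exists n, (k <= n)%N /\ (u n < k.+1%:R^-1%:E)%E.
  by move=> k; have [n ? ?] := Hu _ k (k0 k); exists n.
have [M HM] : exists M, forall n, enorm (x n - z) <= M.
  have /cvg_seq_bounded/bounded_fun_has_ubound[M HM] := cx.
  exists (1 + M) => n; have := HM _ (imageT _ n) => /= h.
  by have := sqr_ge0 (enorm (x n - z) - 1); have := enorm_ge0 (x n - z); nra.
have [xb [_ cl]] : [set v : 'rV[R]_d | `|v - z| <= M] `&` cluster ((x \o t) @ \oo) !=set0.
  apply: compact_closed_ball; exists 0%N => // k _ /=.
  exact: le_trans (norm_le_enorm _) (HM (t k)).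
exists xb.
(* The cluster point is for the sup norm; dividing by [d.+1] leaves room for the passage to the
   Euclidean norm, also when [d] is 0. *)
have /choice[s Hs] : forall k, exists j, (k <= j)%N /\ `|x (t j) - xb| < k.+1%:R^-1 / d.+1%:R.
  move=> k.
  have [||v [[j kj ->] xj]] := cl [set v | exists2 j, (k <= j)%N & v = x (t j)]
    [set v | `|v - xb| < k.+1%:R^-1 / d.+1%:R].
  - by exists k => // j kj; exists j.
  - apply/(@nbhs_normP R 'rV[R]_d); exists (k.+1%:R^-1 / d.+1%:R) => /=.
      by rewrite divr_gt0 ?ltr0n.
    by move=> v; rewrite /ball_ /= distrC.
  - by exists j.
exists (t \o s) => k; have [ks xs] := Hs k; have [st ut] := Ht (s k); split => //=.
- exact: leq_trans ks st.
- by apply: (lt_le_trans ut); rewrite lee_fin lef_pV2 ?posrE ?ltr0n // ler_nat.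
- rewrite (le_lt_trans (enorm_le_norm _)) // (@le_lt_trans _ _ (d.+1%:R * `|x (t (s k)) - xb|)) //.
    by rewrite ler_wpM2r // ler_nat.
  by rewrite mulrC -ltr_pdivlMr // ltr0n.
Qed.

(* The distances to the points of [Z] converge, and along [s] the distance to a
   point of [zs] close to [xb] is small. *)
Lemma opial_cvg (Z : set 'rV[R]_d) (zs : nat -> 'rV[R]_d) (x : nat -> 'rV[R]_d)
    (s : nat -> nat) (xb : 'rV[R]_d) :
  (forall z (e : R), Z z -> 0 < e -> exists m, enorm (zs m - z) < e) ->
  (forall m, cvgn (fun n => enorm (x n - zs m) ^+ 2)) ->
  Z xb -> (forall k, (k <= s k)%N) -> x (s k) @[k --> \oo] --> xb ->
  x @ \oo --> xb.
Proof.
move=> dense cx Zxb sk xs; apply/cvg_enormP; apply/cvgrPdist_le => e e0.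
have e4 : 0 < e / 4 by rewrite divr_gt0.
have [m zm] := dense _ _ Zxb e4.
have [l ul] : exists l : R, enorm (x n - zs m) @[n --> \oo] --> l.
  have /cvg_ex[l2 h2] := cx m; exists (Num.sqrt l2).
  rewrite (_ : (fun n => _) = (fun n => Num.sqrt (enorm (x n - zs m) ^+ 2))); last first.
    by apply/funext => n; rewrite sqrtr_sqr ger0_norm ?enorm_ge0.
  by apply: (continuous_cvg _ (@sqrt_continuous R l2)).
have le_l : l <= e / 4.
  have sub : enorm (x (s k) - zs m) @[k --> \oo] --> l.
    apply: (cvg_comp _ _ _ ul); apply/cvgnyPge => N; exists N => // k /= Nk.
    exact: leq_trans Nk (sk k).
  have lim : enorm (x (s k) - zs m) @[k --> \oo] --> enorm (xb - zs m).
    by apply: cvg_enorm; apply: cvgB => //; exact: cvg_cst.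
  have -> : l = enorm (xb - zs m).
    by rewrite -(cvg_lim (@Rhausdorff R) sub); exact: (cvg_lim (@Rhausdorff R) lim).
  by rewrite enormB ltW.
move/cvgrPdist_le : ul => /(_ _ e4); apply: filterS => n hn.
rewrite sub0r normrN ger0_norm ?enorm_ge0 //.
rewrite -(subrKA (zs m)) (le_trans (enorm_triangle _ _)) //.
by move: hn; rewrite ler_norml => /andP[]; lra.
Qed.

(** [Z] may contain no rational point, so a point of [Z] is chosen in each rational ball that meets
    it. The point [z0] is the default for the other balls and for integers that encode no ball. *)
Lemma dense_sequence (Z : set 'rV[R]_d) : Z !=set0 ->
  exists zs : nat -> 'rV[R]_d, (forall m, Z (zs m)) /\
    forall z (e : R), Z z -> 0 < e -> exists m, enorm (zs m - z) < e.
Proof.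
move=> [z0 Zz0].
pose ok (p : 'rV[rat]_d * nat) z := Z z /\ enorm (z - ratv p.1) < p.2.+1%:R^-1.
have /choice[pt Hpt] : forall p : 'rV[rat]_d * nat, exists y,
    Z y /\ ((exists z, ok p z) -> ok p y).
  move=> p; have [[z okz]|nok] := pselect (exists z, ok p z).
    by exists z; split => //; case: okz.
  by exists z0.
exists (fun m => if @choice.unpickle ('rV[rat]_d * nat)%type m is Some p then pt p else z0); split.
  by move=> m; case: choice.unpickle => // p; have [] := Hpt p.
move=> z e Zz e0.
have [n ne] : exists n, n.+1%:R^-1 < e / 2.
  by have [n] := ltr_add_invr (divr_gt0 e0 (ltr0n R 2)); rewrite add0r; exists n.
have n0 : 0 < n.+1%:R^-1 / d.+1%:R :> R by rewrite divr_gt0 ?invr_gt0 ?ltr0n.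
have [q zq] := ratv_dense z n0.
have zq' : enorm (z - ratv q) < n.+1%:R^-1.
  rewrite (le_lt_trans (enorm_le_norm _)) // (@le_lt_trans _ _ (d.+1%:R * `|z - ratv q|)) //.
    by rewrite ler_wpM2r // ler_nat.
  by rewrite mulrC -ltr_pdivlMr // ltr0n.
exists (choice.pickle (q, n)); rewrite choice.pickleK.
have [_ /(_ (ex_intro _ z (conj Zz zq')))[_ /= h]] := Hpt (q, n).
rewrite -(subrKA (ratv q)) (le_lt_trans (enorm_triangle _ _)) // [enorm (ratv q - z)]enormB.
by move: h zq' ne => /=; move: (n.+1%:R^-1) (enorm _) (enorm _) => a b c; lra.
Qed.

End opial.

(** * Almost sure convergence *)

Section run.
Context {dO dX : measure_display} {Omega : measurableType dO}
  {Xi : measurableType dX} {R : realType} {d L : nat}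
  (P : probability Omega R) (f g : 'I_L -> 'rV[R]_d -> Xi -> R)
  (X : {RV P >-> L.-tuple Xi}) (Xs : nat -> {RV P >-> L.-tuple Xi}).
Hypotheses (L0 : (0 < L)%N) (iid : iid_copies X Xs)
  (mf : forall i, measurable_fun [set: borel_rV R d * Xi] (fun p => f i p.1 p.2))
  (mg : forall i, measurable_fun [set: borel_rV R d * Xi] (fun p => g i p.1 p.2))
  (cf : forall i s, convex_fun (f i ^~ s)) (cg : forall i s, convex_fun (g i ^~ s))
  (df : forall i s x, differentiable (f i ^~ s) x).

Variables (c : nat -> R) (C : R) (x0 : 'rV[R]_d) (x : nat -> Omega -> 'rV[R]_d).
Hypotheses (c0 : forall n, 0 < c n)
  (cC : forall n, \sum_(0 <= k < n) c k ^+ 2 <= C)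
  (x00 : forall w, x 0%N w = x0)
  (xS : forall n w, x n.+1 w = fb_pass f g (c n) (x n w) (Xs n w) L).

Let steps n w i := fb_pass f g (c n) (x n w) (Xs n w) i.

Lemma run_almost_sure (z : 'rV[R]_d) (phi : 'I_L -> Xi -> 'rV[R]_d)
    (K : 'I_L -> Xi -> R) (e : R) :
  (forall i, measurable_fun setT (phi i : Xi -> borel_rV R d)) ->
  (forall i, measurable_fun setT (K i)) -> (forall i s, 0 <= K i s) -> 0 < e ->
  integrable_representation f g X (2 + e) z phi ->
  (forall i a, 0 < a -> ('E_P[fun w => (K i (tnth (X w) i) `^ a)%R] < +oo)%E) ->
  P (X @^-1` (~` good f g z phi K)) = 0%E ->
  {ae P, forall w, [/\ cvgn (fun n => enorm (x n w - z) ^+ 2),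
    forall i : 'I_L, enorm (steps n w i.+1 - steps n w i) @[n --> \oo] --> (0 : R) &
    (\sum_(n <oo) (c n)%:E * \int[distribution P X]_(s in good f g z phi K)
      (sample_gap f g z phi (c n) (x n w) s)%:E < +oo)%E]}.
Proof.
move=> mphi mK K0 e0 rep Kmom PG; set G := good f g z phi K.
have mG : measurable G by exact: measurable_good.
(* A bound on the steps uniform in [n]: [1 + C] serves as [c1] in the pass inequality, so that [B]
   does not depend on [n]. *)
have c1P n : c n <= 1 + C.
  have : c n ^+ 2 <= C.
    apply: le_trans (cC n.+1); rewrite big_nat_recr //= lerDr.
    by apply: sumr_ge0 => k _; exact: sqr_ge0.
  by have := sqr_ge0 (c n - 1); have := ltW (c0 n); nra.
have C0 : 0 <= C by have := cC 0%N; rewrite big_geq.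
have c11 : 1 <= 1 + C by rewrite lerDl.
(* Gap and moves share one decrease term: its pathwise series controls the moves, its integrated
   series the gap. *)
pose D n y s := 2 * c n * sample_gap f g z phi (c n) y s + 4^-1 * sample_move f g (c n) y s.
have gap0 n y s : G s -> 0 <= sample_gap f g z phi (c n) y s.
  by move=> Gs; exact: (sample_gap_ge0 (fun i s => @cf i s) (fun i s => @cg i s) (fun i s x => @df i s x) _ _ Gs).
have move0 n y s : 0 <= sample_move f g (c n) y s.
  by apply: sumr_ge0 => i _; exact: sqr_ge0.
have msg n := measurable_sample_gap mf mg cg df z mphi (ltW (c0 n)).
have msm n := measurable_sample_move mf mg cg df (ltW (c0 n)).
pose zeta s : 'rV[R]_d := 2 *: sample_noise f z phi s.
pose B s := @pass_const R L (1 + C) * sample_bound f z phi K s ^+ 2.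
have pc0 : 0 <= @pass_const R L (1 + C).
  by rewrite addr_ge0 // mulr_ge0 // ?sqr_ge0 // mulr_ge0.
have mPhi n : measurable_fun [set: borel_rV R d * L.-tuple Xi]
    ((fun p => fb_pass f g (c n) p.1 p.2 L) : _ -> borel_rV R d).
  by apply: measurable_fb_pass => //; exact: ltW.
have mzeta : measurable_fun setT (zeta : L.-tuple Xi -> borel_rV R d).
  by apply: measurable_rVZ; exact: measurable_sample_noise.
have izeta : P.-integrable setT (EFin \o (fun w => enorm (zeta (X w)) ^+ 2)).
  exact: (integrable_sample_noise mf df mphi mK K0 e0 rep Kmom).
have Ezeta j : (\int[P]_w (zeta (X w) 0 j)%:E = 0)%E.
  have [inoise Enoise] := integrable_noise_coord mf df e0 rep j.
  rewrite (_ : (fun w => _) = (fun w => (2%:E * (sample_noise f z phi (X w) 0 j)%:E)%E)).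
    rewrite integralZl // -(fineK (integrable_fin_num measurableT inoise)).
    by rewrite [fine _]Enoise mule0.
  by apply/funext => w; rewrite /zeta mxE.
have mB : measurable_fun setT B.
  by apply: measurable_funM => //; apply: measurable_funX; exact: measurable_sample_bound.
have B0 s : 0 <= B s by rewrite mulr_ge0 ?sqr_ge0.
have iB : P.-integrable setT (EFin \o (B \o X)).
  exact: (integrable_scale _ (integrable_sample_bound mf df mphi mK K0 e0 rep Kmom)).
have mD n : measurable_fun [set: borel_rV R d * L.-tuple Xi] (fun p => D n p.1 p.2).
  by apply: measurable_funD; apply: measurable_funM.
have D0 n y s : G s -> 0 <= D n y s.
  by move=> Gs; rewrite addr_ge0 // mulr_ge0 ?gap0 ?mulr_ge0 ?(ltW (c0 n)).
have fejer n y s : G s -> enorm (fb_pass f g (c n) y s L - z) ^+ 2 <=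
    enorm (y - z) ^+ 2 - D n y s - c n * dotv (zeta s) (y - z)
    + c n ^+ 2 * (B s * (1 + enorm (y - z) ^+ 2)).
  move=> Gs; exact: (sample_inequality L0 (fun i s => @cf i s) (fun i s => @cg i s)
    (fun i s x => @df i s x) (fun i s => @K0 i s) y (c0 n) (c1P n) c11 Gs).
have := fejer_almost_sure iid mG PG mPhi x00 xS cC mzeta izeta Ezeta mB B0 iB mD D0 fejer.
have := ae_samples iid mG PG; apply: filterS2 => w Gw [h1 h2 h3]; split => //.
- move=> i; have move_cvg : sample_move f g (c n) (x n w) (Xs n w) @[n --> \oo] --> (0 : R).
    have := cvg_series_cvg_0 h2 => D_0.
    apply: (@squeeze_cvgr _ _ _ _ (fun=> 0) (fun n => 4 * D n (x n w) (Xs n w))).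
    + apply: nearW => n; rewrite move0 /=.
      have : 0 <= 2 * c n * sample_gap f g z phi (c n) (x n w) (Xs n w).
        by rewrite mulr_ge0 ?gap0 ?mulr_ge0 ?(ltW (c0 n)).
      by rewrite /D; lra.
    + exact: cvg_cst.
    + by rewrite -(mulr0 (4 : R)); exact: (cvgM (cvg_cst _) D_0).
  have := continuous_cvg _ (@sqrt_continuous R 0) move_cvg; rewrite sqrtr0 => sq0.
  apply: (@squeeze_cvgr _ _ _ _ (fun=> 0)
    (fun n => Num.sqrt (sample_move f g (c n) (x n w) (Xs n w)))); last 2 first.
  + exact: cvg_cst.
  + exact: sq0.
  apply: nearW => n; rewrite enorm_ge0 /= -[leLHS]ger0_norm ?enorm_ge0 // -sqrtr_sqr.
  rewrite ler_wsqrtr // /sample_move /pass_move (bigD1 i) //= lerDl.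
  by apply: sumr_ge0 => j _; exact: sqr_ge0.
(* The integrated gap with weight [c n] is dominated by the integral of [D], whose gap weight is
   [2 * c n] and whose moves are nonnegative. *)
- apply: le_lt_trans h3; apply: lee_nneseries => [n _ _|n _].
    apply: mule_ge0; first by rewrite lee_fin ltW.
    by apply: integral_ge0 => s Gs; rewrite lee_fin gap0.
  have mpair : measurable_fun setT (fun s : L.-tuple Xi => (x n w : borel_rV R d, s)).
    by apply: measurable_fun_pair => //; exact: measurable_cst.
  have mgn := measurable_funTS (measurableT_comp (@msg n) mpair) (D := G).
  have mDn := measurable_funTS (measurableT_comp (@mD n) mpair) (D := G).
  rewrite -ge0_integralZl //; last 3 first.
  - by apply/measurable_EFinP; exact: mgn.
  - by move=> s Gs; rewrite lee_fin gap0.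
  - by rewrite lee_fin ltW.
  apply: ge0_le_integral => //.
  - by move=> s Gs; rewrite mule_ge0 ?lee_fin ?gap0 ?ltW.
  - by apply/measurable_EFinP; apply: measurable_funM => //; exact: mgn.
  - by apply/measurable_EFinP; exact: mDn.
  move=> s Gs; rewrite -EFinM lee_fin /D.
  by have := mulr_ge0 (ltW (c0 n)) (gap0 n (x n w) s Gs); have := move0 n (x n w) s; lra.
Qed.

Hypotheses (cy : forall A, exists n, A < \sum_(0 <= k < n) c k)
  (Ef : forall i x, ('E_P[fun w => `|f i x (tnth (X w) i)|%R] < +oo)%E)
  (Eg : forall i x, ('E_P[fun w => `|g i x (tnth (X w) i)|%R] < +oo)%E)
  (lip : assumption_lipschitz f X) (repr : assumption_representation f g X).

Lemma run_converges : {ae P, forall w, exists2 xb, minimizers f g X xb &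
  forall i, (i <= L)%N -> steps n w i @[n --> \oo] --> xb}.
Proof.
have /choice[K HK] := lip.
have mK i : measurable_fun setT (K i) by have [] := HK i.
have K0 i s : 0 <= K i s by have [] := HK i.
have Kmom i (a : R) : 0 < a -> ('E_P[fun w => (K i (tnth (X w) i) `^ a)%R] < +oo)%E.
  by have [_ _ _ h] := HK i; exact: h.
have good_ae z phi e : integrable_representation f g X (2 + e) z phi ->
    P (X @^-1` (~` good f g z phi K)) = 0%E.
  move=> [[mphi _ gphi _] _]; apply: (@prob_good _ _ _ _ _ f g mf mg cf df z phi K mphi mK
    _ _ P X gphi) => i.
  by have [] := HK i.
have [zs [Zzs dense]] := dense_sequence repr.1.
have cvg_ae : {ae P, forall w, forall m, cvgn (fun n => enorm (x n w - zs m) ^+ 2)}.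
  apply/ae_foralln => m; have [e e0 [phi rep]] := repr.2 _ (Zzs m).
  have [[mphi _ _ _] _] := rep.
  by apply: filterS (run_almost_sure mphi mK K0 e0 rep Kmom (good_ae _ _ _ rep)) => w [].
(* The gap is needed at one minimizer only: a vanishing mean gap at [zs 0] already makes the cluster
   point a minimizer. The other [zs m] serve for their distances. *)
have [e e0 [phi rep]] := repr.2 _ (Zzs 0%N).
have [[mphi _ _ _] _] := rep.
have PG := good_ae _ _ _ rep.
have := run_almost_sure mphi mK K0 e0 rep Kmom PG.
apply: filterS2 cvg_ae => w cz [_ move0 csum].
set u := fun n => (\int[distribution P X]_(s in good f g (zs 0%N) phi K)
      (sample_gap f g (zs 0%N) phi (c n) (x n w) s)%:E)%E in csum.
have u0 n : (0 <= u n)%E.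
  apply: integral_ge0 => s Gs; rewrite lee_fin.
  exact: (sample_gap_ge0 (fun i s => @cf i s) (fun i s => @cg i s) (fun i s x => @df i s x) _ _ Gs).
have [xb [s Hs]] := cluster_subsequence (cz 0%N) (weighted_liminf c0 cy u0 csum).
have xs : x (s k) w @[k --> \oo] --> xb.
  apply/(cvg_enormP eventually_filter).
  apply: (@squeeze_cvgr _ _ _ _ (fun=> 0) (@harmonic R)); last 2 first.
  - exact: cvg_cst.
  - exact: cvg_harmonic.
  by apply: nearW => k; have [_ _ /ltW h] := Hs k; rewrite enorm_ge0.
have cs : c (s k) @[k --> \oo] --> (0 : R).
  apply: (cvg_comp _ _ _ (cvg0_summable_sqr c0 cC)).
  by apply/cvgnyPge => N; exists N => // k /= Nk; have [/(leq_trans Nk)] := Hs k.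
have us : u (s k) @[k --> \oo] --> 0%E.
  apply: (@squeeze_cvge _ _ _ _ (fun=> 0%E) _ (EFin \o @harmonic R)).
  - by apply: nearW => k; have [_ /ltW h _] := Hs k; rewrite u0.
  - exact: cvg_cst.
  - by apply: cvg_EFin; [exact: nearW|exact: cvg_harmonic].
have Zxb : minimizers f g X xb.
  exact: (cvg_gap_minimizer mf mg cf cg df Ef Eg mphi mK K0 e0 rep PG
    (fun k => c0 (s k)) cs xs us (Zzs 0%N)).
exists xb => //.
have xxb : x n w @[n --> \oo] --> xb.
  by apply: (opial_cvg dense cz Zxb _ xs) => k; have [] := Hs k.
(* Consecutive intermediate points differ by a vanishing displacement, so the limit of [x n w]
   propagates through the pass. *)
elim=> [_|i IH iL]; first exact: xxb.
have d0 : steps n w i.+1 - steps n w i @[n --> \oo] --> (0 : 'rV[R]_d).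
  apply/(cvg_enormP eventually_filter).
  by under eq_fun do rewrite subr0; exact: (move0 (Ordinal iL)).
rewrite -(add0r xb) (_ : (fun n => _) = (fun n => (steps n w i.+1 - steps n w i) + steps n w i)).
  exact: (cvgD d0 (IH (ltnW iL))).
by apply/funext => n; rewrite subrK.
Qed.

End run.

Section limit_variable.
Context {dO : measure_display} {Omega : measurableType dO} {R : realType}
  (P : probability Omega R) {d : nat} (x : nat -> Omega -> 'rV[R]_d).
Hypothesis mx : forall n, measurable_fun setT (x n : Omega -> borel_rV R d).

(* The upper limit exists for every [w] and is measurable in it; off the event of
   convergence the value is irrelevant. *)
Let y w : 'rV[R]_d := \row_j fine (limn_esup (fun n => (x n w 0 j)%:E)).

Let my : measurable_fun setT (y : Omega -> borel_rV R d).
Proof.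
apply: measurable_rV => j.
rewrite (_ : (fun w => _) = fine \o (fun w => limn_esup (fun n => (x n w 0 j)%:E))).
  apply: measurableT_comp => //; apply: measurable_fun_limn_esup => n.
  by apply/measurable_EFinP; exact: measurable_rVP.
by apply/funext => w; rewrite mxE.
Qed.

Lemma limit_variable : exists Y : {RV P >-> borel_rV R d},
  forall w (l : 'rV[R]_d), x n w @[n --> \oo] --> l -> Y w = l.
Proof.
pose Y : {RV P >-> borel_rV R d} := HB.pack (y : Omega -> borel_rV R d)
  (isMeasurableFun.Build _ _ _ _ (y : Omega -> borel_rV R d) my).
exists Y => w l xl; apply/rowP => j; rewrite mxE.
have : (x n w 0 j)%:E @[n --> \oo] --> (l 0 j)%:E.
  by apply: cvg_EFin; [exact: nearW|exact: cvg_coord].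
by move=> /cvg_limn_einf_sup[_ ->].
Qed.

End limit_variable.

Lemma iterates_fb_pass {dO dX : measure_display} {Omega : measurableType dO}
    {Xi : measurableType dX} {R : realType} {P : probability Omega R} {d L : nat}
    (f g : 'I_L -> 'rV[R]_d -> Xi -> R) gamma (xis : nat -> {RV P >-> L.-tuple Xi})
    x0 (x : nat -> Omega -> 'rV[R]_d) (xbar : nat -> nat -> Omega -> 'rV[R]_d) :
  iterates f g gamma xis x0 x xbar -> forall n w i, (i <= L)%N ->
  xbar n.+1 i w = fb_pass f g (gamma n.+1) (x n w) (xis n.+1 w) i.
Proof.
move=> hx n w; have [_ /(_ n)[b0 bS _]] := hx w.
elim=> [_|i IH iL]; first exact: b0.
by rewrite (bS (Ordinal iL)) (fb_passS f g _ _ _ (Ordinal iL)) /= IH // ltnW.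
Qed.

Theorem theorem1 (R : realType) (d L : nat) (hL : (1 <= L)%N)
    (dO dX : measure_display)
    (Omega : measurableType dO) (Xi : measurableType dX)
    (P : probability Omega R)
    (f g : 'I_L -> 'rV[R]_d -> Xi -> R)
    (xi : {RV P >-> L.-tuple Xi})
    (gamma : nat -> R)
    (xis : nat -> {RV P >-> L.-tuple Xi})
    (x0 : 'rV[R]_d)
    (x : nat -> Omega -> 'rV[R]_d)
    (xbar : nat -> nat -> Omega -> 'rV[R]_d)
    (h1 : assumption_integrands f g xi)
    (h2 : assumption_steps gamma)
    (h3 : assumption_lipschitz f xi)
    (h4 : assumption_representation f g xi)
    (h5 : assumption_subgradient g xi)
    (hxis : iid_copies xi (fun n => xis n.+1))
    (hx : iterates f g gamma xis x0 x xbar) :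
  exists Xstar : {RV P >-> borel_rV R d},
    [/\ P (Xstar @^-1` minimizers f g xi) = 1%E,
        {ae P, forall w, x n w @[n --> \oo] --> (Xstar w : 'rV[R]_d)} &
        forall i, (i < L)%N ->
          {ae P, forall w, xbar n i w @[n --> \oo] --> (Xstar w : 'rV[R]_d)}].
Proof.
have mf i : measurable_fun [set: borel_rV R d * Xi] (fun p => f i p.1 p.2).
  by have [[[]]] := h1 i.
have mg i : measurable_fun [set: borel_rV R d * Xi] (fun p => g i p.1 p.2).
  by have [[_ []]] := h1 i.
have cf i s : convex_fun (f i ^~ s).
  by have [[[_ cf] _] _ _] := h1 i; exact: convex_function_fun.
have cg i s : convex_fun (g i ^~ s).
  by have [[_ [_ cg]] _ _] := h1 i; exact: convex_function_fun.
have df i s y : differentiable (f i ^~ s) y by have [_ _] := h1 i; exact.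
have Ef i y : ('E_P[fun w => `|f i y (tnth (xi w) i)|%R] < +oo)%E.
  by have [_ /(_ y)[]] := h1 i.
have Eg i y : ('E_P[fun w => `|g i y (tnth (xi w) i)|%R] < +oo)%E.
  by have [_ /(_ y)[]] := h1 i.
have [gamma0 gammay gamma2 _] := h2.
(* The shift leaves out [gamma 0], on which nothing is assumed: pass [n] uses step and sample of
   index [n.+1]. *)
pose c n := gamma n.+1.
have c0 n : 0 < c n by exact: gamma0.
have [C cC] : exists C, forall n, \sum_(0 <= k < n) c k ^+ 2 <= C.
  have [|C HC] := nneseries_bounded_sums _ gamma2; first by move=> n _; exact: sqr_ge0.
  by exists C => n; have := HC n.+1; rewrite big_add1.
have cy A : exists n, A < \sum_(0 <= k < n) c k.
  (* The maximum with 0 rules out the index 0, whose partial sum is empty, so that the sum can be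
     shifted by one. *)
  have [|[|n] Hn] := nneseries_unbounded_sums _ gammay (Num.max A 0).
  - by move=> n /gamma0/ltW.
  - by move: Hn; rewrite big_geq // gt_max ltxx andbF.
  by exists n; move: Hn; rewrite big_add1 /= gt_max => /andP[].
have x00 w : x 0%N w = x0 by have [] := hx w.
have xbarE := iterates_fb_pass hx.
have xS n w : x n.+1 w = fb_pass f g (c n) (x n w) (xis n.+1 w) L.
  by have [_ /(_ n)[_ _ ->]] := hx w; rewrite xbarE.
have mPhi n : measurable_fun [set: borel_rV R d * L.-tuple Xi]
    ((fun p => fb_pass f g (c n) p.1 p.2 L) : _ -> borel_rV R d).
  by apply: measurable_fb_pass => //; exact: ltW.
have mx n : measurable_fun setT (x n : Omega -> borel_rV R d).
  have ad := @adapted _ _ _ _ R P (fun n => xis n.+1) d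
    (fun n y s => fb_pass f g (c n) y s L) x0 x mPhi x00 xS n.
  exact: (measurable_history ad).
have [Y HY] := limit_variable P mx.
have ae_lim : {ae P, forall w, minimizers f g xi (Y w) /\
    forall i, (i <= L)%N ->
      fb_pass f g (c n) (x n w) (xis n.+1 w) i @[n --> \oo] --> (Y w : 'rV[R]_d)}.
  have := @run_converges _ _ _ _ _ _ _ P f g xi _ hL hxis mf mg cf cg df c C x0 x c0 cC
    x00 xS cy Ef Eg h3 h4.
  apply: filterS => w [l Zl xl].
  by rewrite (HY w l (xl 0%N isT)).
have mZ : measurable (minimizers f g xi : set (borel_rV R d)).
  exact: (measurable_minimizers mf mg cf cg Ef Eg).
exists Y; split.
- have mYZ : measurable (Y @^-1` minimizers f g xi).
    by rewrite -[X in measurable X]setTI; apply: measurable_funP.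
  have : P (~` (Y @^-1` minimizers f g xi)) = 0%E.
    apply/(negligibleP _ (measurableC mYZ)).
    by apply: filterS ae_lim => w [].
  rewrite probability_setC // => /eqP; rewrite sube_eq // add0e => /eqP.
  by [].
- by apply: filterS ae_lim => w [_ /(_ 0%N isT)].
move=> i iL; apply: filterS ae_lim => w [_ /(_ i (ltnW iL)) h].
(* The values of [xbar] at index 0 are arbitrary; the limit is taken along [n.+1]. *)
rewrite -cvg_shiftS.
have xbar_pass : [sequence xbar n.+1 i w]_n =
    (fun n => fb_pass f g (c n) (x n w) (xis n.+1 w) i).
  by apply/funext => n; rewrite /= xbarE // ltnW.
by rewrite xbar_pass.
Qed.
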